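(* For $n\ge1$ there is a homotopy equivalence $$\Sigma K_n\simeq S^2\vee\bigvee_{\text{even } i>0}\tbinom{n-1}{i}\bigl(S^{i+1}\vee S^{i+2}\bigr)\vee\bigvee_{\text{odd } i}\tbinom{n-1}{i}M^{i+2}(2),$$ where $M^{i+2}(2)=S^{i+1}\cup_2e^{i+2}$ is the mod-2 Moore space and $\binom{n-1}{i}Y$ denotes a wedge of $\binom{n-1}{i}$ copies of $Y$.
   Context: $\Sigma$ denotes (reduced) suspension. $K_n=(S^1)^n/\bigl((z_1,\ldots,z_{n-1},z_n)\sim(\overline{z}_1,\ldots,\overline{z}_{n-1},-z_n)\bigr)$, where $S^1\subset\mathbb{C}$ is the unit circle and $\overline{z}$ is complex conjugation. *)

(* Defs.v *)
From HB Require Import structures.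
From mathcomp Require Import all_boot all_order all_algebra generic_quotient.
From mathcomp Require Import all_classical all_reals topology.
From mathcomp Require Import normedtype homotopy.
Import numFieldNormedType.Exports.
Set Implicit Arguments. Unset Strict Implicit. Unset Printing Implicit Defensive.
Import Order.TTheory GRing.Theory Num.Theory.
Local Open Scope classical_set_scope.
Local Open Scope ring_scope.
Local Open Scope quotient_scope.

Section GenQuot.
Context {T : topologicalType} (r : T -> T -> Prop).

Definition gen_equiv (a b : T) : Prop :=
  forall E : T -> T -> Prop,
    (forall x y, r x y -> E x y) -> (forall x, E x x) ->
    (forall x y, E x y -> E y x) -> (forall x y z, E x y -> E y z -> E x z) ->
    E a b.

Definition gen_equivb (a b : T) : bool := `[< gen_equiv a b >].

Lemma gen_equivb_refl : reflexive gen_equivb.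
Proof. by move=> x; apply/asboolP => E _ Er _ _. Qed.
Lemma gen_equivb_sym : symmetric gen_equivb.
Proof.
move=> x y; rewrite /gen_equivb; apply/asboolP/asboolP => H E h1 h2 h3 h4;
  exact: h3 _ _ (H E h1 h2 h3 h4).
Qed.
Lemma gen_equivb_trans : transitive gen_equivb.
Proof.
move=> y x z /asboolP H1 /asboolP H2; apply/asboolP => E h1 h2 h3 h4.
exact: h4 _ y _ (H1 E h1 h2 h3 h4) (H2 E h1 h2 h3 h4).
Qed.

Definition gen_equiv_rel := EquivRel _ gen_equivb_refl gen_equivb_sym gen_equivb_trans.

Definition gquot := {eq_quot gen_equiv_rel}.
HB.instance Definition _ := Topological.copy gquot (quotient_topology gquot).
HB.instance Definition _ := Quotient.on gquot.
End GenQuot.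

Section Homotopy.
Context {R : realType}.
Definition unit_interval := set_type (`[0, 1] : set R).

Definition homotopic {X Y : topologicalType} (f g : X -> Y) : Prop :=
  exists H : (X * unit_interval)%type -> Y, continuous H /\
    (forall x (t : unit_interval), set_val t = 0 -> H (x, t) = f x) /\
    (forall x (t : unit_interval), set_val t = 1 -> H (x, t) = g x).

Definition homotopy_equivalent (X Y : topologicalType) : Prop :=
  exists (f : X -> Y) (g : Y -> X), continuous f /\ continuous g /\
    homotopic (g \o f) id /\ homotopic (f \o g) id.
End Homotopy.

Section Suspension.
Context {R : realType} (X : ptopologicalType).
Definition susp_collapsed (p : (X * @unit_interval R)%type) : Prop :=
  set_val p.2 = 0 \/ set_val p.2 = 1 \/ p.1 = point.
Definition reduced_suspension :=
  gquot (fun p q : (X * @unit_interval R)%type =>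
           susp_collapsed p /\ susp_collapsed q).
End Suspension.

Section Spheres.
Context {R : realType}.
Definition sqnorm k (x : 'rV[R]_k) : R := \sum_(i < k) x ord0 i ^+ 2.
Definition sphere_set k : set 'rV[R]_k.+1 := [set x | sqnorm x = 1].
Definition disk_set k : set 'rV[R]_k := [set x | sqnorm x <= 1].

Definition e0 k : 'rV[R]_k.+1 := \row_(j < k.+1) (j == ord0)%:R.
Arguments sphere_set : clear implicits.
Arguments disk_set : clear implicits.
Arguments e0 : clear implicits.
Lemma e0_in k : e0 k \in sphere_set k.
Proof.
rewrite inE /sphere_set /= /sqnorm big_ord_recl /= !mxE eqxx expr1n.
by rewrite big1 ?addr0 // => i _; rewrite mxE expr0n.
Qed.

Definition sphere k := set_type (sphere_set k).
HB.instance Definition _ k := Topological.on (sphere k).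
HB.instance Definition _ k := isPointed.Build (sphere k) (SigSub (@e0_in k)).
End Spheres.

(* ---------- Mod-2 Moore space  M^(m+1)(2) = S^m \cup_2 e^(m+1)  (m >= 1) *)
Section Moore.
Context {R : realType}.
(* the standard degree-2 self map of S^m (m >= 1): z |-> z^2/|z| on the first
   two coordinates (viewed as a complex number z), identity on the others *)
Definition deg2 m (v : 'rV[R]_m.+1) : 'rV[R]_m.+1 :=
  let a := v ord0 ord0 in
  let b := v ord0 (inord 1) in
  let r := Num.sqrt (a ^+ 2 + b ^+ 2) in
  \row_(j < m.+1) if (j == 0 :> nat) then (a ^+ 2 - b ^+ 2) / r
                  else if (j == 1 :> nat) then 2 * a * b / r
                  else v ord0 j.

(* disjoint union S^m (tag true) + D^(m+1) (tag false), inside bool * R^(m+1) *)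
Definition moore_base_set m : set (bool * 'rV[R]_m.+1)%type :=
  [set p | if p.1 then sqnorm p.2 = 1 else sqnorm p.2 <= 1].
Arguments moore_base_set : clear implicits.
Definition moore_base m := set_type (moore_base_set m).

Definition moore_attach m (p q : moore_base m) : Prop :=
  (set_val p).1 = false /\ sqnorm (set_val p).2 = 1 /\
  (set_val q).1 = true /\ (set_val q).2 = deg2 (set_val p).2.

Definition moore_space m := gquot (@moore_attach m).
Arguments moore_space : clear implicits.

Lemma moore_pt_in m : (true, e0 m) \in moore_base_set m.
Proof. by rewrite inE /moore_base_set /=; move: (@e0_in R m); rewrite inE. Qed.

HB.instance Definition _ m := Topological.on (moore_space m).
HB.instance Definition _ m :=
  isPointed.Build (moore_space m) (\pi_(moore_space m) (SigSub (moore_pt_in m))).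
End Moore.

(* ---------- K_n = (S^1)^n / (z_1,..,z_n) ~ (conj z_1,..,conj z_(n-1), -z_n) *)
Section Kn.
Context {R : realType} (n : nat).
(* (S^1)^n inside R^(n x 2): row i = (Re z_i, Im z_i) *)
Definition torus_set : set 'M[R]_(n, 2) :=
  [set x | forall i, x i ord0 ^+ 2 + x i (inord 1) ^+ 2 = 1].
Definition torus := set_type torus_set.

Definition Kn_invol (x : 'M[R]_(n, 2)) : 'M[R]_(n, 2) :=
  \matrix_(i, j) if (i == n.-1 :> nat) then - x i j
                 else if (j == 0 :> nat) then x i j else - x i j.

Definition Kn := gquot (fun x y : torus => set_val y = Kn_invol (set_val x)).

Definition torus_pt : 'M[R]_(n, 2) := \matrix_(i, j) (j == 0 :> nat)%:R.
Lemma torus_pt_in : torus_pt \in torus_set.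
Proof.
rewrite inE /torus_set => i; rewrite !mxE /= inordK //.
by rewrite expr1n expr0n addr0.
Qed.

HB.instance Definition _ := Topological.on Kn.
HB.instance Definition _ :=
  isPointed.Build Kn (\pi_Kn (SigSub torus_pt_in)).
End Kn.

Section RHS.
Context {R : realType} (n : nat).
(* index (i, j, t): summand number j < C(n-1, i) of "type i";
   i = 0: S^2 (t = false only);
   i even > 0: t = false gives S^(i+1), t = true gives S^(i+2);
   i odd: t = false gives M^(i+2)(2) = S^(i+1) \cup_2 e^(i+2). *)
Definition rhs_valid (c : nat * nat * bool) : bool :=
  let: (i, j, t) := c in
  [&& (i < n)%N, (j < 'C(n.-1, i))%N & t ==> (~~ odd i && (0 < i)%N)].
Definition rhs_index := {c : nat * nat * bool | rhs_valid c}.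

Definition rhs_piece (c : rhs_index) : ptopologicalType :=
  let: (i, _, t) := val c in
  if i == 0%N then (@sphere R 2 : ptopologicalType)
  else if odd i then (@moore_space R i.+1 : ptopologicalType)
  else if t then (@sphere R i.+2 : ptopologicalType)
  else (@sphere R i.+1 : ptopologicalType).

Definition rhs_wedge := wedge (fun c : rhs_index => @point (rhs_piece c)).
End RHS.

(* Main.v *)
(**
Cut K_n open along its last circle: it is the quotient of [-1,1] x (S^1)^(n-1) that glues the
end s = -1 to the end s = 1 by complex conjugation in the remaining n-1 coordinates. Let m = n-1.
For one of these circle coordinates, let X be the same space without that coordinate; the base
point of the circle is a section of K_n -> X, so the suspension of K_n is a coproduct, in the
pointed homotopy category, of the suspension of X and of that of K_n / X. In the quotient the
coordinate has become a smash coordinate. Treating all coordinates in this way, the suspension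
splits into pieces indexed by the subsets B of the m coordinates: for i = #|B| the piece is the
cube of dimension i+2 whose faces are collapsed, except the two faces s = -1 and s = 1, which
are glued by v |-> -v in the i coordinates of B; for i = 0 these two are collapsed as well, which
makes the piece S^2. For i > 0 the piece is S^(i+1)
with an (i+2)-cell attached by a map which collapses the equator v_0 = 0 and wraps the two
hemispheres around the sphere, the second one with i signs changed. Pairs of sign changes are
undone by rotations. For even i the attaching map is then null-homotopic and the piece is
S^(i+1) v S^(i+2); for odd i it is homotopic to the standard map of degree 2 and the piece is
M^(i+2)(2). All the homotopies between maps of spheres are composites of segments between maps
whose values have nonnegative scalar product.
*)
Require Import Defs.
From HB Require Import structures.
From mathcomp Require Import ring lra zify.
From mathcomp Require Import all_boot all_order all_algebra generic_quotient.
From mathcomp Require Import all_classical all_reals topology normedtype homotopy realfun.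
Import numFieldNormedType.Exports.
Set Implicit Arguments. Unset Strict Implicit. Unset Printing Implicit Defensive.
Import Order.TTheory GRing.Theory Num.Theory.
Local Open Scope classical_set_scope.
Local Open Scope ring_scope.
Local Open Scope quotient_scope.

(** No map between the suspension and the wedge is ever written down: both are coproducts of the
    same family, and coproducts are unique. Splittings can thus be iterated, reindexed and
    transported without touching a formula. Conjugation fixes the base point of the circle, so the
    section respects the gluing. Quotients have two costs. A homotopy on a quotient requires that
    the quotient map times the line be a quotient map, which holds because the line is locally
    compact. And inverses of continuous bijections must be continuous, while the quotients are not
    known to be Hausdorff; so each inverse is obtained from a compact set that maps onto a Euclidean
    set on one side and to the quotient on the other. All models are quotients of one space R x R x
    R^m, where dropping a coordinate means ignoring it. *)

Definition cat_at {X Y : topologicalType} (f : X -> Y) (x : X) : Prop :=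
  forall U, nbhs (f x) U -> nbhs x (f @^-1` U).

(** * Continuity and quotients *)

Section ContinuityAt.
Context {R : realType}.
Implicit Types X Y Z : topologicalType.

Lemma cat_cst X Y (c : Y) (x : X) : cat_at (fun _ => c) x.
Proof. exact: cst_continuous. Qed.

Lemma cat_id X (x : X) : cat_at (fun y => y) x.
Proof. by []. Qed.

Lemma cat_comp X Y Z (f : Y -> Z) (g : X -> Y) x :
  cat_at f (g x) -> cat_at g x -> cat_at (fun y => f (g y)) x.
Proof. by move=> cf cg U /cf /cg. Qed.

Lemma cat_compc X Y Z (f : Y -> Z) (g : X -> Y) x :
  continuous f -> cat_at g x -> cat_at (fun y => f (g y)) x.
Proof. by move=> cf; apply: cat_comp; exact: cf. Qed.

Lemma cat_pair X Y Z (f : X -> Y) (g : X -> Z) x :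
  cat_at f x -> cat_at g x -> cat_at (fun y => (f y, g y)) x.
Proof. exact: cvg_pair. Qed.

Lemma cat_fst X Y Z (f : X -> Y * Z) x :
  cat_at f x -> cat_at (fun y => (f y).1) x.
Proof. by move=> cf; apply: (@cat_comp _ _ _ fst f) => //; exact: cvg_fst. Qed.

Lemma cat_snd X Y Z (f : X -> Y * Z) x :
  cat_at f x -> cat_at (fun y => (f y).2) x.
Proof. by move=> cf; apply: (@cat_comp _ _ _ snd f) => //; exact: cvg_snd. Qed.

Lemma cat_add X (f g : X -> R) x :
  cat_at f x -> cat_at g x -> cat_at (fun y => f y + g y) x.
Proof. exact: cvgD. Qed.

Lemma cat_opp X (f : X -> R) x : cat_at f x -> cat_at (fun y => - f y) x.
Proof. exact: cvgN. Qed.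

Lemma cat_mul X (f g : X -> R) x :
  cat_at f x -> cat_at g x -> cat_at (fun y => f y * g y) x.
Proof. exact: cvgM. Qed.

Lemma cat_inv X (f : X -> R) x :
  f x != 0 -> cat_at f x -> cat_at (fun y => (f y)^-1) x.
Proof. by move=> f0 cf; exact: cvgV. Qed.

Lemma cat_norm X (f : X -> R) x : cat_at f x -> cat_at (fun y => `|f y|) x.
Proof. exact: cvg_norm. Qed.

Lemma cat_sqrt X (f : X -> R) x :
  cat_at f x -> cat_at (fun y => Num.sqrt (f y)) x.
Proof. by move=> cf; apply: (cat_comp (f := Num.sqrt)) => //; exact: sqrt_continuous. Qed.

Lemma cat_exp X (f : X -> R) n x :
  cat_at f x -> cat_at (fun y => f y ^+ n) x.
Proof.
by move=> cf; apply: (cat_comp (f := fun z : R => z ^+ n)) => //; exact: exprn_continuous.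
Qed.

Lemma cat_max X (f g : X -> R) x :
  cat_at f x -> cat_at g x -> cat_at (fun y => Num.max (f y) (g y)) x.
Proof.
move=> cf cg; rewrite (_ : (fun y => _) = fun y => 2^-1 * (f y + g y + `|f y - g y|)).
  apply: cat_mul; first exact: cat_cst.
  apply: cat_add; first exact: cat_add.
  by apply: cat_norm; apply: cat_add => //; exact: cat_opp.
by apply/funext => y; rewrite maxr_absE mulrC.
Qed.

Lemma cat_min X (f g : X -> R) x :
  cat_at f x -> cat_at g x -> cat_at (fun y => Num.min (f y) (g y)) x.
Proof.
move=> cf cg; rewrite (_ : (fun y => _) = fun y => 2^-1 * (f y + g y - `|f y - g y|)).
  apply: cat_mul; first exact: cat_cst.
  apply: cat_add; first exact: cat_add.
  by apply/cat_opp/cat_norm; apply: cat_add => //; exact: cat_opp.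
by apply/funext => y; rewrite minr_absE mulrC.
Qed.

Lemma cat_sum X I (r : seq I) (P : pred I) (f : I -> X -> R) x :
  (forall i, cat_at (f i) x) -> cat_at (fun y => \sum_(i <- r | P i) f i y) x.
Proof.
move=> cf; elim: r => [|i r IH].
  by under eq_fun do rewrite big_nil; exact: cat_cst.
under eq_fun do rewrite big_cons.
by case: (P i) => //; exact: cat_add.
Qed.

Lemma cat_prod X I (r : seq I) (P : pred I) (f : I -> X -> R) x :
  (forall i, cat_at (f i) x) -> cat_at (fun y => \prod_(i <- r | P i) f i y) x.
Proof.
move=> cf; elim: r => [|i r IH].
  by under eq_fun do rewrite big_nil; exact: cat_cst.
under eq_fun do rewrite big_cons.
by case: (P i) => //; exact: cat_mul.
Qed.

Lemma cat_coord X m n (f : X -> 'M[R]_(m, n)) i j x :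
  cat_at f x -> cat_at (fun y => f y i j) x.
Proof.
by move=> cf; apply: (cat_comp (f := fun M : 'M[R]_(m, n) => M i j)) => //;
  exact: coord_continuous.
Qed.

Lemma cat_mx X m n (f : X -> 'M[R]_(m, n)) x :
  (forall i j, cat_at (fun y => f y i j) x) -> cat_at f x.
Proof.
move=> cf U [P fP PU].
have : nbhs x (\bigcap_(ij in [set: 'I_m * 'I_n]) ((fun y => f y ij.1 ij.2) @^-1` P ij.1 ij.2)).
  have /finite_fsetP[F FE] := @finite_finset _ [set: 'I_m * 'I_n].
  rewrite FE; apply: (@filter_bigI _ ('I_m * 'I_n)%type) => ij _.
  exact/cf/fP.
by apply: filterS => y Hy; apply: PU => i j; exact: (Hy (i, j)).
Qed.

Lemma cat_matrix X m n (f : 'I_m -> 'I_n -> X -> R) x :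
  (forall i j, cat_at (f i j) x) -> cat_at (fun y => \matrix_(i, j) f i j y) x.
Proof. by move=> cf; apply: cat_mx => i j; under eq_fun do rewrite mxE; exact: cf. Qed.

(** Each branch has to be continuous only at points of its own closed side, so it may be given by a
    formula that degenerates on the other side, such as a quotient or a direction. *)
Lemma cat_paste_at X Y (a : X -> R) (f g : X -> Y) x :
  cat_at a x -> (a x <= 0 -> cat_at f x) -> (0 <= a x -> cat_at g x) ->
  (a x = 0 -> f x = g x) -> cat_at (fun x => if a x <= 0 then f x else g x) x.
Proof.
move=> ca cf cg fg U; case: (ltgtP (a x) 0) => ax.
- move=> /(cf (ltW ax)) Uf.
  have : nbhs x (a @^-1` [set r | r < 0]) by apply: ca; exact: lt_nbhsl.
  by apply: filterS2 Uf => y /= fy ay; rewrite (ltW ay).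
- move=> /(cg (ltW ax)) Uf.
  have : nbhs x (a @^-1` [set r | 0 < r]) by apply: ca; exact: lt_nbhsr.
  by apply: filterS2 Uf => y /= fy ay; rewrite leNgt ay.
- rewrite ?ax ?lexx => Ux.
  have Uf : nbhs x (f @^-1` U) by apply: cf => //; rewrite ax.
  have Ug : nbhs x (g @^-1` U) by apply: cg; rewrite ?ax // -fg.
  by apply: filterS2 Uf Ug => y /= fy gy; case: ifP.
Qed.

Lemma cat_paste X Y (a : X -> R) (f g : X -> Y) :
  (forall x, cat_at a x) ->
  (forall x, a x <= 0 -> cat_at f x) -> (forall x, 0 <= a x -> cat_at g x) ->
  (forall x, a x = 0 -> f x = g x) ->
  forall x, cat_at (fun x => if a x <= 0 then f x else g x) x.
Proof. by move=> ca cf cg fg x; apply: cat_paste_at => // ?; [exact: cf|exact: cg|exact: fg]. Qed.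

Lemma cat_set_type X Y (A : set Y) (f : X -> set_type A) x :
  cat_at (fun y => set_val (f y)) x -> cat_at f x.
Proof.
move=> cf U [V [[W oW <-] Vx] VU]; apply: filterS (cf W _).
  by move=> y Wy; apply: VU.
exact: open_nbhs_nbhs.
Qed.

Lemma cat_set_val X Y (A : set Y) (f : X -> set_type A) x :
  cat_at f x -> cat_at (fun y => set_val (f y)) x.
Proof. by move=> cf; apply: (cat_comp (f := set_val)) => //; exact: initial_continuous. Qed.

End ContinuityAt.

(** Continuity is stated at a point and for eta-expanded functions, so that the head of the body
    selects the lemma; a side condition such as a nonzero denominator is left as a goal at that
    point. *)
Ltac cat_step :=
  lazymatch goal with
  | |- cat_at (fun _ => ?c) _ => apply cat_cst
  | |- cat_at (fun y => y) _ => apply cat_id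
  | |- cat_at (fun y => (@?f y, @?g y)) _ => refine (@cat_pair _ _ _ f g _ _ _)
  | |- cat_at (pair ?a) _ => refine (@cat_pair _ _ _ (fun _ => a) id _ _ _)
  | |- cat_at id _ => apply cat_id
  | |- cat_at fst _ => refine (@cat_fst _ _ _ id _ _)
  | |- cat_at snd _ => refine (@cat_snd _ _ _ id _ _)
  | |- cat_at (fun y => (@?f y).1) _ => refine (@cat_fst _ _ _ f _ _)
  | |- cat_at (fun y => (@?f y).2) _ => refine (@cat_snd _ _ _ f _ _)
  | |- cat_at (fun y => @?f y + @?g y) _ => refine (@cat_add _ _ f g _ _ _)
  | |- cat_at (fun y => - @?f y) _ => refine (@cat_opp _ _ f _ _)
  | |- cat_at (fun y => @?f y * @?g y) _ => refine (@cat_mul _ _ f g _ _ _)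
  | |- cat_at (fun y => (@?f y)^-1) _ => refine (@cat_inv _ _ f _ _ _)
  | |- cat_at (fun y => `|@?f y|) _ => refine (@cat_norm _ _ f _ _)
  | |- cat_at (fun y => Num.sqrt (@?f y)) _ => refine (@cat_sqrt _ _ f _ _)
  | |- cat_at (fun y => @?f y ^+ ?n) _ => refine (@cat_exp _ _ f n _ _)
  | |- cat_at (fun y => Num.max (@?f y) (@?g y)) _ => refine (@cat_max _ _ f g _ _ _)
  | |- cat_at (fun y => Num.min (@?f y) (@?g y)) _ => refine (@cat_min _ _ f g _ _ _)
  | |- cat_at (fun y => fun_of_matrix (@?f y) ?i ?j) _ => refine (@cat_coord _ _ _ _ f i j _ _)
  | |- cat_at (fun y => set_val (@?f y)) _ => refine (@cat_set_val _ _ _ f _ _)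
  | |- cat_at (fun y => \sum_(i <- _ | _) _) _ => apply: cat_sum => ?
  | |- cat_at (fun y => \prod_(i <- _ | _) _) _ => apply: cat_prod => ?
  | |- cat_at (fun y => \matrix_(i, j) _) _ => apply: cat_matrix => ? ?
  end.
Ltac cat_auto := repeat cat_step.

Section Lifting.
Context {R : realType}.
Implicit Types X Y : topologicalType.

Lemma cat_curry X Y (h : X * R -> Y) : continuous h ->
  continuous (fun x => (fun r => h (x, r)) : {compact-open, R -> Y}).
Proof. exact: continuous_curry_fun. Qed.

Lemma cat_uncurry X Y (h : X -> R -> Y) :
  continuous (h : X -> {compact-open, R -> Y}) -> (forall x, continuous (h x)) ->
  continuous (fun p : X * R => h p.1 p.2).
Proof.
move=> ch chx.
have : continuous (uncurry h).
  exact: (continuous_uncurry (@locally_compactR R) (@norm_hausdorff _ _) ch chx).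
by rewrite (_ : uncurry h = fun p : X * R => h p.1 p.2) //; apply/funext => -[].
Qed.

(** The product of a quotient map with the line is again a quotient map. The adjoint map into the
    function space with the compact-open topology descends by the universal property of the quotient
    alone; local compactness of the line turns it back into a map on the product. *)
Lemma quotient_lift2 (T : topologicalType) (Q0 : quotType T) Y (h : T * R -> Y) :
  continuous h ->
  (forall a b r, \pi_(quotient_topology Q0) a = \pi_(quotient_topology Q0) b -> h (a, r) = h (b, r)) ->
  exists H : quotient_topology Q0 * R -> Y,
    continuous H /\ forall a r, H (\pi_(quotient_topology Q0) a, r) = h (a, r).
Proof.
move=> ch hE.
pose k (x : quotient_topology Q0) : R -> Y := fun r => h (repr x, r).
have kE a : k (\pi_(quotient_topology Q0) a) = fun r => h (a, r).
  by apply/funext => r; apply: hE; exact: reprK.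
exists (fun p => k p.1 p.2); split; last by move=> a r; rewrite kE.
apply: cat_uncurry.
  apply/quotient_continuous => x; rewrite /comp /=.
  rewrite (_ : (fun x => _) = fun a => (fun r => h (a, r)) : {compact-open, R -> Y}).
    exact: cat_curry.
  by apply/funext => a; rewrite -kE.
move=> x; rewrite -[x]reprK kE => r.
by apply: (cat_compc ch); cat_auto.
Qed.

End Lifting.

Section GquotLift.
Context {R : realType} {T : topologicalType} (r : T -> T -> Prop).

Lemma gquot_piP (a b : T) : \pi_(gquot r) a = \pi_(gquot r) b <-> gen_equiv r a b.
Proof.
split=> [/eqmodP/asboolP //|H]; apply/eqmodP; exact/asboolP.
Qed.

Lemma gquot_rel (a b : T) : r a b -> \pi_(gquot r) a = \pi_(gquot r) b.
Proof. by move=> rab; apply/gquot_piP => E h _ _ _; exact: h. Qed.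

Lemma gquot_pi_cat (a : T) : cat_at (\pi_(gquot r)) a.
Proof. exact: pi_continuous. Qed.

Lemma gquot_ind (P : gquot r -> Prop) :
  (forall a, P (\pi_(gquot r) a)) -> forall x, P x.
Proof. by move=> H x; rewrite -[x]reprK; exact: H. Qed.

Lemma gquot_const (Y : Type) (f : T -> Y) : (forall a b, r a b -> f a = f b) ->
  forall a b, \pi_(gquot r) a = \pi_(gquot r) b -> f a = f b.
Proof.
move=> fr a b /gquot_piP H; apply: (H (fun x y => f x = f y)) => //.
by move=> x y z -> ->.
Qed.

Lemma gquot_lift (Y : topologicalType) (f : T -> Y) :
  continuous f -> (forall a b, r a b -> f a = f b) ->
  exists F : gquot r -> Y, continuous F /\ forall a, F (\pi_(gquot r) a) = f a.
Proof.
move=> cf fr; exists (f \o repr).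
have fE a : (f \o repr) (\pi_(gquot r) a) = f a.
  by apply: (gquot_const fr); rewrite reprK.
split=> //; apply/quotient_continuous.
by rewrite (_ : _ \o \pi_(gquot r) = f) //; exact/funext.
Qed.

Lemma gquot_lift2 (Y : topologicalType) (h : T * R -> Y) :
  continuous h -> (forall a b s, r a b -> h (a, s) = h (b, s)) ->
  exists H : gquot r * R -> Y,
    continuous H /\ forall a s, H (\pi_(gquot r) a, s) = h (a, s).
Proof.
move=> ch hr; apply: (quotient_lift2 ch) => a b s.
exact: (gquot_const (f := fun a => h (a, s)) (fun a b => hr a b s)).
Qed.

End GquotLift.

(* [k] restricted to [K] is a closed map, hence a quotient map onto its image. *)
Lemma compact_lift {A X X' Y : topologicalType} (K : set A) (k : A -> X)
    (r : X' -> X) (p : A -> Y) :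
  compact K -> hausdorff_space X -> continuous k -> continuous p ->
  (forall x, exists2 a, K a & k a = r x) ->
  (forall a b, K a -> K b -> k a = k b -> p a = p b) ->
  exists al : X' -> Y, (forall x, cat_at r x -> cat_at al x) /\
    forall x a, K a -> r x = k a -> al x = p a.
Proof.
move=> cK hX ck cp surj pk.
pose c x := projT1 (cid2 (surj x)).
have [Kc kc] : (forall x, K (c x)) /\ forall x, k (c x) = r x.
  by split=> x; rewrite /c; case: cid2.
exists (p \o c); split; last by move=> x a Ka E; apply: pk; rewrite ?kc.
move=> x crx U; rewrite nbhsE => -[V [oV Vx] VU].
(* The points of [K] sent outside [V] form a compact set; its image is closed in the Hausdorff space
   [X] and misses [r x], so the complement of the image gives the neighbourhood. *)
pose C := k @` (K `&` p @^-1` (~` V)).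
have clC : closed C.
  apply: compact_closed => //; apply: continuous_compact.
    exact: continuous_subspaceT.
  apply: compact_closedI => //.
  by apply: closed_comp => //; exact: open_closedC.
have nC : ~ C (r x).
  move=> [a [Ka pa] E]; apply: pa; rewrite (pk a (c x)) ?kc //; exact: Vx.
have : nbhs x (r @^-1` (~` C)).
  by apply: crx; apply: open_nbhs_nbhs; split => //; exact: closed_openC.
apply: filterS => y /= Cy; apply: VU; apply: contrapT => NV; apply: Cy.
by exists (c y); rewrite ?kc //; split.
Qed.

(** * Coproducts up to homotopy *)

(** The base point is a field, so that quotients such as [reduced_suspension] are pointed without a
    canonical instance being declared for them. *)
Record pspace := PSpace { psT :> topologicalType; pspt : psT }.
Arguments pspt : clear implicits.

Definition pmap (X Y : pspace) (f : X -> Y) : Prop :=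
  continuous f /\ f (pspt X) = pspt Y.

Lemma choice_dep (A : Type) (B : A -> Type) (P : forall a, B a -> Prop) :
  (forall a, exists b, P a b) -> exists f : forall a, B a, forall a, P a (f a).
Proof. by move=> H; exists (fun a => projT1 (cid (H a))) => a; case: cid. Qed.

Section PointedHomotopy.
Context {R : realType}.
Implicit Types X Y Z : pspace.

(** The time ranges over the whole line: reversal and concatenation are plain formulas, and the
    exponential law applies directly. Homotopies that make sense only on [0, 1] are extended by
    [clamp]. *)
Definition phtp X Y (f g : X -> Y) : Prop :=
  exists H : (X * R)%type -> Y, continuous H /\ (forall x, H (x, 0) = f x) /\
    (forall x, H (x, 1) = g x) /\ forall r, H (pspt X, r) = pspt Y.

Definition phe X Y : Prop :=
  exists (f : X -> Y) (g : Y -> X), pmap f /\ pmap g /\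
    phtp (g \o f) id /\ phtp (f \o g) id.

Lemma pmap_id X : pmap (@id X).
Proof. by split=> // x; exact: cat_id. Qed.

Lemma pmap_comp X Y Z (f : X -> Y) (g : Y -> Z) :
  pmap f -> pmap g -> pmap (g \o f).
Proof.
move=> [cf f0] [cg g0]; split; last by rewrite /= f0.
by move=> x; apply: continuous_comp; [exact: cf|exact: cg].
Qed.

Lemma phtp_refl X Y (f : X -> Y) : pmap f -> phtp f f.
Proof.
move=> [cf f0]; exists (fun p => f p.1); split => // x.
by apply: (cat_compc cf); cat_auto.
Qed.

Lemma phtp_eq X Y (f g : X -> Y) : pmap f -> f =1 g -> phtp f g.
Proof. by move=> pf /funext <-; exact: phtp_refl. Qed.

Lemma phtp_sym X Y (f g : X -> Y) : phtp f g -> phtp g f.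
Proof.
move=> [H [cH [H0 [H1 Hp]]]]; exists (fun p => H (p.1, 1 - p.2)); split; last first.
  by split=> [x|]; [rewrite /= subr0|split=> [x|r]; rewrite /= ?subrr].
by move=> p; apply: (cat_compc cH); cat_auto.
Qed.

Lemma phtp_trans X Y (f g h : X -> Y) : phtp f g -> phtp g h -> phtp f h.
Proof.
move=> [H [cH [H0 [H1 Hp]]]] [K [cK [K0 [K1 Kp]]]].
exists (fun p => if p.2 - 2^-1 <= 0 then H (p.1, 2 * p.2) else K (p.1, 2 * p.2 - 1)).
split; last split; last split.
- apply: (cat_paste (a := fun p : X * R => p.2 - 2^-1)); first by move=> p; cat_auto.
  + by move=> p _; apply: (cat_compc cH); cat_auto.
  + by move=> p _; apply: (cat_compc cK); cat_auto.
  + move=> [x r] /= E; have -> : r = 2^-1 by lra.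
    have -> : 2 * 2^-1 = 1 :> R by lra.
    by rewrite (_ : 1 - 1 = 0) ?H1 ?K0 //; lra.
- by move=> x /=; rewrite ifT ?mulr0 ?H0 //; lra.
- move=> x /=; have -> : (1 - 2^-1 <= 0 :> R) = false by lra.
  by have -> : 2 * 1 - 1 = 1 :> R by lra.
- by move=> r /=; case: ifP.
Qed.

Lemma phtp_compl X Y Z (f g : X -> Y) (h : Y -> Z) :
  pmap h -> phtp f g -> phtp (h \o f) (h \o g).
Proof.
move=> [ch h0] [H [cH [H0 [H1 Hp]]]]; exists (h \o H); split; last first.
  by split=> [x|]; [rewrite /= H0|split=> [x|r]; rewrite /= ?H1 ?Hp].
by move=> p; apply: continuous_comp; [exact: cH|exact: ch].
Qed.

Lemma phtp_compr X Y Z (f g : Y -> Z) (h : X -> Y) :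
  pmap h -> phtp f g -> phtp (f \o h) (g \o h).
Proof.
move=> [ch h0] [H [cH [H0 [H1 Hp]]]]; exists (fun p => H (h p.1, p.2)).
split; last by split=> [x|]; [rewrite H0|split=> [x|r]; rewrite /= ?H1 ?h0 ?Hp].
by move=> p; apply: (cat_compc cH); apply: cat_pair; [apply: (cat_compc ch)|]; cat_auto.
Qed.

Lemma phe_refl X : phe X X.
Proof. have pI := @pmap_id X; exists id, id; split; first exact: pI.
by split; [exact: pI|split; exact: phtp_refl]. Qed.

Lemma phe_sym X Y : phe X Y -> phe Y X.
Proof. by move=> [f [g [pf [pg [gf fg]]]]]; exists g, f. Qed.

Lemma phe_trans X Y Z : phe X Y -> phe Y Z -> phe X Z.
Proof.
move=> [f [g [pf [pg [gf fg]]]]] [h [k [ph [pk [kh hk]]]]].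
exists (h \o f), (g \o k); split; first exact: pmap_comp.
split; first exact: pmap_comp.
split.
- apply: phtp_trans gf.
  exact: (phtp_compl pg (phtp_compr pf kh)).
- apply: phtp_trans hk.
  exact: (phtp_compl ph (phtp_compr pk fg)).
Qed.

Lemma phe_iso X Y (f : X -> Y) (g : Y -> X) :
  pmap f -> pmap g -> cancel f g -> cancel g f -> phe X Y.
Proof.
move=> pf pg fK gK; exists f, g; do 2!split=> //; split.
- by apply: phtp_eq => //; exact: pmap_comp.
- by apply: phtp_eq => //; exact: pmap_comp.
Qed.

(* [X], with the maps [inc i], is a coproduct of the [P i] in the category of pointed spaces
   and pointed homotopy classes of maps. *)
Definition hcoprod_by (I : Type) (P : I -> pspace) X (inc : forall i, P i -> X) : Prop :=
  [/\ forall i, pmap (inc i),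
      forall Y (f : forall i, P i -> Y), (forall i, pmap (f i)) ->
        exists h : X -> Y, pmap h /\ forall i, phtp (h \o inc i) (f i) &
      forall Y (h h' : X -> Y), pmap h -> pmap h' ->
        (forall i, phtp (h \o inc i) (h' \o inc i)) -> phtp h h'].

Definition hcoprod (I : Type) (P : I -> pspace) X : Prop :=
  exists inc, @hcoprod_by I P X inc.

Lemma hcoprod_uniq I (P : I -> pspace) X X' :
  hcoprod P X -> hcoprod P X' -> phe X X'.
Proof.
move=> [i [pi ei ui]] [j [pj ej uj]].
have [f [pf fi]] := ei _ j pj; have [g [pg gj]] := ej _ i pi.
exists f, g; split=> //; split=> //; split.
- apply: ui; [exact: pmap_comp|exact: pmap_id|].
  move=> k; apply: (@phtp_trans _ _ _ (g \o j k)); last exact: gj.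
  exact: (phtp_compl pg (fi k)).
- apply: uj; [exact: pmap_comp|exact: pmap_id|].
  move=> k; apply: (@phtp_trans _ _ _ (f \o i k)); last exact: fi.
  exact: (phtp_compl pf (gj k)).
Qed.

Lemma hcoprod_pher I (P : I -> pspace) X X' :
  hcoprod P X -> phe X X' -> hcoprod P X'.
Proof.
move=> [i [pi ei ui]] [u [v [pu [pv [vu uv]]]]].
exists (fun k => u \o i k); split.
- by move=> k; exact: pmap_comp.
- move=> Y f pf; have [h [ph hi]] := ei _ f pf.
  exists (h \o v); split; first exact: pmap_comp.
  move=> k; apply: phtp_trans (hi k).
  exact: (phtp_compr (pi k) (phtp_compl ph vu)).
- move=> Y h h' ph ph' hh.
  have E : phtp (h \o u) (h' \o u) by apply: ui => //; exact: pmap_comp.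
  apply: (@phtp_trans _ _ _ (h \o (u \o v))).
    exact: phtp_sym (phtp_compl ph uv).
  apply: (@phtp_trans _ _ _ (h' \o (u \o v))); last exact: (phtp_compl ph' uv).
  exact: (phtp_compr pv E).
Qed.

Lemma hcoprod_reindex I J (P : I -> pspace) (Q : J -> pspace) X (g : J -> I) (g' : I -> J) :
  cancel g g' -> cancel g' g -> (forall j, phe (Q j) (P (g j))) ->
  hcoprod P X -> hcoprod Q X.
Proof.
move=> gK g'K QP [i [pi ei ui]].
have /choice_dep [u /choice_dep [v uvP]] := QP.
have pu k : pmap (u k) by case: (uvP k).
have pv k : pmap (v k) by case: (uvP k) => _ [].
have vu k : phtp (v k \o u k) id by case: (uvP k) => _ [_ []].
have uv k : phtp (u k \o v k) id by case: (uvP k) => _ [_ []].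
exists (fun k => i (g k) \o u k); split.
- by move=> k; exact: pmap_comp.
- move=> Y f pf.
  (* An index [l] equals [g (g' l)] only propositionally. The family on [I] is therefore chosen with
     a specification that quantifies over all [k] with [g k = l] and transports along the
     equation. *)
  pose cast k l (e : g k = l) : P l -> P (g k) := fun x => ecast z (P z) (esym e) x.
  have E l : exists f' : P l -> Y, pmap f' /\
      forall k (e : g k = l), phtp f' (f k \o v k \o cast k l e).
    rewrite -(g'K l); set k := g' l.
    exists (f k \o v k); split; first exact: pmap_comp.
    move=> k' e; have ek : k' = k by rewrite -(gK k') e gK.
    subst k'; rewrite (Prop_irrelevance e erefl) /cast /=.
    by apply: phtp_refl; exact: pmap_comp.
  have /choice_dep [f' f'P] := E.
  have [h [ph hi]] := ei _ f' (fun l => (f'P l).1).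
  exists h; split => // k.
  apply: (@phtp_trans _ _ _ (f' (g k) \o u k)).
    exact: (phtp_compr (pu k) (hi (g k))).
  apply: (@phtp_trans _ _ _ (f k \o v k \o u k)).
    exact: (phtp_compr (pu k) ((f'P _).2 k erefl)).
  exact: (phtp_compl (pf k) (vu k)).
- move=> Y h h' ph ph' hh; apply: ui => // l; rewrite -(g'K l); set k := g' l.
  apply: (@phtp_trans _ _ _ (h \o i (g k) \o (u k \o v k))).
    by apply: phtp_sym; apply: (phtp_compl _ (uv k)); exact: pmap_comp.
  apply: (@phtp_trans _ _ _ (h' \o i (g k) \o (u k \o v k))); last first.
    by apply: (phtp_compl _ (uv k)); exact: pmap_comp.
  exact: (phtp_compr (pv k) (hh k)).
Qed.

Lemma hcoprod_sig I (J : I -> Type) (P : forall i, J i -> pspace) (X : I -> pspace) Z :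
  (forall i, hcoprod (P i) (X i)) -> hcoprod X Z ->
  hcoprod (fun k : {i : I & J i} => P (projT1 k) (projT2 k)) Z.
Proof.
move=> /choice_dep [a aP] [b [pb eb ub]].
exists (fun k => b (projT1 k) \o a (projT1 k) (projT2 k)); split.
- by move=> [i j] /=; apply: pmap_comp => //; case: (aP i).
- move=> Y f pf.
  have E i : exists h : X i -> Y, pmap h /\ forall j, phtp (h \o a i j) (f (existT _ i j)).
    by case: (aP i) => _ e _; exact: (e Y _ (fun j => pf (existT _ i j))).
  have /choice_dep [h hP] := E.
  have [k [pk kb]] := eb _ h (fun i => (hP i).1).
  exists k; split => // -[i j] /=.
  apply: (@phtp_trans _ _ _ (h i \o a i j)); last exact: (hP i).2.
  by apply: (phtp_compr _ (kb i)); case: (aP i).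
- move=> Y h h' ph ph' hh; apply: ub => // i.
  case: (aP i) => pa _ ua; apply: ua; try exact: pmap_comp.
  by move=> j; exact: (hh (existT _ i j)).
Qed.

Lemma hcoprod1 X : hcoprod (fun _ : unit => X) X.
Proof.
exists (fun _ => id); split; first by move=> _; exact: pmap_id.
  by move=> Y f pf; exists (f tt); split=> // -[]; exact: (phtp_refl (pf tt)).
by move=> Y h h' _ _ /(_ tt).
Qed.

End PointedHomotopy.

Section Clamp.
Context {R : realType}.

Definition clamp (r : R) : R := Num.max 0 (Num.min 1 r).

Lemma clamp_ge0 r : 0 <= clamp r.
Proof. by rewrite /clamp le_max lexx. Qed.

Lemma clamp_le1 r : clamp r <= 1.
Proof. by rewrite /clamp ge_max ler01 ge_min lexx. Qed.

Lemma clamp_itv r : 0 <= clamp r <= 1.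
Proof. by rewrite clamp_ge0 clamp_le1. Qed.

Lemma clamp_id r : 0 <= r <= 1 -> clamp r = r.
Proof. by move=> /andP[r0 r1]; rewrite /clamp min_r // max_r. Qed.

Lemma clamp0 : clamp 0 = 0.
Proof. by rewrite clamp_id ?lexx ?ler01. Qed.

Lemma clamp1 : clamp 1 = 1.
Proof. by rewrite clamp_id ?lexx ?ler01. Qed.

Lemma cat_clamp (X : topologicalType) (f : X -> R) x :
  cat_at f x -> cat_at (fun y => clamp (f y)) x.
Proof. by move=> cf; rewrite /clamp; cat_auto. Qed.

End Clamp.

Ltac minmax_split x y :=
  lazymatch constr:((x, y)) with
  | context [Num.max _ _] => fail
  | context [Num.min _ _] => fail
  | _ => case: (leP x y) => ?
  end.
Ltac minmax := repeat match goal with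
  | |- context [Num.max ?x ?y] => minmax_split x y
  | |- context [Num.min ?x ?y] => minmax_split x y end.

Section Update.
Context {R : realType} {m : nat}.
Implicit Types (v : 'rV[R]_m) (i j : 'I_m).

Definition upd v i (x : R) : 'rV[R]_m := \matrix_(k, j) (if j == i then x else v ord0 j).

Lemma updE v i x j : upd v i x ord0 j = if j == i then x else v ord0 j.
Proof. by rewrite mxE. Qed.

Lemma upd_id v i : upd v i (v ord0 i) = v.
Proof. by apply/rowP => j; rewrite updE; case: eqP => // ->. Qed.

Lemma upd_opp v i x : - upd v i x = upd (- v) i (- x).
Proof. by apply/rowP => j; rewrite !mxE; case: ifP. Qed.

Lemma cat_upd (X : topologicalType) (f : X -> 'rV[R]_m) i (g : X -> R) x :
  cat_at f x -> cat_at g x -> cat_at (fun y => upd (f y) i (g y)) x.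
Proof. by move=> cf cg; apply: cat_matrix => k j; case: (j == i) => //; cat_auto. Qed.

End Update.

Ltac cat_top := repeat first
  [ cat_step | assumption
  | lazymatch goal with
    | |- cat_at (fun y => clamp (@?f y)) _ => refine (@cat_clamp _ _ f _ _)
    | |- cat_at (fun y => upd (@?f y) ?i (@?g y)) _ => refine (@cat_upd _ _ _ f i g _ _ _)
    end ].

(** * Splitting off one circle coordinate *)

Section Models.
Context {R : realType} {m : nat}.
Implicit Types (A S : {set 'I_m}) (i j : 'I_m).

Definition raw : topologicalType := (R * R * 'rV[R]_m)%type.

(* The reduced suspension, with suspension coordinate [p.1.1], of the space of pairs
   [(p.1.2, p.2)], where the faces [p.1.2 = -1] and [p.1.2 = 1] are glued by [v |-> - v]
   and the coordinate [p.2 i] is circle-valued, [|x| >= 1] being the base point, for [i] in [A];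
   collapsed when [|x| >= 1] for [i] in [S]; ignored for the other [i]. *)
Definition mcol A S (p : raw) : Prop :=
  [\/ p.1.1 <= 0, 1 <= p.1.1, exists2 i, i \in S & 1 <= `|p.2 ord0 i| |
      [/\ forall i, i \notin S, 1 <= `|p.1.2| & forall i, i \in A -> 1 <= `|p.2 ord0 i|]].

Definition mtriv A S (v v' : 'rV[R]_m) : Prop := forall i, v ord0 i = v' ord0 i \/
  (i \notin S /\ (i \in A -> 1 <= `|v ord0 i| /\ 1 <= `|v' ord0 i|)).

(** The last clause of [mcol], which collapses the base point of the unsuspended space, is reserved
    for empty [S]. For nonempty [S] the collapsed faces of [S] serve as base point, and the faces s
    = -1 and s = 1 have to stay glued, not collapsed. With [A] and [S] both empty the clause
    collapses these two faces, which is how S^2 arises. *)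
Definition mrel A S (p q : raw) : Prop :=
  [\/ mcol A S p /\ mcol A S q,
      [/\ p.1.1 = q.1.1, p.1.2 <= -1, 1 <= q.1.2 & q.2 = - p.2] |
      p.1 = q.1 /\ mtriv A S p.2 q.2].

Definition mod_space A S : pspace :=
  PSpace (\pi_(gquot (mrel A S)) ((0, 0, 0) : raw)).

Definition mpi A S (p : raw) : mod_space A S := \pi_(gquot (mrel A S)) p.

Definition mcompat A S (Y : pspace) (f : raw -> Y) : Prop :=
  [/\ forall p, mcol A S p -> f p = pspt Y,
      forall t s s' v, s <= -1 -> 1 <= s' -> f (t, s, v) = f (t, s', - v) &
      forall t s v v', mtriv A S v v' -> f (t, s, v) = f (t, s, v')].

Lemma mcompat_rel A S (Y : pspace) (f : raw -> Y) p q :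
  mcompat A S f -> mrel A S p q -> f p = f q.
Proof.
move=> [fc fg ft] [[/fc -> /fc ->] //||].
- by case: p q => [[t s] v] [[t' s'] v'] /= [<- s1 s1' ->]; exact: fg.
- by case: p q => [[t s] v] [[t' s'] v'] /= [[<- <-]]; exact: ft.
Qed.

Lemma mpi_compat A S : mcompat A S (mpi A S).
Proof.
split.
- move=> p pc; apply: gquot_rel; apply: Or31; split=> //.
  by apply: Or41; rewrite /= lexx.
- by move=> t s s' v ? ?; apply: gquot_rel; apply: Or32; split.
- by move=> t s v v' ?; apply: gquot_rel; apply: Or33; split.
Qed.

Lemma mpi_cat A S p : cat_at (mpi A S) p.
Proof. exact: gquot_pi_cat. Qed.

Lemma mcompat_comp A S (Y Z : pspace) (f : raw -> Y) (F : Y -> Z) :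
  mcompat A S f -> F (pspt Y) = pspt Z -> mcompat A S (fun p => F (f p)).
Proof.
move=> [fc fg ft] F0; split.
- by move=> p /fc ->.
- by move=> t s s' v h h'; congr F; exact: fg.
- by move=> t s v v' h; congr F; exact: ft.
Qed.

Lemma mod_ind A S (P : mod_space A S -> Prop) : (forall p, P (mpi A S p)) -> forall x, P x.
Proof. exact: gquot_ind. Qed.

Lemma mod_lift A S (Y : pspace) (f : raw -> Y) :
  (forall p, cat_at f p) -> mcompat A S f ->
  exists F : mod_space A S -> Y, pmap F /\ forall p, F (mpi A S p) = f p.
Proof.
move=> cf fc; have [F [cF FE]] := gquot_lift cf (fun p q => mcompat_rel fc).
exists F; split => //; split => //.
by rewrite FE; case: fc => + _ _; apply; apply: Or41; rewrite /= lexx.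
Qed.

(** The formula [K] is meant for times in [0, 1]; clamping extends it to the line, so compatibility
    is asked only for those times. *)
Lemma mod_htp A S (Y : pspace) (f g : mod_space A S -> Y) (K : raw -> R -> Y) :
  (forall p, cat_at (fun p : raw * R => K p.1 (clamp p.2)) p) ->
  (forall r, 0 <= r <= 1 -> mcompat A S (K ^~ r)) ->
  (forall p, K p 0 = f (mpi A S p)) -> (forall p, K p 1 = g (mpi A S p)) ->
  @phtp R _ _ f g.
Proof.
move=> cK Kc K0 K1.
have [|H [cH HE]] := gquot_lift2 (r := mrel A S) cK.
  by move=> a b s ab; exact: (mcompat_rel (Kc _ (clamp_itv s)) ab).
exists H; split => //; split; last split.
- by apply: mod_ind => p; rewrite HE /= clamp0.
- by apply: mod_ind => p; rewrite HE /= clamp1.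
- move=> r; rewrite HE /=; have [+ _ _] := Kc _ (clamp_itv r); apply.
  by apply: Or41; rewrite /= lexx.
Qed.

End Models.
Arguments raw : clear implicits.

Section Splitting.
Context {R : realType} {m : nat} (A S : {set 'I_m}) (i : 'I_m).
Context (iA : i \in A) (iS : i \notin S).

Notation A' := (A :\ i).
Notation S' := (i |: S).
Notation raw := (raw R m).

(** Addition of maps out of a suspension: pinched at height 1/2, the suspension carries [g] on its
    lower half and [f] on its upper half. *)
Definition half_pinch (Y : Type) (f g : raw -> Y) (p : raw) : Y :=
  if p.1.1 - 2^-1 <= 0 then g (2 * p.1.1, p.1.2, p.2) else f (2 * p.1.1 - 1, p.1.2, p.2).

(** The height at which the loop of [fold_collar] is cut off. For |x| <= 1/2 it is at least 1 and
    cuts nothing off, since heights from 1 on are collapsed; at the base point it is 0. *)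
Definition collar (p : raw) : R := Num.max 0 (2 - 2 * `|p.2 ord0 i|).

(* The difference of [h] and of its restriction to the section [p.2 i = 1], as a loop in the
   suspension coordinate: it runs along [h] and back along the restriction. In the collar
   [1/2 <= |p.2 i| <= 1] the loop is shortened so that it is constant over the section. *)
Definition fold_collar (Y : Type) (h : raw -> Y) (p : raw) : Y :=
  if p.1.1 - 2^-1 <= 0
  then h (Num.min (2 * p.1.1) (collar p), p.1.2, upd p.2 i (2 * p.2 ord0 i))
  else h (Num.min (2 - 2 * p.1.1) (collar p), p.1.2, upd p.2 i 1).

Definition base_section (Y : Type) (h : raw -> Y) (p : raw) : Y :=
  h (p.1.1, p.1.2, upd p.2 i 1).

Lemma norm2M (x : R) : `|2 * x| = 2 * `|x|.
Proof. by rewrite normrM ger0_norm. Qed.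

Lemma mcol0 (B C : {set 'I_m}) (t s : R) (v : 'rV[R]_m) : t <= 0 -> mcol B C (t, s, v).
Proof. by move=> ?; apply: Or41. Qed.

Lemma mcol1 (B C : {set 'I_m}) (t s : R) (v : 'rV[R]_m) : 1 <= t -> mcol B C (t, s, v).
Proof. by move=> ?; apply: Or42. Qed.

Lemma mcolS (B C : {set 'I_m}) (t s : R) (v : 'rV[R]_m) j : j \in C -> 1 <= `|v ord0 j| -> mcol B C (t, s, v).
Proof. by move=> jC vj; apply: Or43; exists j. Qed.

Arguments mcolS {B C t s v j}.

Lemma iS' : i \in S'. Proof. by rewrite !inE eqxx. Qed.

Lemma mcol_smash t s (v : 'rV[R]_m) : 1 <= `|v ord0 i| -> mcol A' S' (t, s, v).
Proof. by move=> vi; apply: (mcolS iS'). Qed.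

Lemma mtriv_upd (v : 'rV[R]_m) (x y : R) : x = y \/ (1 <= `|x| /\ 1 <= `|y|) ->
  mtriv A S (upd v i x) (upd v i y).
Proof.
by move=> xy j; rewrite !updE; case: eqP => [->|_]; [case: xy; [left|right]|left].
Qed.

Lemma mtriv_upd' (v v' : 'rV[R]_m) x : mtriv A' S' v v' -> mtriv A S (upd v i x) (upd v' i x).
Proof.
move=> vv j; rewrite !updE; case: eqP => [_|/eqP ji]; first by left.
case: (vv j) => [|[jS jA]]; first by left.
right; split; first by apply: contra jS => jS; rewrite !inE jS orbT.
by move=> jA'; apply: jA; rewrite !inE ji.
Qed.

Lemma mtriv_coord (v v' : 'rV[R]_m) : mtriv A' S' v v' -> v ord0 i = v' ord0 i.
Proof. by case/(_ i) => // -[]; rewrite iS'. Qed.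

(** Moving the coordinate [i] within its base point is harmless on both halves: [g] is constant
    there, because the coordinate is a smash coordinate for [g], and [f] ignores the coordinate. *)
Lemma half_pinch_compat (Y : pspace) (f g : raw -> Y) :
  mcompat A' S f -> mcompat A' S' g -> mcompat A S (half_pinch f g).
Proof.
move=> [fc fg ft] [gc gg gt]; split.
- move=> [[t s] v] /= pc; rewrite /half_pinch /=.
  case: ifP => [t1|/negbT]; last rewrite -ltNge => t1.
    case: pc => /= [t0|t0|[j jS vj]|[_ _ H]].
    + by apply/gc/mcol0; lra.
    + by exfalso; lra.
    + by apply: gc; apply: (mcolS _ vj); rewrite !inE jS orbT.
    + by apply: gc; apply: mcol_smash; exact: H.
  case: pc => /= [t0|t0|[j jS vj]|[H s1 H']].
  + by exfalso; lra.
  + by apply/fc/mcol1; lra.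
  + by apply: fc; exact: (mcolS jS vj).
  + by apply: fc; apply: Or44; split=> // j; rewrite !inE => /andP[_ /H'].
- move=> t s s' v h h'; rewrite /half_pinch /=.
  by case: ifP => _; [exact: gg|exact: fg].
- move=> t s v v' vv; rewrite /half_pinch /=; case: ifP => _.
    have [E|] := vv i; last first.
      by move=> [_ /(_ iA)[vi vi']]; rewrite !gc //; exact: mcol_smash.
    apply: gt => j; have [->|ji] := eqVneq j i; first by left.
    case: (vv j) => [|[jS jA]]; [by left|right; split].
      by rewrite !inE negb_or ji.
    by rewrite !inE => /andP[_ /jA].
  apply: ft => j; case: (vv j) => [|[jS jA]]; [by left|right; split => //].
  by rewrite !inE => /andP[_ /jA].
Qed.

(** The parameter space [T] lets one statement serve single maps and homotopies. *)
Lemma half_pinch_cat (Y : pspace) (T : topologicalType) (f g : raw -> T -> Y) :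
  (forall r, mcompat A' S (f ^~ r)) -> (forall r, mcompat A' S' (g ^~ r)) ->
  (forall p, cat_at (fun p => f p.1 p.2) p) -> (forall p, cat_at (fun p => g p.1 p.2) p) ->
  forall p, cat_at (fun p => half_pinch (f ^~ p.2) (g ^~ p.2) p.1) p.
Proof.
move=> fc gc cf cg.
apply: (cat_paste (R := R) (a := fun p : raw * T => p.1.1.1 - 2^-1)
  (f := fun p => g (2 * p.1.1.1, p.1.1.2, p.1.2) p.2)
  (g := fun p => f (2 * p.1.1.1 - 1, p.1.1.2, p.1.2) p.2)).
- by move=> p; cat_auto.
- move=> p _; apply: (cat_comp (f := fun q : raw * T => g q.1 q.2)
    (g := fun p : raw * T => ((2 * p.1.1.1, p.1.1.2, p.1.2) : raw, p.2))) => //; cat_auto.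
- move=> p _; apply: (cat_comp (f := fun q : raw * T => f q.1 q.2)
    (g := fun p : raw * T => ((2 * p.1.1.1 - 1, p.1.1.2, p.1.2) : raw, p.2))) => //; cat_auto.
- move=> [[[t s] v] r] /= t1.
  have [+ _ _] := fc r; have [+ _ _] := gc r => gr fr.
  by rewrite gr ?fr //; [apply: mcol0|apply: mcol1]; lra.
Qed.

Lemma fold_collar_compat (Y : pspace) (h : raw -> Y) :
  mcompat A S h -> mcompat A' S' (fold_collar h).
Proof.
move=> [hc hg ht]; split.
- move=> [[t s] v] /= pc; rewrite /fold_collar /collar /=.
  case: ifP => [t1|/negbT]; last rewrite -ltNge => t1.
    case: pc => /= [t0|t0|[j]|[/(_ i)]]; last by rewrite iS'.
    + by apply/hc/mcol0; rewrite ge_min; apply/orP; left; lra.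
    + by exfalso; lra.
    + rewrite !inE; have [-> _ vi|ji /= jS vj] := eqVneq j i.
        by apply/hc/mcol0; minmax; lra.
      by apply: hc; apply: (mcolS jS); rewrite updE (negbTE ji).
  case: pc => /= [t0|t0|[j]|[/(_ i)]]; last by rewrite iS'.
  + by exfalso; lra.
  + by apply/hc/mcol0; rewrite ge_min; apply/orP; left; lra.
  + rewrite !inE; have [-> _ vi|ji /= jS vj] := eqVneq j i.
      by apply/hc/mcol0; minmax; lra.
    by apply: hc; apply: (mcolS jS); rewrite updE (negbTE ji).
- move=> t s s' v s1 s1'; rewrite /fold_collar /collar /= mxE normrN.
  case: ifP => _; first by rewrite mulrN -upd_opp; exact: hg.
  (* The gluing turns the section value 1 into -1, which is again the base point of the circle. *)
  rewrite (hg _ s s') // upd_opp; apply: ht; apply: mtriv_upd; right.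
  by rewrite normrN normr1.
- move=> t s v v' vv; rewrite /fold_collar /collar /= (mtriv_coord vv).
  by case: ifP => _; apply: ht; exact: mtriv_upd'.
Qed.

Lemma fold_collar_cat (Y : pspace) (h : raw -> Y) :
  (forall p, cat_at h p) -> mcompat A S h -> forall p, cat_at (fold_collar h) p.
Proof.
move=> ch [hc hg ht].
apply: (cat_paste (a := fun p : raw => p.1.1 - 2^-1)).
- by move=> p; cat_auto.
- by move=> p _; apply: cat_compc => //; rewrite /collar; cat_top.
- by move=> p _; apply: cat_compc => //; rewrite /collar; cat_top.
- move=> [[t s] v] /= t1; rewrite /collar /=.
  (* At t = 1/2 the halves meet. For |x| <= 1/2 both are at height at least 1, hence collapsed;
     otherwise the doubled coordinate already represents the base point and both halves run over the
     section. *)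
  have [v1|v1] := leP (`|v ord0 i|) 2^-1.
    by rewrite !hc //; apply: mcol1; minmax; lra.
  have E2 : 2 - 2 * t = 1 by lra.
  have E1 : 2 * t = 1 by lra.
  rewrite E2 E1.
  by apply: ht; apply: mtriv_upd; right; rewrite norm2M normr1; split; lra.
Qed.

Lemma base_section_compat (Y : pspace) (h : raw -> Y) :
  mcompat A S h -> mcompat A' S (base_section h).
Proof.
move=> [hc hg ht]; split.
- move=> [[t s] v] /= pc; rewrite /base_section /=.
  case: pc => /= [t0|t0|[j jS vj]|[H s1 H']].
  + exact/hc/mcol0.
  + exact/hc/mcol1.
  + apply: hc; apply: (mcolS jS); rewrite updE; case: eqP => // ji.
    by move: iS; rewrite -ji jS.
  + apply: hc; apply: Or44; split=> //= j jA; rewrite updE.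
    by case: eqP => [_|/eqP ji]; [rewrite normr1|apply: H'; rewrite !inE ji].
- move=> t s s' v s1 s1'; rewrite /base_section /= (hg _ s s') // upd_opp.
  by apply: ht; apply: mtriv_upd; right; rewrite normrN normr1.
- move=> t s v v' vv; rewrite /base_section /=; apply: ht => j.
  rewrite !updE; case: eqP => [_|/eqP ji]; first by left.
  case: (vv j) => [|[jS jA]]; [by left|right; split=> // jA'].
  by apply: jA; rewrite !inE ji.
Qed.

Lemma base_section_cat (Y : pspace) (h : raw -> Y) :
  (forall p, cat_at h p) -> forall p, cat_at (base_section h) p.
Proof. by move=> ch p; apply: cat_compc => //; cat_top. Qed.

End Splitting.

Section SplitTheorem.
Context {R : realType} {m : nat} (A S : {set 'I_m}) (i : 'I_m).
Context (iA : i \in A) (iS : i \notin S).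

Notation A' := (A :\ i).
Notation S' := (i |: S).
Notation raw := (raw R m).
Notation mpi := (@mpi R m).

Lemma mpi_pmap_cat B C (Y : pspace) (F : mod_space B C -> Y) : pmap F ->
  forall p, cat_at (fun p => F (mpi B C p)) p.
Proof. by move=> [cF _] p; apply: (cat_compc cF); exact: mpi_cat. Qed.

Lemma mpi_pmap_compat B C (Y : pspace) (F : mod_space B C -> Y) : pmap F ->
  mcompat B C (fun p => F (mpi B C p)).
Proof. by move=> [_ F0]; apply: mcompat_comp F0; exact: mpi_compat. Qed.

Lemma mtriv_free (v : 'rV[R]_m) x : mtriv A' S (upd v i x) v.
Proof.
by move=> j; rewrite updE; case: eqP => [->|_]; [right; rewrite !inE eqxx|left].
Qed.

(** Over the section the [g] half is constant. What remains is [f] run on the upper half of the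
    interval, and the homotopy stretches it linearly to the whole interval. *)
Lemma half_pinch_section (Y : pspace) (F : mod_space A S -> Y) (f : mod_space A' S -> Y)
    (g : mod_space A' S' -> Y) (inc : mod_space A' S -> mod_space A S) :
  pmap f -> pmap g ->
  (forall p, F (mpi A S p) = half_pinch (fun p => f (mpi A' S p)) (fun p => g (mpi A' S' p)) p) ->
  (forall p, inc (mpi A' S p) = base_section i (mpi A S) p) ->
  @phtp R _ _ (F \o inc) f.
Proof.
move=> pf pg FE incE.
have [fc fg ft] := mpi_pmap_compat pf; have [gc _ _] := mpi_pmap_compat pg.
apply: (mod_htp (K := fun p r => f (mpi A' S ((2 - r) * p.1.1 - (1 - r), p.1.2, p.2)))).
- move=> p; apply: cat_compc pf.1 _; apply: (cat_comp (f := mpi A' S)); first exact: mpi_cat.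
  by cat_top.
- move=> r /andP[r0 r1]; split.
  + move=> [[t s] v] pc; case: pc => /= [t0|t0|vj|vS]; apply: fc.
    * by apply: mcol0 => /=; nra.
    * by apply: mcol1 => /=; nra.
    * exact: Or43.
    * exact: Or44.
  + by move=> t s s' v h h'; exact: fg.
  + by move=> t s v v' h; exact: ft.
- move=> [[t s] v] /=; rewrite incE /base_section /= FE /half_pinch /= !subr0.
  case: ifP => [t1|_].
    by rewrite gc ?fc //; [apply: mcol0; lra|apply: mcol_smash; rewrite updE eqxx normr1].
  by apply/esym/ft/mtriv_free.
- by move=> [[t s] v] /=; congr (f (mpi _ _ (_, _, _))); lra.
Qed.

(** Since [f] ignores the coordinate [i], its part of the composite goes up a path and back down the
    same path. This spur is pulled below height 0, while [g], which occupies the first quarter of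
    the interval, is stretched to the whole of it. *)
Lemma half_pinch_fold (Y : pspace) (F : mod_space A S -> Y) (f : mod_space A' S -> Y)
    (g : mod_space A' S' -> Y) (psi : mod_space A' S' -> mod_space A S) :
  pmap f -> pmap g ->
  (forall p, F (mpi A S p) = half_pinch (fun p => f (mpi A' S p)) (fun p => g (mpi A' S' p)) p) ->
  (forall p, psi (mpi A' S' p) = fold_collar i (mpi A S) p) ->
  @phtp R _ _ (F \o psi) g.
Proof.
move=> pf pg FE psiE.
have [fc fg ft] := mpi_pmap_compat pf; have [gc gg gt] := mpi_pmap_compat pg.
have cf p := mpi_pmap_cat pf p; have cg p := mpi_pmap_cat pg p.
pose G (p : raw) (r : R) := g (mpi A' S' ((4 - 3 * r) * p.1.1, p.1.2, upd p.2 i ((2 - r) * p.2 ord0 i))).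
(* The slope 3 matches the stretching factor 4 - 3r: at the junction (4 - 3r)t = 1 the height is at
   most 4t - 1 - 3r = -3r(1 - t), so both branches are at the base point there. At r = 1 the height
   is negative everywhere. *)
pose M (p : raw) r := 2 * Num.min (Num.min (2 * p.1.1) (2 - 2 * p.1.1)) (collar i p) - 1 - 3 * r.
pose H (p : raw) r := f (mpi A' S (M p r, p.1.2, p.2)).
have norm2r (r x : R) : 0 <= r <= 1 -> `|(2 - r) * x| = (2 - r) * `|x|.
  by move=> r01; rewrite normrM ger0_norm //; lra.
apply: (mod_htp (K := fun p r => if (4 - 3 * r) * p.1.1 - 1 <= 0 then G p r else H p r)).
- apply: (cat_paste (a := fun p : raw * R => (4 - 3 * clamp p.2) * p.1.1.1 - 1)
    (f := fun p => G p.1 (clamp p.2)) (g := fun p => H p.1 (clamp p.2))).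
  + by move=> p; cat_top.
  + by move=> p _; apply: (cat_comp (cg _)); cat_top.
  + by move=> p _; apply: (cat_comp (cf _)); rewrite /M /collar; cat_top.
  + move=> [[[t s] v] r0] /=; move: (clamp_itv r0); move: (clamp r0) => r /andP[r1 r2] t1.
    rewrite /G /H gc ?fc //; last by apply: mcol1 => /=; lra.
    apply: mcol0; rewrite /M /=.
    have t2 : t <= 1.
      rewrite leNgt; apply/negP => t2.
      have : 0 <= (1 - r) * (t - 1) by rewrite mulr_ge0; lra.
      lra.
    have : 0 <= r * (1 - t) by rewrite mulr_ge0; lra.
    by minmax; lra.
- move=> r r01; have /andP[r0 r1] := r01; split.
  + move=> [[t s] v] pc /=; case: ifP => [t1|/negbT]; last rewrite -ltNge => t1.
      apply: gc; case: pc => /= [t0|t0|[j]|[/(_ i)]]; last by rewrite iS'.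
      * by apply: mcol0 => /=; rewrite mulr_ge0_le0 //; lra.
      * by apply: mcol1 => /=; have : 0 <= (1 - r) * (t - 1); [rewrite mulr_ge0|]; lra.
      * rewrite !inE; have [-> _ vi|ji /= jS vj] := eqVneq j i.
          apply: mcol_smash; rewrite updE eqxx norm2r //.
          by apply: (le_trans vi); rewrite ler_peMl //; lra.
        by apply: Or43; exists j; rewrite /= ?updE ?(negbTE ji) // !inE jS orbT.
    apply: fc; case: pc => /= [t0|t0|[j]|[/(_ i)]]; last by rewrite iS'.
    * by exfalso; have : (4 - 3 * r) * t <= 0; [rewrite mulr_ge0_le0 //|]; lra.
    * by apply: mcol0; rewrite /M /=; minmax; lra.
    * rewrite !inE; have [-> _ vi|ji /= jS vj] := eqVneq j i.
        by apply: mcol0; rewrite /M /collar /=; minmax; lra.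
      by apply: Or43; exists j.
  + move=> t s s' v h h' /=; rewrite /G /H /M /collar /= mxE normrN.
    case: ifP => _; first by rewrite mulrN -upd_opp; exact: gg.
    exact: fg.
  + move=> t s v v' vv /=; rewrite /G /H /M /collar /= (mtriv_coord vv).
    case: ifP => _; first apply: gt.
      move=> j; rewrite !updE; case: eqP => _; [by left|exact: vv].
    apply: ft => j; case: (vv j) => [|[jS jA]]; [by left|right; split=> //].
    by apply: contra jS => jS; rewrite !inE jS orbT.
- move=> [[t s] v] /=; rewrite psiE /fold_collar /= !mulr0 !subr0.
  have ft' v' x y : f (mpi A' S (y, s, upd v' i x)) = f (mpi A' S (y, s, v')).
    exact/ft/mtriv_free.
  have v2 : 2^-1 <= `|v ord0 i| -> 1 <= `|upd v i (2 * v ord0 i) ord0 i|.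
    by rewrite updE eqxx norm2M; lra.
  rewrite /G /H /M /= !mulr0 !subr0.
  case: (leP (t - 2^-1) 0) => t1; rewrite FE /half_pinch /=.
    case: (leP (4 * t - 1) 0) => t2.
      rewrite ifT; last by minmax; lra.
      have [tc|ct] := leP (2 * t) (collar i (t, s, v)).
        by rewrite mulrA (_ : 2 * 2 = 4 :> R) //; lra.
      by rewrite !gc //; apply/mcol_smash/v2; move: ct; rewrite /collar /=; minmax; lra.
    case: ifP => [t3|/negbT]; last rewrite -ltNge => t3.
      rewrite gc ?fc //; first by apply: mcol0; move: t3; minmax; lra.
      by apply/mcol_smash/v2; move: t3; rewrite /collar /=; minmax; lra.
    by rewrite ft' (min_l (_ : 2 * t <= 2 - 2 * t)) //; lra.
  have -> : (4 * t - 1 <= 0) = false by lra.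
  case: ifP => [t3|_].
    rewrite gc ?fc //; first by apply: mcol0; move: t3; minmax; lra.
    by apply: mcol_smash; rewrite updE eqxx normr1.
  by rewrite ft' (min_r (_ : 2 - 2 * t <= 2 * t)) //; lra.
- move=> [[t s] v] /=; rewrite /G /H /=.
  case: ifP => [_|/negbT]; last rewrite -ltNge => t1.
    by rewrite (_ : (2 - 1) * v ord0 i = v ord0 i) ?upd_id; [congr (g (mpi _ _ (_, _, _)))|]; lra.
  rewrite fc ?gc //; first by apply: mcol1; lra.
  by apply: mcol0; rewrite /M /=; minmax; lra.
Qed.

End SplitTheorem.

Section SplitIdentity.
Context {R : realType} {m : nat} (A S : {set 'I_m}) (i : 'I_m).
Context (iA : i \in A) (iS : i \notin S).

Notation A' := (A :\ i).
Notation S' := (i |: S).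
Notation raw := (raw R m).
Notation mpi := (@mpi R m).
Notation mod_space := (@mod_space R m).

Lemma collar_ge0 (p : raw) : 0 <= collar i p.
Proof. by rewrite /collar le_max lexx. Qed.

Lemma collar_eq0 (p : raw) : 1 <= `|p.2 ord0 i| -> collar i p = 0.
Proof. by move=> ?; rewrite /collar max_l //; lra. Qed.

Lemma collar_gt (p : raw) : collar i p < 1 -> 2^-1 <= `|p.2 ord0 i|.
Proof. by rewrite /collar gt_max => /andP[_]; lra. Qed.

(* Deforms the outcome of cancelling the two opposite paths over the section to the identity. *)
Definition expand (p : raw) (r : R) : raw :=
  ((1 - r) * Num.max (Num.min (Num.min (4 * p.1.1) 1) (collar i p)) (2 * p.1.1 - 1) +
     r * p.1.1, p.1.2, upd p.2 i ((2 - r) * p.2 ord0 i)).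

Lemma norm2rM (r x : R) : r <= 1 -> `|(2 - r) * x| = (2 - r) * `|x|.
Proof. by move=> r1; rewrite normrM ger0_norm //; lra. Qed.

Lemma norm2rM_ge1 (r x : R) : r <= 1 -> 1 <= `|x| -> 1 <= `|(2 - r) * x|.
Proof.
by move=> r1 x1; rewrite norm2rM //; apply: (le_trans x1); rewrite ler_peMl //; lra.
Qed.

Lemma mcol_updS (t' s : R) (v : 'rV[R]_m) x j : j \in S -> 1 <= `|v ord0 j| ->
  mcol A S (t', s, upd v i x).
Proof.
move=> jS vj; apply: Or43; exists j => //=; rewrite updE.
by case: eqP => // ji; move: iS; rewrite -ji jS.
Qed.

Arguments mcol_updS {t' s v x j}.

Lemma mcol_updA (t' s : R) (v : 'rV[R]_m) x : (forall j, j \notin S) -> 1 <= `|s| ->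
  (forall j, j \in A -> 1 <= `|v ord0 j|) -> 1 <= `|x| -> mcol A S (t', s, upd v i x).
Proof.
move=> S0 s1 vA x1; apply: Or44; split=> //= j jA; rewrite updE.
by case: eqP => // _; exact: vA.
Qed.

Lemma mtriv_updA (v v' : 'rV[R]_m) x y : mtriv A S v v' ->
  x = y \/ (1 <= `|x| /\ 1 <= `|y|) -> mtriv A S (upd v i x) (upd v' i y).
Proof.
move=> vv xy j; rewrite !updE; case: eqP => [->|_]; last exact: vv.
by case: xy => ?; [left|right].
Qed.

Lemma mtriv_collar (t s : R) (v v' : 'rV[R]_m) : mtriv A S v v' ->
  collar i (t, s, v) = collar i (t, s, v') /\
  (v ord0 i = v' ord0 i \/ (1 <= `|v ord0 i| /\ 1 <= `|v' ord0 i|)).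
Proof.
move=> vv; case: (vv i) => [E|[_ /(_ iA)[vi vi']]]; first by rewrite /collar /= E; split=> //; left.
by rewrite !collar_eq0 //; split=> //; right.
Qed.

Lemma expand_compat r : 0 <= r <= 1 -> mcompat A S (fun p => mpi A S (expand p r)).
Proof.
have [mc mg mt] := @mpi_compat R m A S.
move=> /andP[r0 r1]; split.
- move=> [[t s] v] pc; apply: mc; rewrite /expand; case: pc => /= [t0|t0|[j jS vj]|[S0 s1 vA]].
  + set T := Num.max _ _; have T0 : T <= 0.
      rewrite /T ge_max !ge_min; apply/andP; split; last by lra.
      by apply/orP; left; apply/orP; left; lra.
    have H1 : (1 - r) * T <= 0 by rewrite mulr_ge0_le0 // subr_ge0.
    have H2 : r * t <= 0 by rewrite mulr_ge0_le0.
    by apply: mcol0; move: H1 H2; clear; lra.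
  + set T := Num.max _ _; have T1 : 0 <= T - 1.
      by rewrite /T subr_ge0 le_max; apply/orP; right; lra.
    have H1 : 0 <= (1 - r) * (T - 1) by rewrite mulr_ge0 // subr_ge0.
    have H2 : 0 <= r * (t - 1) by rewrite mulr_ge0 // subr_ge0.
    by apply: mcol1; move: H1 H2; clear; lra.
  + exact: (mcol_updS jS vj).
  + by apply: mcol_updA => //; apply: norm2rM_ge1 => //; exact: vA.
- move=> t s s' v s1 s1'; rewrite /expand /collar /= mxE normrN mulrN -upd_opp; exact: mg.
- move=> t s v v' vv; rewrite /expand /=; have [-> H] := mtriv_collar t s vv.
  apply: mt; apply: mtriv_updA => //; case: H => [->|[vi vi']]; [by left|right].
  by split; exact: norm2rM_ge1.
Qed.

Lemma expand_cat (p : raw * R) : cat_at (fun p => mpi A S (expand p.1 (clamp p.2))) p.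
Proof.
apply: (cat_comp (f := mpi A S)); first exact: mpi_cat.
by rewrite /expand /collar; cat_top.
Qed.

(** In [phi] the interval is run up over the given point, then down and up again over the section.
    The lower bound [r] in [N] rises from 0 to 1 and fills this dip; only the doubled coordinate and
    the collar then differ from the identity, and [expand] removes both. *)
Lemma split_identity (phi : mod_space A S -> mod_space A S) :
  (forall p, phi (mpi A S p) =
     half_pinch (base_section i (mpi A S)) (fold_collar i (mpi A S)) p) ->
  @phtp R _ _ phi id.
Proof.
move=> phiE; have [mc mg mt] := @mpi_compat R m A S.
have [psi [ppsi psiE]] : exists F : mod_space A S -> mod_space A S,
    pmap F /\ forall p, F (mpi A S p) = mpi A S (expand p 0).
  apply: (mod_lift (f := fun p => mpi A S (expand p 0))); last first.
    by apply: expand_compat; rewrite lexx ler01.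
  move=> p; apply: (cat_comp (f := mpi A S)); first exact: mpi_cat.
  by rewrite /expand /collar; cat_top.
apply: (@phtp_trans _ _ _ _ psi); last first.
  apply: (mod_htp (K := fun p r => mpi A S (expand p r))).
  - exact: expand_cat.
  - exact: expand_compat.
  - by move=> p; rewrite psiE.
  - move=> [[t s] v]; rewrite /expand /= subrr mul0r add0r mul1r.
    by rewrite (_ : (2 - 1) * v ord0 i = v ord0 i) ?upd_id //; lra.
pose N (p : raw) r := Num.max (Num.min (Num.max (2 - 4 * p.1.1) r) (collar i p)) (2 * p.1.1 - 1).
pose G (p : raw) := mpi A S (Num.min (4 * p.1.1) (collar i p), p.1.2, upd p.2 i (2 * p.2 ord0 i)).
pose H (p : raw) r := mpi A S (N p r, p.1.2, upd p.2 i 1).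
(* From the height min(1, collar) upwards, the doubled coordinate may be replaced by the section:
   either the height is at least 1 and the point is collapsed, or the collar is below 1 and the
   doubled coordinate represents the base point. *)
have tech (t s t' : R) (v : 'rV[R]_m) : Num.min 1 (collar i (t, s, v)) <= t' ->
    mpi A S (t', s, upd v i (2 * v ord0 i)) = mpi A S (t', s, upd v i 1).
  rewrite ge_min => /orP[t1|ct]; first by rewrite !mc //; exact: mcol1.
  have [t1|t1] := leP 1 t'; first by rewrite !mc //; exact: mcol1.
  apply: mt; apply: mtriv_upd => //; right; rewrite norm2M normr1; split=> //.
  have := @collar_gt (t, s, v) (le_lt_trans ct t1); rewrite /=; lra.
apply: (mod_htp (K := fun p r => if 4 * p.1.1 - 1 <= 0 then G p else H p r)).
- apply: (cat_paste (a := fun p : raw * R => 4 * p.1.1.1 - 1)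
    (f := fun p => G p.1) (g := fun p => H p.1 (clamp p.2))).
  + by move=> p; cat_top.
  + move=> p _; apply: (cat_comp (f := mpi A S)); first exact: mpi_cat.
    by rewrite /collar; cat_top.
  + move=> p _; apply: (cat_comp (f := mpi A S)); first exact: mpi_cat.
    by rewrite /N /collar; cat_top.
  + move=> [[[t s] v] r] /= t1; rewrite /G /H /N /=.
    have E : 4 * t = 1 by lra.
    have -> : Num.max (Num.min (Num.max (2 - 4 * t) (clamp r)) (collar i (t, s, v))) (2 * t - 1)
              = Num.min 1 (collar i (t, s, v)).
      have := clamp_le1 r; have := collar_ge0 (t, s, v).
      by rewrite (_ : 2 - 4 * t = 1) => [c0 r1|]; [rewrite (max_l r1) max_l // le_min|]; lra.
    by rewrite E; exact: tech.
- move=> r /andP[r0 r1]; split.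
  + move=> [[t s] v] pc /=; rewrite /G /H; case: ifP => [t1|/negbT]; last rewrite -ltNge => t1.
      apply: mc; case: pc => /= [t0|t0|[j jS vj]|[S0 s1 vA]].
      * by apply: mcol0; rewrite ge_min; apply/orP; left; lra.
      * by exfalso; lra.
      * exact: (mcol_updS jS vj).
      * apply: mcol_updA => //; rewrite norm2M; have := vA _ iA; lra.
    apply: mc; case: pc => /= [t0|t0|[j jS vj]|[S0 s1 vA]].
    * by exfalso; lra.
    * by apply: mcol1; rewrite /N le_max; apply/orP; right => /=; lra.
    * exact: (mcol_updS jS vj).
    * by apply: mcol_updA => //; rewrite normr1.
  + move=> t s s' v s1 s1' /=; rewrite /G /H /N /collar /= mxE normrN; case: ifP => _.
      by rewrite mulrN -upd_opp; exact: mg.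
    rewrite (mg _ s s') // upd_opp; apply: mt; apply: mtriv_upd => //; right.
    by rewrite normrN normr1.
  + move=> t s v v' vv /=; rewrite /G /H /N /=; have [-> E] := mtriv_collar t s vv.
    case: ifP => _; apply: mt; apply: mtriv_updA => //; last by left.
    by case: E => [->|[vi vi']]; [left|right; rewrite !norm2M; split; lra].
- move=> [[t s] v] /=; rewrite phiE /half_pinch /G /H /N /=.
  rewrite /base_section /fold_collar /=.
  have c0 := collar_ge0 (t, s, v).
  have cE x : collar i (x, s, v) = collar i (t, s, v) by [].
  rewrite !cE; move: (collar i (t, s, v)) c0 => c c0.
  case: (leP (4 * t - 1) 0) => t1.
    have -> : (t - 2^-1 <= 0) = true by lra.
    have -> : (2 * t - 2^-1 <= 0) = true by lra.
    by rewrite mulrA (_ : 2 * 2 = 4 :> R) //; lra.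
  case: ifP => [t2|/negbT]; last rewrite -ltNge => t2.
    have -> : (2 * t - 2^-1 <= 0) = false by lra.
    rewrite (max_l (_ : 0 <= 2 - 4 * t)); last by lra.
    rewrite (_ : 2 - 2 * (2 * t) = 2 - 4 * t); last by lra.
    by rewrite max_l // le_min; lra.
  rewrite (max_r (_ : 2 - 4 * t <= 0)); last by lra.
  by rewrite min_l // max_r //; lra.
- move=> [[t s] v] /=; rewrite psiE /expand /G /H /N /= subr0 mul1r mul0r addr0 subr0.
  have c0 := collar_ge0 (t, s, v).
  case: (leP (4 * t - 1) 0) => t1.
    rewrite (min_l (_ : 4 * t <= 1)); last by lra.
    have [t0|t0] := leP t 0.
      rewrite !mc //; last by apply: mcol0; rewrite ge_min; apply/orP; left; lra.
      apply: mcol0; rewrite ge_max ge_min; apply/andP; split; last by lra.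
      by apply/orP; left; lra.
    by rewrite max_l // le_min; lra.
  rewrite (min_r (_ : 1 <= 4 * t)); last by lra.
  rewrite (max_r (_ : 2 - 4 * t <= 1)); last by lra.
  by apply/esym/(tech t); rewrite le_max lexx.
Qed.

(** Existence: the two maps are added by [half_pinch]. Uniqueness: the identity is homotopic to the
    sum [phi] of the two inclusions, so a map is determined by its restrictions, and homotopies
    between the restrictions are added by the same [half_pinch], time by time. *)
Theorem mod_split :
  @hcoprod R bool (fun b => if b then mod_space A' S' else mod_space A' S) (mod_space A S).
Proof.
have mc := @mpi_compat R m A S.
have mcat : forall p, cat_at (mpi A S) p by move=> p; exact: mpi_cat.
have [inc [pinc incE]] := mod_lift (base_section_cat mcat) (base_section_compat iS mc).
have [psi [ppsi psiE]] := mod_lift (fold_collar_cat iS mcat mc) (fold_collar_compat iS mc).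
have pinch (Y : pspace) (f : mod_space A' S -> Y) (g : mod_space A' S' -> Y) :
    pmap f -> pmap g -> exists h : mod_space A S -> Y, pmap h /\ forall p,
      h (mpi A S p) = half_pinch (fun p => f (mpi A' S p)) (fun p => g (mpi A' S' p)) p.
  move=> pf pg; have fc := mpi_pmap_compat pf; have gc := mpi_pmap_compat pg.
  apply: (mod_lift (f := half_pinch (fun p => f (mpi A' S p)) (fun p => g (mpi A' S' p)))); last first.
    exact: (half_pinch_compat iA fc gc).
  have H : forall q : raw * R, cat_at (fun q => half_pinch
      (fun p => f (mpi A' S p)) (fun p => g (mpi A' S' p)) q.1) q.
    apply: (half_pinch_cat (A := A) (S := S) (i := i)
      (f := fun p _ => f (mpi A' S p)) (g := fun p _ => g (mpi A' S' p))) => //.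
    - by move=> q /=; apply: (cat_comp (f := fun p => f (mpi A' S p))); [exact: mpi_pmap_cat|cat_auto].
    - by move=> q /=; apply: (cat_comp (f := fun p => g (mpi A' S' p))); [exact: mpi_pmap_cat|cat_auto].
  move=> p; exact: (cat_comp (H (p, 0)) (cat_pair (@cat_id _ p) (@cat_cst _ _ (0 : R) p))).
exists (fun b => if b as b0 return ((if b0 then mod_space A' S' else mod_space A' S) : pspace) ->
  mod_space A S then psi else inc); split.
- by case.
- move=> Y f pf; have [h [ph hE]] := pinch _ _ _ (pf false) (pf true).
  exists h; split=> // -[].
  + by apply: half_pinch_fold hE psiE => //; [exact: (pf false)|exact: (pf true)].
  + by apply: half_pinch_section hE incE => //; [exact: (pf false)|exact: (pf true)].
have [phi [pphi phiE]] := pinch _ _ _ pinc ppsi.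
have phi_id : @phtp R _ _ phi id.
  by apply: split_identity => p; rewrite phiE /half_pinch incE psiE.
move=> Y h h' ph ph' hh.
apply: (@phtp_trans _ _ _ _ (h \o phi)).
  exact: phtp_sym (phtp_compl ph phi_id).
apply: (@phtp_trans _ _ _ _ (h' \o phi)); last exact: (phtp_compl ph' phi_id).
have [K1 [cK1 [K10 [K11 K1p]]]] := hh false; have [K2 [cK2 [K20 [K21 K2p]]]] := hh true.
pose k1 p r := K1 (mpi A' S p, r); pose k2 p r := K2 (mpi A' S' p, r).
have k1c r : mcompat A' S (k1 ^~ r).
  by apply: (mcompat_comp (F := fun x => K1 (x, r))) => //; exact: mpi_compat.
have k2c r : mcompat A' S' (k2 ^~ r).
  by apply: (mcompat_comp (F := fun x => K2 (x, r))) => //; exact: mpi_compat.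
apply: (mod_htp (K := fun p r => half_pinch (k1 ^~ r) (k2 ^~ r) p)).
- move=> p; apply: (cat_comp (f := fun q : raw * R => half_pinch (k1 ^~ q.2) (k2 ^~ q.2) q.1)
    (g := fun q : raw * R => (q.1, clamp q.2))); last by cat_top.
  apply: half_pinch_cat k1c k2c _ _ _ => q.
  + apply: (cat_compc cK1); apply: cat_pair; last by cat_auto.
    by apply: (cat_comp (f := mpi A' S)); [exact: mpi_cat|cat_auto].
  + apply: (cat_compc cK2); apply: cat_pair; last by cat_auto.
    by apply: (cat_comp (f := mpi A' S')); [exact: mpi_cat|cat_auto].
- by move=> r _; exact: (half_pinch_compat iA (k1c r) (k2c r)).
- move=> p; rewrite /= phiE /half_pinch /k1 /k2.
  by case: ifP => _; [rewrite K20|rewrite K10].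
- move=> p; rewrite /= phiE /half_pinch /k1 /k2.
  by case: ifP => _; [rewrite K21|rewrite K11].
Qed.

End SplitIdentity.

Section SplitAll.
Context {R : realType} {m : nat}.
Implicit Types A S : {set 'I_m}.
Notation mod_space := (@mod_space R m).

Lemma phe_eq (X Y : pspace) : X = Y -> @phe R X Y.
Proof. by move=> ->; exact: phe_refl. Qed.

Lemma mod_split_all A S : (forall i, i \in A -> i \notin S) ->
  @hcoprod R {B : {set 'I_m} | B \subset A} (fun B => mod_space finset.set0 (S :|: val B)) (mod_space A S).
Proof.
move: {2}#|A| (leqnn #|A|) => k; elim: k A S => [|k IH] A S.
  rewrite leqn0 finset.cards_eq0 => /eqP -> _.
  have sub0 : (finset.set0 : {set 'I_m}) \subset finset.set0 by [].
  pose g (B : {B : {set 'I_m} | B \subset finset.set0}) := tt.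
  pose g' (_ : unit) : {B : {set 'I_m} | B \subset finset.set0} := exist (fun B : {set 'I_m} => B \subset finset.set0) _ sub0.
  refine (@hcoprod_reindex R _ _ _ _ _ g g' _ _ _ (@hcoprod1 R (mod_space finset.set0 S))).
  - by move=> [B B0]; apply: val_inj; apply/esym/eqP; rewrite -finset.subset0.
  - by case.
  - by move=> [B /=]; rewrite finset.subset0 => /eqP ->; apply: phe_eq; rewrite finset.setU0.
have [-> _|/finset.set0Pn[i iA]] := eqVneq A finset.set0; first by apply: IH; rewrite finset.cards0.
rewrite (cardsD1 i A) iA ltnS => Ak dAS.
have iS : i \notin S by exact: dAS.
have d1 j : j \in A :\ i -> j \notin S by rewrite !inE => /andP[_ /dAS].
have d2 j : j \in A :\ i -> j \notin i |: S.
  by rewrite !inE negb_or => /andP[-> /dAS].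
pose X (b : bool) := if b then i |: S else S.
have HX b : @hcoprod R {B : {set 'I_m} | B \subset A :\ i}
    (fun B => mod_space finset.set0 (X b :|: val B)) (mod_space (A :\ i) (X b)).
  by case: b; apply: IH.
have Hb : @hcoprod R bool (fun b => mod_space (A :\ i) (X b)) (mod_space A S).
  apply: (hcoprod_reindex (g := id) (g' := id) _ _ _ (mod_split iA iS)) => //.
  by case; exact: phe_refl.
have D (B : {set 'I_m}) : B \subset A -> B :\ i \subset A :\ i by exact: finset.setSD.
have U (b : bool) (B : {set 'I_m}) : B \subset A :\ i -> (if b then i |: B else B) \subset A.
  move=> BA; have BA' := fintype.subset_trans BA (finset.subD1set _ _).
  by case: b => //; rewrite finset.subUset finset.sub1set iA.
(* A subset [B] of [A] amounts to the answer whether it contains [i], together with the rest of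
   [B]. *)
apply: (hcoprod_reindex
  (g := fun B : {B : {set 'I_m} | B \subset A} => existT (fun=> {B : {set 'I_m} | B \subset A :\ i}) (i \in val B)
          (exist (fun B : {set 'I_m} => B \subset A :\ i) (val B :\ i) (D _ (valP B))))
  (g' := fun c => exist (fun B : {set 'I_m} => B \subset A) (if projT1 c then i |: val (projT2 c) else val (projT2 c))
          (U _ _ (valP (projT2 c)))) _ _ _ (hcoprod_sig HX Hb)).
- move=> [B BA]; apply: val_inj => /=; case: ifP => iB; first exact: finset.setD1K.
  by apply/finset.setP => j; rewrite !inE; case: eqP => // ->; rewrite iB.
- move=> [b [B BA]] /=.
  have iB : i \notin B by apply/negP => /(fintype.subsetP BA); rewrite !inE eqxx.
  have E1 : (i \in (if b then i |: B else B)) = b.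
    by case: b; rewrite ?inE ?eqxx // (negbTE iB).
  have E2 : (if b then i |: B else B) :\ i = B.
    clear E1; case: b; rewrite ?finset.setU1K //; apply/finset.setP => j; rewrite !inE.
    by case: eqP => // ->; rewrite (negbTE iB).
  move: (D _ _); rewrite E1 E2 => H; congr (existT _ b _); exact: val_inj.
- move=> [B BA] /=; apply: phe_eq; congr (mod_space _ _); apply/finset.setP => j.
  rewrite /X; case: ifP => iB; rewrite !inE; case: eqP => [->|] //=; rewrite ?iB ?orbT ?orbF //.
Qed.

Lemma mod_coprod :
  @hcoprod R {set 'I_m} (mod_space finset.set0) (mod_space [set: 'I_m]%SET finset.set0).
Proof.
have d (i : 'I_m) : i \in [set: 'I_m]%SET -> i \notin (finset.set0 : {set 'I_m}).
  by rewrite finset.in_set0.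
apply: (hcoprod_reindex (g := fun B => exist (fun B : {set 'I_m} => B \subset [set: 'I_m]%SET) B (finset.subsetT B)) (g' := val) _ _ _ (mod_split_all d)) => //.
- by move=> [B H]; exact: val_inj.
- by move=> B; apply: phe_eq; rewrite finset.set0U.
Qed.

End SplitAll.

(** * Compact representatives for the models, and the parametrised circle *)

Section Box.
Context {R : realType} {m : nat}.
Notation raw := (raw R m).
Notation mpi := (@mpi R m).
Implicit Types A S : {set 'I_m}.

Definition trunc (x : R) : R := Num.max (-1) (Num.min 1 x).

Lemma trunc_itv x : -1 <= trunc x <= 1.
Proof. by rewrite /trunc; minmax; lra. Qed.

Lemma trunc_id x : -1 <= x <= 1 -> trunc x = x.
Proof. by move=> /andP[? ?]; rewrite /trunc; minmax; lra. Qed.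

Lemma trunc_or x : trunc x = x \/ (1 <= `|x| /\ 1 <= `|trunc x|).
Proof.
rewrite !ler_normr /trunc; minmax; do ?[by left; lra]; right; split; lra.
Qed.

Lemma truncN x : trunc (- x) = - trunc x.
Proof. by rewrite /trunc; minmax; lra. Qed.

Lemma trunc_ge x : 1 <= x -> trunc x = 1.
Proof. by move=> ?; rewrite /trunc; minmax; lra. Qed.

Lemma trunc_le x : x <= -1 -> trunc x = -1.
Proof. by move=> ?; rewrite /trunc; minmax; lra. Qed.

Lemma cat_trunc (X : topologicalType) (f : X -> R) x :
  cat_at f x -> cat_at (fun y => trunc (f y)) x.
Proof. by move=> cf; rewrite /trunc; cat_auto. Qed.

(** Every class of a model has a representative here, by [mpi_to_box]; compactness of this set makes
    the inverse maps continuous. *)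
Definition box : set raw :=
  (`[0, 1]%classic `*` `[-1, 1]%classic) `*`
    [set v : 'rV[R]_m | forall i, `[-1, 1]%classic (v ord0 i)].

Lemma boxP t s v : box (t, s, v) <->
  [/\ 0 <= t <= 1, -1 <= s <= 1 & forall i, -1 <= v ord0 i <= 1].
Proof.
split.
- case=> -[ht hs] hv; split; first by move: ht; rewrite /= in_itv.
    by move: hs; rewrite /= in_itv.
  by move=> i; have := hv i; rewrite /= in_itv.
- move=> [t1 s1 v1]; split; first by split; rewrite /= in_itv.
  by move=> i /=; rewrite in_itv /= v1.
Qed.

Lemma box_compact : compact box.
Proof.
apply: compact_setX; first by apply: compact_setX; exact: segment_compact.
by apply: (@rV_compact R m (fun _ => `[-1, 1]%classic)) => _; exact: segment_compact.
Qed.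

Definition to_box (p : raw) : raw :=
  (clamp p.1.1, trunc p.1.2, \matrix_(k, i) trunc (p.2 k i)).

Lemma to_boxP p : box (to_box p).
Proof.
apply/boxP; split; [exact: clamp_itv|exact: trunc_itv|].
by move=> i; rewrite mxE; exact: trunc_itv.
Qed.

Lemma mpi_to_box A S p : mpi A S (to_box p) = mpi A S p.
Proof.
have [mc mg mt] := @mpi_compat R m A S.
case: p => [[t s] v]; rewrite /to_box /=.
have [t0|t0] := leP t 0.
  by rewrite !mc //; apply: mcol0 => //; rewrite /clamp; minmax; lra.
have [t1|t1] := leP 1 t.
  by rewrite !mc //; apply: mcol1 => //; rewrite /clamp; minmax; lra.
rewrite clamp_id; last by rewrite !ltW.
have sE (w : 'rV[R]_m) : mpi A S (t, trunc s, w) = mpi A S (t, s, w).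
  have [s0|s0] := leP s (-1).
    by rewrite trunc_le // (mg _ _ 1) // [RHS](mg _ _ 1).
  have [s1|s1] := leP 1 s.
    have H s' : 1 <= s' -> mpi A S (t, s', w) = mpi A S (t, -1, - w).
      by move=> h; rewrite (mg _ (-1) s') ?opprK.
    by rewrite trunc_ge // !H.
  by rewrite trunc_id // !ltW.
rewrite sE.
have [[i iS vi]|H] := pselect (exists2 i, i \in S & 1 <= `|v ord0 i|).
  rewrite !mc //; first by apply: Or43; exists i.
  by apply: Or43; exists i => //=; rewrite mxE; case: (trunc_or (v ord0 i)) => [->|[]].
apply: mt => i; rewrite mxE; case: (trunc_or (v ord0 i)) => [->|[v1 v2]]; [by left|right].
by split; [apply/negP => iS; apply: H; exists i|].
Qed.

Lemma mod_box_ind A S (P : mod_space A S -> Prop) :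
  (forall p, box p -> P (mpi A S p)) -> forall x, P x.
Proof. by move=> H; apply: mod_ind => p; rewrite -mpi_to_box; apply/H/to_boxP. Qed.

Lemma box0 : box (0, 0, 0).
Proof.
have H : -1 <= (0 : R) <= 1 by apply/andP; split; lra.
by apply/boxP; split=> // [|i]; rewrite ?mxE // lexx ler01.
Qed.

(** The inverse [F] comes from outside, in practice from [compact_lift], and has to be compared with
    [f] only on representatives in the box. *)
Lemma mod_iso A S (Y : pspace) (f : raw -> Y) (F : Y -> mod_space A S) :
  (forall p, cat_at f p) -> mcompat A S f -> continuous F ->
  (forall p, box p -> F (f p) = mpi A S p) ->
  (forall y, exists2 p, box p & f p = y) -> @phe R (@mod_space R m A S) Y.
Proof.
move=> cf fc cF Ff fs; have [G [pG GE]] := mod_lift cf fc.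
apply: (@phe_iso _ _ _ G F) => //.
- split=> //; have [fc0 _ _] := fc.
  by rewrite -(fc0 (0, 0, 0)) ?Ff //; [exact: box0|apply: mcol0].
- by apply: mod_box_ind => p bp; rewrite GE Ff.
- by move=> y; have [p bp <-] := fs y; rewrite Ff.
Qed.

End Box.

Ltac cat_all := repeat first
  [ cat_step | assumption
  | lazymatch goal with
    | |- cat_at (fun y => clamp (@?f y)) _ => refine (@cat_clamp _ _ f _ _)
    | |- cat_at (fun y => trunc (@?f y)) _ => refine (@cat_trunc _ _ f _ _)
    end ].

Section Circle.
Context {R : realType}.

Lemma sqr_le1 (x : R) : x ^+ 2 <= 1 -> -1 <= x <= 1.
Proof.
move=> x1; rewrite -ler_norml -[_ <= _]ler_sqr ?nnegrE //.
by rewrite real_normK ?num_real // expr1n.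
Qed.

(** Half-angle formulas: in absolute value c is the cosine of half the angle of (a, b), and it takes
    its sign from b. *)
Lemma circle_surj (a b : R) : a ^+ 2 + b ^+ 2 = 1 -> exists c : R,
  [/\ -1 <= c <= 1, 2 * c ^+ 2 - 1 = a & 2 * c * Num.sqrt (1 - c ^+ 2) = b].
Proof.
move=> ab.
have a1 : -1 <= a <= 1 by apply: sqr_le1; rewrite -ab lerDl sqr_ge0.
have [q [q0 q2]] : exists q : R, 0 <= q /\ q ^+ 2 = (1 + a) / 2.
  by exists (Num.sqrt ((1 + a) / 2)); rewrite sqrtr_ge0 sqr_sqrtr //; lra.
have /andP[_ q1] : -1 <= q <= 1 by apply: sqr_le1; rewrite q2; lra.
have E : 2 * q * Num.sqrt (1 - q ^+ 2) = `|b|.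
  apply/eqP; rewrite -(@eqrXn2 _ 2) // ?mulr_ge0 ?sqrtr_ge0 //; apply/eqP.
  rewrite real_normK ?num_real // !exprMn sqr_sqrtr q2; last by lra.
  by rewrite (_ : b ^+ 2 = 1 - a ^+ 2); [field|lra].
have [b0|b0] := leP 0 b.
  exists q; split; [by rewrite q1 andbT; lra|by rewrite q2; lra|by rewrite E ger0_norm].
exists (- q); split; [by rewrite lerNl opprK q1; lra|by rewrite sqrrN q2; lra|].
by rewrite sqrrN mulrN mulNr E ltr0_norm // opprK.
Qed.

Lemma circle_inj (c d : R) : -1 <= c <= 1 -> -1 <= d <= 1 ->
  2 * c ^+ 2 - 1 = 2 * d ^+ 2 - 1 ->
  2 * c * Num.sqrt (1 - c ^+ 2) = 2 * d * Num.sqrt (1 - d ^+ 2) ->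
  c = d \/ (1 <= `|c| /\ 1 <= `|d|).
Proof.
move=> c1 d1 E1; have E : c ^+ 2 = d ^+ 2 by lra.
rewrite E => E2; have /eqP := E; rewrite eqf_sqr => /orP[/eqP|/eqP cd]; first by left.
have : d * Num.sqrt (1 - d ^+ 2) = 0 by move: E2; rewrite cd; lra.
move/eqP; rewrite mulf_eq0 => /orP[/eqP d0|]; first by left; rewrite cd d0 oppr0.
rewrite sqrtr_eq0 subr_le0 => d2; right.
have H : 1 <= `|d| by rewrite -[_ <= _]ler_sqr ?nnegrE // expr1n real_normK ?num_real.
by rewrite cd normrN.
Qed.

Lemma half_circle (a b : R) : a ^+ 2 + b ^+ 2 = 1 -> 0 <= b ->
  [/\ -1 <= - a <= 1 & Num.sqrt (1 - (- a) ^+ 2) = b].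
Proof.
move=> ab b0; split.
  by apply: sqr_le1; rewrite sqrrN -ab lerDl sqr_ge0.
by rewrite (_ : 1 - (- a) ^+ 2 = b ^+ 2) ?sqrtr_sqr ?ger0_norm //; lra.
Qed.

End Circle.

(** * The suspension of K_n *)

Section Start.
Context {R : realType} (m : nat).
Notation raw := (raw R m).
Notation Torus := (@torus R m.+1).
Notation Kn' := (@Kn R m.+1).
Notation J := (@unit_interval R).
Notation setT' := [set: 'I_m]%SET.
Notation set0' := (finset.set0 : {set 'I_m}).
Notation mp := (@mpi R m setT' set0').

Lemma clamp_in (r : R) : clamp r \in (`[0, 1]%classic : set R).
Proof. by rewrite inE /= in_itv /=; exact: clamp_itv. Qed.

Definition to_J (r : R) : J := SigSub (clamp_in r).

Lemma to_JE r : set_val (to_J r) = clamp r.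
Proof. by []. Qed.

Lemma to_J_val (u : J) : to_J (set_val u) = u.
Proof.
apply: val_inj => /=; apply: clamp_id.
by have := set_valP u; rewrite /= in_itv.
Qed.

(** A parametrisation of the circle by [-1, 1] in which conjugation is c -> -c and the base point 1
    is attained exactly at c = 1 and c = -1. *)
Definition chi (c : R) (j : 'I_2) : R :=
  if j == ord0 then 2 * c ^+ 2 - 1 else 2 * c * Num.sqrt (1 - c ^+ 2).

(** Of the last circle only the upper half is parametrised: every orbit of the involution meets it,
    and its ends, z = 1 at s = -1 and z = -1 at s = 1, are exchanged by the involution. *)
Definition half (s : R) (j : 'I_2) : R := if j == ord0 then - s else Num.sqrt (1 - s ^+ 2).

Definition tor_mx (p : raw) : 'M[R]_(m.+1, 2) :=
  \matrix_(i, j) if unlift ord_max i is Some k then chi (trunc (p.2 ord0 k)) j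
                 else half (trunc p.1.2) j.

Let i1 : 'I_2 := inord 1.

Lemma i1E : (i1 == ord0) = false.
Proof. by rewrite -val_eqE /= inordK. Qed.

Lemma ord2P (j : 'I_2) : j = ord0 \/ j = i1.
Proof. by case: j => -[|[|//]] lj; [left|right]; apply: val_inj; rewrite //= inordK. Qed.

Lemma tor_lift p k j : tor_mx p (lift ord_max k) j = chi (trunc (p.2 ord0 k)) j.
Proof. by rewrite mxE liftK. Qed.

Lemma tor_last p j : tor_mx p ord_max j = half (trunc p.1.2) j.
Proof. by rewrite mxE unlift_none. Qed.

Lemma sqr_trunc (x : R) : 0 <= 1 - trunc x ^+ 2.
Proof. by have /andP[] := trunc_itv x; nra. Qed.

Lemma tor_in p : tor_mx p \in @torus_set R m.+1.
Proof.
rewrite inE => i; case: (unliftP ord_max i) => [k ->|->].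
  rewrite !tor_lift /chi eqxx i1E !exprMn sqr_sqrtr ?sqr_trunc //; ring.
by rewrite !tor_last /half eqxx i1E sqrrN sqr_sqrtr ?sqr_trunc //; ring.
Qed.

Definition tor (p : raw) : Torus := SigSub (tor_in p).

Lemma torE p : set_val (tor p) = tor_mx p.
Proof. by []. Qed.

Lemma tor_cat p : cat_at tor p.
Proof.
apply: cat_set_type; rewrite /tor /=; apply: cat_matrix => i j.
by case: unlift => [k|]; rewrite /chi /half; case: (j == ord0); cat_all.
Qed.

Lemma inv_in (z : Torus) : Kn_invol (set_val z) \in @torus_set R m.+1.
Proof.
rewrite inE => i; have := set_valP z i; rewrite !mxE /=.
have -> : (nat_of_ord (inord 1 : 'I_2) == 0)%N = false by rewrite inordK.
by case: ifP => _; rewrite ?sqrrN.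
Qed.

Definition inv (z : Torus) : Torus := SigSub (inv_in z).

Lemma inv_lift (z : Torus) k j :
  set_val (inv z) (lift ord_max k) j = if j == ord0 then set_val z (lift ord_max k) j
                                      else - set_val z (lift ord_max k) j.
Proof.
by rewrite /= mxE /= /bump leqNgt ltn_ord /= add0n ltn_eqF.
Qed.

Lemma inv_last (z : Torus) j : set_val (inv z) ord_max j = - set_val z ord_max j.
Proof. by rewrite /= mxE /= eqxx. Qed.

Lemma invK z : inv (inv z) = z.
Proof.
apply: val_inj; apply/matrixP => i j; case: (unliftP ord_max i) => [k ->|->].
  rewrite [LHS]inv_lift inv_lift; case: (j == ord0) => //; exact: opprK.
by rewrite [LHS]inv_last inv_last; exact: opprK.
Qed.

Lemma inv_cat z : cat_at inv z.
Proof.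
apply: cat_set_type; rewrite /inv /= /Kn_invol; apply: cat_matrix => i j.
by case: (i == _ :> nat); [|case: (j == _ :> nat)]; cat_all.
Qed.

(** On the edge of the half torus, where the last coordinate is real, the involution becomes the
    gluing of the faces s = -1 and s = 1. The second alternative says that the point is off the
    edge. *)
Lemma tor_inv t s v : inv (tor (t, s, v)) = tor (t, - s, - v) \/ 1 <> trunc s ^+ 2.
Proof.
have [E|] := eqVneq (trunc s ^+ 2) 1; last by move/eqP/nesym; right.
left; apply: val_inj; apply/matrixP => i j; case: (unliftP ord_max i) => [k ->|->].
  rewrite [LHS]inv_lift [RHS]tor_lift torE tor_lift /= mxE truncN /chi.
  by case: (j == ord0); rewrite sqrrN; ring.
rewrite [LHS]inv_last [RHS]tor_last torE tor_last /= truncN /half sqrrN E subrr sqrtr0.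
by case: ifP => _; rewrite ?oppr0.
Qed.

(* Reflects the torus onto the half of it that is parametrised by [tor]. *)
Definition fold_mx (z : Torus) : 'M[R]_(m.+1, 2) :=
  \matrix_(i, j) if (i == ord_max) && (j == i1) then `|set_val z i j| else set_val z i j.

Lemma fold_mx_id (z : Torus) : 0 <= set_val z ord_max i1 -> fold_mx z = set_val z.
Proof.
move=> z0; apply/matrixP => i j; rewrite mxE; case: eqP => //= ->.
by case: eqP => // ->; rewrite ger0_norm.
Qed.

Lemma tor_ge0 p : 0 <= set_val (tor p) ord_max i1.
Proof. by rewrite tor_last /half i1E sqrtr_ge0. Qed.

Lemma tor_surj (z : 'M[R]_(m.+1, 2)) t : (forall i, z i ord0 ^+ 2 + z i i1 ^+ 2 = 1) ->
  0 <= z ord_max i1 -> 0 <= t <= 1 -> exists s v, box (t, s, v) /\ tor_mx (t, s, v) = z.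
Proof.
move=> zT z0 t01.
have /choice [c cP] : forall k : 'I_m, exists c : R, [/\ -1 <= c <= 1,
    2 * c ^+ 2 - 1 = z (lift ord_max k) ord0 &
    2 * c * Num.sqrt (1 - c ^+ 2) = z (lift ord_max k) i1].
  by move=> k; exact: circle_surj.
have [s1 sE] := half_circle (zT ord_max) z0.
exists (- z ord_max ord0), (\row_k c k); split.
  by apply/boxP; split=> // k; rewrite mxE; case: (cP k).
apply/matrixP => i j; case: (unliftP ord_max i) => [k ->|->].
  rewrite tor_lift /= mxE; have [c1 c2 c3] := cP k.
  by rewrite trunc_id // /chi; case: (ord2P j) => ->; rewrite ?eqxx ?i1E.
rewrite tor_last /= trunc_id // /half.
by case: (ord2P j) => ->; rewrite ?eqxx ?i1E // opprK.
Qed.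

Lemma tor_fibre p q : box p -> box q -> tor_mx p = tor_mx q -> p.1.1 = q.1.1 -> mp p = mp q.
Proof.
have [mc mg mt] := @mpi_compat R m setT' set0'.
case: p q => [[t s] v] [[t' s'] v'] /boxP[t1 s1 v1] /boxP[t2 s2 v2] E /= <-.
have -> : s' = s.
  have := congr1 (fun M : 'M_(_, _) => M ord_max ord0) E.
  by rewrite /= !tor_last /= !trunc_id // /half eqxx => /oppr_inj.
apply: mt => k.
have E0 := congr1 (fun M : 'M_(_, _) => M (lift ord_max k) ord0) E.
have E1 := congr1 (fun M : 'M_(_, _) => M (lift ord_max k) i1) E.
move: E0 E1; rewrite /= !tor_lift /= !trunc_id // /chi eqxx i1E => E0 E1.
case: (circle_inj (v1 k) (v2 k) E0 E1) => [|]; [by left|right].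
by rewrite finset.in_set0.
Qed.

Lemma tor_glue t s v : trunc s ^+ 2 = 1 -> mp (t, - s, - v) = mp (t, s, v).
Proof.
have [mc mg mt] := @mpi_compat R m setT' set0'.
move=> /eqP; rewrite sqrf_eq1 => /orP[] /eqP; rewrite /trunc => H.
  by rewrite (mg _ (- s) s) ?opprK //; move: H; minmax; lra.
by rewrite (mg _ s (- s)) //; move: H; minmax; lra.
Qed.

Lemma torus_cover (z : Torus) t : exists2 p, box p /\ p.1.1 = clamp t & z = tor p \/ inv z = tor p.
Proof.
have zT (w : Torus) i : set_val w i ord0 ^+ 2 + set_val w i i1 ^+ 2 = 1 by exact: (set_valP w i).
have [z0|z0] := leP 0 (set_val z ord_max i1).
  have [s [v [bp E]]] := tor_surj (zT z) z0 (clamp_itv t).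
  by exists (clamp t, s, v) => //; left; exact: val_inj.
have z1 : 0 <= set_val (inv z) ord_max i1 by rewrite inv_last oppr_ge0 ltW.
have [s [v [bp E]]] := tor_surj (zT (inv z)) z1 (clamp_itv t).
by exists (clamp t, s, v) => //; right; exact: val_inj.
Qed.

(** Compactness inverts the parametrisation on the upper half of the torus; the involution carries
    the inverse to the lower half. On the common edge both definitions apply and agree because of
    the gluing. *)
Lemma torus_lift : exists F : Torus * R -> mod_space setT' set0',
  [/\ continuous F,
      forall z t p, box p -> z = tor p -> clamp t = p.1.1 -> F (z, t) = mp p &
      forall z t, F (inv z, t) = F (z, t)].
Proof.
pose k (p : raw) := (tor_mx p, p.1.1).
(* Reflecting the lower half up makes [r] continuous everywhere with values in the image of the box.
   In the end [al] is evaluated on the upper half only. *)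
pose r (x : Torus * R) := (fold_mx x.1, clamp x.2).
have hX : hausdorff_space ('M[R]_(m.+1, 2) * R)%type by exact: norm_hausdorff.
have ck : continuous k.
  move=> p; apply: cat_pair; last by cat_auto.
  by apply: (cat_set_val (f := tor)); exact: tor_cat.
have cm : continuous mp by move=> p; exact: mpi_cat.
have surj x : exists2 p, box p & k p = r x.
  case: x => z t; rewrite /k /r /=.
  have [||s [v [bp E]]] := @tor_surj (fold_mx z) (clamp t) _ _ (clamp_itv t).
  - move=> i; have H : set_val z i ord0 ^+ 2 + set_val z i i1 ^+ 2 = 1 by exact: (set_valP z i).
    have E0 : (ord0 == i1) = false by rewrite eq_sym i1E.
    by rewrite !mxE E0 eqxx andbF andbT; case: (i == ord_max); rewrite ?real_normK ?num_real.
  - by rewrite mxE !eqxx /= normr_ge0.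
  - by exists (clamp t, s, v) => //; rewrite E.
have fib p q : box p -> box q -> k p = k q -> mp p = mp q.
  by move=> bp bq [E1 E2]; exact: tor_fibre.
have [al [cal alE]] := compact_lift (@box_compact R m) hX ck cm surj fib.
have alE' z t p : box p -> z = tor p -> clamp t = p.1.1 -> al (z, t) = mp p.
  move=> bp -> tp; apply: alE => //; rewrite /k /r /= tp fold_mx_id //; exact: tor_ge0.
have alc x : cat_at al x.
  apply: cal; apply: cat_pair; last by cat_all.
  apply: cat_matrix => i j; case: (_ && _); last by cat_auto.
  by cat_auto.
(* On the edge, z and its mirror image both lie in the closed upper half, with parameters (s, v) and
   (-s, -v). *)
have edge (z : Torus) (t : R) : set_val z ord_max i1 = 0 -> al (z, t) = al (inv z, t).
  move=> z0; have [[[t' s] v] [bp tE] zp] := torus_cover z t.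
  move: tE bp zp => /= -> bp zp.
  have [t1 s1 v1] := (boxP _ _ _).1 bp.
  have bp' : box (clamp t, - s, - v).
    have N (x : R) : -1 <= x <= 1 -> -1 <= - x <= 1 by lra.
    by apply/boxP; split; [exact: t1|exact: N|move=> i; rewrite mxE; exact: N].
  have E1 : trunc s ^+ 2 = 1.
    have E : set_val (tor (clamp t, s, v)) ord_max i1 = 0.
      by case: zp => <-; rewrite ?inv_last z0 ?oppr0.
    move: E; rewrite torE tor_last /half i1E /= => /eqP; rewrite sqrtr_eq0 => H.
    by have := sqr_trunc s; lra.
  have invE : inv (tor (clamp t, s, v)) = tor (clamp t, - s, - v).
    by case: (tor_inv (clamp t) s v) => // /nesym.
  have glue : mp (clamp t, - s, - v) = mp (clamp t, s, v) by exact: tor_glue.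
  case: zp => zp.
    have A1 := alE' z t _ bp zp erefl.
    have A2 : al (inv z, t) = mp (clamp t, - s, - v) by apply: alE' => //; rewrite zp.
    by rewrite A1 A2.
  have A1 := alE' (inv z) t _ bp zp erefl.
  have A2 : al (z, t) = mp (clamp t, - s, - v).
    by apply: alE' => //; rewrite -invE -zp invK.
  by rewrite A1 A2.
exists (fun x : Torus * R => if - set_val x.1 ord_max i1 <= 0 then al x else al (inv x.1, x.2)); split.
- apply: (cat_paste (a := fun x : Torus * R => - set_val x.1 ord_max i1)).
  + by move=> x; cat_auto.
  + by move=> x _; exact: alc.
  + move=> x _; apply: (cat_comp (alc _)); apply: cat_pair; last by cat_auto.
    by apply: (cat_comp (f := inv)); [exact: inv_cat|cat_auto].
  + by move=> [z t] /= /eqP; rewrite oppr_eq0 => /eqP; exact: edge.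
- move=> z t p bp zp tp /=; rewrite ifT; first exact: alE'.
  by rewrite oppr_le0 zp tor_ge0.
- move=> z t /=; rewrite !inv_last invK opprK oppr_le0.
  case: (ltgtP 0 (set_val z ord_max i1)) => // z0.
  exact/esym/edge/esym.
Qed.

Definition susp_K : pspace :=
  PSpace (\pi_(@reduced_suspension R Kn') (point, to_J 0)).

Lemma trunc_pm (x : R) : 1 <= `|x| -> trunc x = 1 \/ trunc x = -1.
Proof.
by rewrite ler_normr => /orP[x1|x1]; [left; exact: trunc_ge|right; apply: trunc_le; lra].
Qed.

Lemma chi_base x j : 1 <= `|x| -> chi (trunc x) j = (j == ord0)%:R.
Proof.
by rewrite /chi => /trunc_pm[] ->; case: (j == ord0);
  rewrite ?sqrrN expr1n ?subrr ?sqrtr0 ?mulr0 //=; lra.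
Qed.

Lemma tor_base (p : raw) : 1 <= `|p.1.2| -> (forall i, 1 <= `|p.2 ord0 i|) ->
  tor p = SigSub (@torus_pt_in R m.+1) \/ inv (tor p) = SigSub (@torus_pt_in R m.+1).
Proof.
have j0 (j : 'I_2) : (j == 0 :> nat) = (j == ord0) by [].
move=> /trunc_pm s1 v1; case: s1 => s1; [right|left]; apply: val_inj;
  apply/matrixP => i j; case: (unliftP ord_max i) => [k ->|->].
- rewrite [LHS]inv_lift torE tor_lift /= mxE chi_base // j0.
  by case: (j == ord0); rewrite //= oppr0.
- rewrite [LHS]inv_last torE tor_last /= mxE s1 /half expr1n subrr sqrtr0 j0.
  by case: (j == ord0); rewrite ?oppr0 ?opprK.
- by rewrite [LHS]tor_lift /= mxE chi_base.
- rewrite [LHS]tor_last /= mxE s1 /half sqrrN expr1n subrr sqrtr0 opprK j0.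
  by case: (j == ord0).
Qed.

Lemma tor_eq (p q : raw) : trunc p.1.2 = trunc q.1.2 ->
  (forall i j, chi (trunc (p.2 ord0 i)) j = chi (trunc (q.2 ord0 i)) j) -> tor p = tor q.
Proof.
move=> sE vE; apply: val_inj; apply/matrixP => i j; case: (unliftP ord_max i) => [k ->|->].
  by rewrite [LHS]tor_lift [RHS]tor_lift vE.
by rewrite [LHS]tor_last [RHS]tor_last sE.
Qed.

(** The inverse on the torus times the line descends through two quotients in turn, to K_n times the
    line and then to the suspension; the factor R is carried through the first by [gquot_lift2]. *)
Theorem start_phe : @phe R susp_K (@mod_space R m setT' set0').
Proof.
apply: phe_sym.
have [mc mg mt] := @mpi_compat R m setT' set0'.
have [F0 [cF0 F0E F0inv]] := torus_lift.
have [F1 [cF1 F1E]] : exists H : Kn' * R -> mod_space setT' set0',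
    continuous H /\ forall z t, H (\pi_Kn' z, t) = F0 (z, t).
  apply: gquot_lift2 => // x y t E.
  by rewrite -F0inv; congr (F0 (_, _)); exact: val_inj.
have F1cover (x : Kn') t : exists p, [/\ box p, p.1.1 = clamp t, x = \pi_Kn' (tor p) & F1 (x, t) = mp p].
  have [z ->] : exists z, x = \pi_Kn' z by exists (repr x); rewrite reprK.
  have [p [bp tp] zp] := torus_cover z t.
  exists p; split=> //; last first.
    by rewrite F1E; case: zp => [zp|zp]; [|rewrite -F0inv]; rewrite (F0E _ _ p).
  by case: zp => <- //; exact: gquot_rel.
have F1pt t : F1 (point, t) = pspt (mod_space setT' set0').
  (* As s = 1 stands for z_n = -1, this is a parameter of the mirror image of the base point. *)
  pose p : raw := (clamp t, 1, const_mx 1).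
  have pv i : 1 <= `|p.2 ord0 i| by rewrite mxE normr1.
  have ps : 1 <= `|p.1.2| by rewrite normr1.
  have bp : box p.
    have I1 : -1 <= (1 : R) <= 1 by apply/andP; split; lra.
    by apply/boxP; split=> // [|i]; rewrite ?mxE //; exact: clamp_itv.
  rewrite F1E -(mc p); last by apply: Or44; split=> // i; rewrite finset.in_set0.
  rewrite -(F0E (tor p) t) //.
  by case: (tor_base ps pv) => <- //; rewrite F0inv.
have [F2 [cF2 F2E]] : exists F : reduced_suspension Kn' -> mod_space setT' set0',
    continuous F /\ forall a, F (\pi_(@reduced_suspension R Kn') a) = F1 (a.1, set_val a.2).
  apply: gquot_lift.
    by move=> x; apply: (cat_compc cF1); cat_auto.
  suff H p : susp_collapsed p -> F1 (p.1, set_val p.2) = pspt (mod_space setT' set0').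
    by move=> p q [/H -> /H ->].
  case: p => x u; rewrite /susp_collapsed /= => -[u0|[u1|->//]].
    have [p [bp tp _ ->]] := F1cover x (set_val u).
    by apply: mc; apply: Or41; rewrite tp u0 clamp0.
  have [p [bp tp _ ->]] := F1cover x (set_val u).
  by apply: mc; apply: Or42; rewrite tp u1 clamp1.
pose f (p : raw) : susp_K := \pi_(@reduced_suspension R Kn') (\pi_Kn' (tor p), to_J p.1.1).
have K_inv z : \pi_Kn' (inv z) = \pi_Kn' z by apply/esym; exact: gquot_rel.
apply: (@mod_iso _ _ _ _ susp_K f F2) => //.
- move=> p; apply: (cat_comp (f := \pi_(@reduced_suspension R Kn'))); first exact: gquot_pi_cat.
  apply: cat_pair.
    by apply: (cat_comp (f := \pi_Kn')); [exact: gquot_pi_cat|exact: tor_cat].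
  by apply: cat_set_type; change (cat_at (fun q : raw => clamp q.1.1) p); cat_all.
- split.
  + move=> p pc; apply: gquot_rel; split; last by left; rewrite to_JE clamp0.
    case: pc => [t0|t1|[i]|[_ s1 v1]].
    * by left; rewrite to_JE /clamp; minmax; lra.
    * by right; left; rewrite to_JE /clamp; minmax; lra.
    * by rewrite finset.in_set0.
    * right; right => /=.
      have [|E|E] := tor_base s1; first by move=> i; apply: v1; rewrite finset.in_setT.
        by rewrite E.
      by rewrite -K_inv E.
  + move=> t s s' v s1 s1'; rewrite /f /=; congr (\pi_(_) (_, _)).
    rewrite -K_inv; case: (tor_inv t s v) => [->|]; last first.
      by rewrite trunc_le // sqrrN expr1n.
    by congr (\pi_(_) _); apply: tor_eq => //=; rewrite !trunc_ge //; lra.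
  + move=> t s v v' vv; rewrite /f /=; congr (\pi_(_) (\pi_(_) _, _)).
    apply: tor_eq => //= i j; case: (vv i) => [->//|[_ []]]; first by rewrite finset.in_setT.
    by move=> v1 v2; rewrite !chi_base.
- move=> p bp; rewrite /f F2E /= F1E to_JE; apply: F0E => //.
  case: p bp => [[t s] v] /boxP[t1 _ _] /=.
  by rewrite (clamp_id t1) clamp_id.
- move=> y; have [[x u] ->] : exists a, y = \pi_(@reduced_suspension R Kn') a.
    by exists (repr (y : reduced_suspension Kn')); rewrite reprK.
  have [p [bp tp -> _]] := F1cover x (set_val u); exists p => //.
  rewrite /f tp; congr (\pi_(_) (_, _)); rewrite -[RHS]to_J_val; congr to_J.
  by apply: clamp_id; have := set_valP u; rewrite /= in_itv.
Qed.

End Start.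

(** * Cells, cones and maps of spheres *)

Section CubeToDisk.
Context {R : realType}.

(* Maps the cube [-1, 1]^N onto the unit disk, one coordinate at a time: the slice of the disk
   over the last coordinates of a point is a disk of radius [sqrt (\prod (1 - c_l ^ 2))]. *)
Definition kap N (c : 'I_N -> R) (j : 'I_N) : R :=
  c j * Num.sqrt (\prod_(l < N | (j < l)%N) (1 - c l ^+ 2)).

Definition in_cube N (c : 'I_N -> R) : Prop := forall l, -1 <= c l <= 1.

Definition tailf N (c : 'I_N.+1 -> R) : 'I_N -> R := fun j => c (lift ord0 j).

Definition vol N (c : 'I_N -> R) : R := \prod_(l < N) (1 - c l ^+ 2).

Lemma in_cube_tail N (c : 'I_N.+1 -> R) : in_cube c -> in_cube (tailf c).
Proof. by move=> H l; exact: H. Qed.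

Lemma factor_ge0 (x : R) : -1 <= x <= 1 -> 0 <= 1 - x ^+ 2.
Proof.
move=> /andP[x1 x2]; rewrite (_ : 1 - x ^+ 2 = (1 - x) * (1 + x)); last by ring.
by rewrite mulr_ge0; lra.
Qed.

Lemma vol_ge0 N (c : 'I_N -> R) : in_cube c -> 0 <= vol c.
Proof. by move=> H; apply: prodr_ge0 => l _; exact: factor_ge0. Qed.

Lemma vol_recl N (c : 'I_N.+1 -> R) : vol c = (1 - c ord0 ^+ 2) * vol (tailf c).
Proof. by rewrite /vol big_ord_recl. Qed.

Lemma kap0 N (c : 'I_N.+1 -> R) : kap c ord0 = c ord0 * Num.sqrt (vol (tailf c)).
Proof. by rewrite /kap big_mkcond big_ord_recl /= mul1r. Qed.

Lemma kap_tail N (c : 'I_N.+1 -> R) j : kap c (lift ord0 j) = kap (tailf c) j.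
Proof. by rewrite /kap big_mkcond big_ord_recl /= mul1r -big_mkcond. Qed.

(** Each coordinate takes the fraction c_j^2 of the squared radius left by the later ones and leaves
    1 - c_j^2 of it. Hence exactly the boundary of the cube goes to the unit sphere. *)
Lemma kap_norm N (c : 'I_N -> R) : in_cube c -> 1 - \sum_(j < N) kap c j ^+ 2 = vol c.
Proof.
elim: N c => [|N IH] c H; first by rewrite /vol !big_ord0 subr0.
rewrite vol_recl -(IH _ (in_cube_tail H)) big_ord_recl kap0 exprMn sqr_sqrtr; last first.
  exact/vol_ge0/in_cube_tail.
rewrite (eq_bigr (fun j => kap (tailf c) j ^+ 2)) => [|j _]; last by rewrite kap_tail.
by rewrite -(IH _ (in_cube_tail H)); ring.
Qed.

(** If [vol] of the tail vanishes, the slice over the tail is a single point and the first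
    coordinate cannot be recovered. *)
Lemma kap_inj N (c d : 'I_N.+1 -> R) : in_cube c -> in_cube d ->
  vol (tailf c) != 0 -> kap c =1 kap d -> c =1 d.
Proof.
elim: N c d => [|N IH] c d Hc Hd.
  move=> _ E l; have := E ord0; rewrite !kap0 /vol !big_ord0 sqrtr1 !mulr1.
  by rewrite (ord1 l).
move=> Vc E; have Et : kap (tailf c) =1 kap (tailf d).
  by move=> j; rewrite -!kap_tail.
have tE : tailf c =1 tailf d.
  apply: IH => //; try exact: in_cube_tail.
  by move: Vc; rewrite vol_recl mulf_eq0 negb_or => /andP[].
have V : vol (tailf d) = vol (tailf c) by apply: eq_bigr => l _; rewrite tE.
move=> l; case: (unliftP ord0 l) => [k ->|->]; first exact: tE.
have := E ord0; rewrite !kap0 V; apply: mulIf.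
by rewrite sqrtr_eq0 -ltNge lt_def Vc; exact/vol_ge0/in_cube_tail.
Qed.

(** Where the slice degenerates the first coordinate is free, and it is set to 1. The representative
    then lies on the face s = 1, from which the sphere of the cone is parametrised in [mod_cone]. *)
Lemma kap_surj N (v : 'I_N.+1 -> R) : \sum_j v j ^+ 2 <= 1 ->
  exists c, [/\ in_cube c, kap c =1 v & vol (tailf c) = 0 -> c ord0 = 1].
Proof.
have step M (w : 'I_M.+1 -> R) (c' : 'I_M -> R) : \sum_j w j ^+ 2 <= 1 ->
    in_cube c' -> kap c' =1 tailf w ->
    exists c, [/\ in_cube c, kap c =1 w & vol (tailf c) = 0 -> c ord0 = 1].
  move=> w1 Hc' Ec'.
  have V0 := vol_ge0 Hc'.
  have w0 : w ord0 ^+ 2 <= vol c'.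
    rewrite -kap_norm // (eq_bigr (fun j => w (lift ord0 j) ^+ 2)) => [|j _]; last by rewrite Ec'.
    by move: w1; rewrite big_ord_recl; lra.
  pose c0 := if vol c' == 0 then 1 else w ord0 / Num.sqrt (vol c').
  pose c (j : 'I_M.+1) := if unlift ord0 j is Some k then c' k else c0.
  have ct : tailf c = c' by apply/funext => j; rewrite /tailf /c liftK.
  have cc0 : c ord0 = c0 by rewrite /c unlift_none.
  have c0E : c0 * Num.sqrt (vol c') = w ord0.
    rewrite /c0; case: eqP => [V|/eqP V].
      by rewrite V sqrtr0 mulr0; apply/esym/eqP; rewrite -sqrf_eq0 eq_le sqr_ge0 andbT -V.
    by rewrite divfK // sqrtr_eq0 -ltNge lt_def V.
  exists c; split.
  - move=> l; case: (unliftP ord0 l) => [k ->|->].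
      by rewrite (_ : c (lift ord0 k) = c' k) // /c liftK.
    rewrite cc0; apply: sqr_le1; rewrite /c0; case: eqP => [V|/eqP V]; first by rewrite expr1n.
    by rewrite expr_div_n sqr_sqrtr // ler_pdivrMr ?mul1r // lt_def V.
  - move=> l; case: (unliftP ord0 l) => [k ->|->]; first by rewrite kap_tail ct Ec'.
    by rewrite kap0 ct cc0.
  - by rewrite ct cc0 /c0 => ->; rewrite eqxx.
have H : forall M (w : 'I_M -> R), \sum_j w j ^+ 2 <= 1 -> exists2 c, in_cube c & kap c =1 w.
  elim=> [|M IH] w w1; first by exists (fun=> 0); [move=> []|move=> []].
  have [|c' Hc' Ec'] := IH (tailf w).
    by move: w1; rewrite big_ord_recl; have := sqr_ge0 (w ord0); rewrite /tailf; lra.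
  by have [c [Hc Ec _]] := step _ w c' w1 Hc' Ec'; exists c.
move=> v1; have [|c' Hc' Ec'] := H N (tailf v).
  by move: v1; rewrite big_ord_recl; have := sqr_ge0 (v ord0); rewrite /tailf; lra.
exact: step Hc' Ec'.
Qed.

Lemma vol_eq0P N (c : 'I_N -> R) : in_cube c -> vol c = 0 <-> exists l, 1 <= `|c l|.
Proof.
move=> Hc; split.
  move/eqP; rewrite /vol prodf_seq_eq0 => /hasP[l _ /= /eqP H]; exists l.
  by rewrite -[_ <= _]ler_sqr ?nnegrE // expr1n real_normK ?num_real //; lra.
move=> [l]; rewrite -[_ <= _]ler_sqr ?nnegrE // expr1n real_normK ?num_real // => H.
apply/eqP; rewrite /vol (bigD1 l) //= mulf_eq0; apply/orP; left.
by rewrite eq_le factor_ge0 // andbT; lra.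
Qed.

End CubeToDisk.

Section Coordinates.
Context {R : realType} {m : nat} (B : {set 'I_m}).
Notation raw := (raw R m).
Notation j := #|B|.

(** The order matters: s comes first, then the coordinates of [B], and the suspension coordinate,
    rescaled to [-1, 1], is last. Under [kap] the faces s = -1 and s = 1 become the two hemispheres
    of the boundary, and all other faces go to the equator, where the first coordinate vanishes. *)
Definition coords (p : raw) (l : 'I_j.+2) : R :=
  if unlift ord0 l is Some k then
    if unlift ord_max k is Some i then trunc (p.2 ord0 (enum_val i))
    else trunc (2 * p.1.1 - 1)
  else trunc p.1.2.

Lemma coords0 p : coords p ord0 = trunc p.1.2.
Proof. by rewrite /coords unlift_none. Qed.

Lemma coords_last p : coords p (lift ord0 ord_max) = trunc (2 * p.1.1 - 1).
Proof. by rewrite /coords liftK unlift_none. Qed.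

Lemma coords_mid p i : coords p (lift ord0 (lift ord_max i)) = trunc (p.2 ord0 (enum_val i)).
Proof. by rewrite /coords !liftK. Qed.

Lemma coords_cube p : in_cube (coords p).
Proof.
move=> l; rewrite /coords; case: unlift => [k|]; last exact: trunc_itv.
by case: unlift => [i|]; exact: trunc_itv.
Qed.

Lemma trunc_ge1 (x : R) : 1 <= `|x| <-> 1 <= `|trunc x|.
Proof.
split=> H; last by case: (trunc_or x) => [<-|[]].
by case: (trunc_or x) => [->|[]].
Qed.

Lemma coords_tail p : vol (tailf (coords p)) = 0 <->
  [\/ p.1.1 <= 0, 1 <= p.1.1 | exists2 i, i \in B & 1 <= `|p.2 ord0 i|].
Proof.
have H := vol_eq0P (in_cube_tail (coords_cube p)); split.
  move/H => [l]; rewrite /tailf; case: (unliftP ord_max l) => [i ->|->].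
    rewrite coords_mid -trunc_ge1 => vi; apply: Or33.
    by exists (enum_val i) => //; exact: enum_valP.
  rewrite coords_last -trunc_ge1 ler_normr => /orP[t1|t1]; [apply: Or32|apply: Or31]; lra.
move=> K; apply/H; case: K => [t0|t1|[i iB vi]].
- by exists ord_max; rewrite /tailf coords_last -trunc_ge1 ler_normr; apply/orP; right; lra.
- by exists ord_max; rewrite /tailf coords_last -trunc_ge1 ler_normr; apply/orP; left; lra.
- by exists (lift ord_max (enum_rank_in iB i)); rewrite /tailf coords_mid enum_rankK_in // -trunc_ge1.
Qed.

Lemma coords_surj (c : 'I_j.+2 -> R) : in_cube c -> exists2 p, box p & coords p =1 c.
Proof.
move=> Hc.
pose v : 'rV[R]_m := \matrix_(a, i)
  (if [pick k : 'I_j | enum_val k == i] is Some k then c (lift ord0 (lift ord_max k)) else 0).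
exists ((c (lift ord0 ord_max) + 1) / 2, c ord0, v).
  apply/boxP; split=> [|//|i]; first by have := Hc (lift ord0 ord_max); lra.
  by rewrite mxE; case: pickP => [k _|_]; [exact: Hc|lra].
move=> l; case: (unliftP ord0 l) => [k ->|->]; last by rewrite coords0 trunc_id //; exact: Hc.
case: (unliftP ord_max k) => [i ->|->]; last first.
  have E : 2 * ((c (lift ord0 ord_max) + 1) / 2) - 1 = c (lift ord0 ord_max) by lra.
  by rewrite coords_last /= E trunc_id //; exact: Hc.
rewrite coords_mid /= mxE; case: pickP => [k' /eqP/enum_val_inj ->|/(_ i)].
  by rewrite trunc_id //; exact: Hc.
by rewrite eqxx.
Qed.

Lemma coords_fibre p q : box p -> box q -> coords p =1 coords q ->
  mpi finset.set0 B p = mpi finset.set0 B q.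
Proof.
have [mc mg mt] := @mpi_compat R m finset.set0 B.
case: p q => [[t s] v] [[t' s'] v'] /boxP[t1 s1 v1] /boxP[t2 s2 v2] E.
have := E ord0; rewrite !coords0 /= !trunc_id // => <-.
have I (x : R) : 0 <= x <= 1 -> -1 <= 2 * x - 1 <= 1 by lra.
have TI (x y : R) : 2 * x - 1 = 2 * y - 1 -> x = y by lra.
have := E (lift ord0 ord_max); rewrite !coords_last /= !trunc_id ?I // => /TI <-.
apply: mt => i; have [iB|iB] := boolP (i \in B); [left|right].
  have := E (lift ord0 (lift ord_max (enum_rank_in iB i))).
  by rewrite !coords_mid /= !trunc_id // enum_rankK_in.
by split=> //; rewrite finset.in_set0.
Qed.

Lemma cat_coords (X : topologicalType) (f : X -> raw) l x :
  cat_at f x -> cat_at (fun y => coords (f y) l) x.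
Proof.
by move=> cf; rewrite /coords; case: unlift => [k|]; [case: unlift => [i|]|]; cat_all.
Qed.

Lemma cat_kap_coords l (p : raw) : cat_at (fun p => kap (coords p) l) p.
Proof.
apply: cat_mul; first by apply: cat_coords; cat_auto.
apply: cat_sqrt; apply: cat_prod => k; apply: cat_add; first by cat_auto.
by apply/cat_opp/cat_exp; apply: cat_coords; cat_auto.
Qed.

End Coordinates.

Section Norms.
Context {R : realType}.

Definition nn k (v : 'rV[R]_k) : R := Num.sqrt (sqnorm v).

Lemma sqnorm_ge0 k (v : 'rV[R]_k) : 0 <= sqnorm v.
Proof. by apply: sumr_ge0 => i _; exact: sqr_ge0. Qed.

Lemma nn_ge0 k (v : 'rV[R]_k) : 0 <= nn v.
Proof. exact: sqrtr_ge0. Qed.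

Lemma sqnormZ k a (v : 'rV[R]_k) : sqnorm (a *: v) = a ^+ 2 * sqnorm v.
Proof. by rewrite /sqnorm mulr_sumr; apply: eq_bigr => i _; rewrite mxE exprMn. Qed.

Lemma nnZ k a (v : 'rV[R]_k) : 0 <= a -> nn (a *: v) = a * nn v.
Proof. by move=> a0; rewrite /nn sqnormZ sqrtrM ?sqr_ge0 // sqrtr_sqr ger0_norm. Qed.

Lemma sqnorm_eq0 k (v : 'rV[R]_k) : (sqnorm v == 0) = (v == 0).
Proof.
apply/idP/eqP => [/eqP H|->]; last by rewrite /sqnorm big1 // => i _; rewrite mxE expr0n.
apply/rowP => i; rewrite mxE; apply/eqP; rewrite -sqrf_eq0; apply/eqP.
move: H; rewrite /sqnorm => H.
by apply: (psumr_eq0P _ H) => // j _; exact: sqr_ge0.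
Qed.

Lemma nn_eq0 k (v : 'rV[R]_k) : (nn v == 0) = (v == 0).
Proof. by rewrite -sqnorm_eq0 sqrtr_eq0 eq_le sqnorm_ge0 andbT. Qed.

Lemma nn_gt0 k (v : 'rV[R]_k) : (0 < nn v) = (v != 0).
Proof. by rewrite lt_def nn_ge0 andbT nn_eq0. Qed.

Lemma nn1 k (v : 'rV[R]_k) : (sqnorm v == 1) = (nn v == 1).
Proof.
rewrite /nn -(@eqrXn2 _ 2 (Num.sqrt _)) ?sqrtr_ge0 // sqr_sqrtr ?sqnorm_ge0 //.
by rewrite expr1n.
Qed.

Lemma nn_le1 k (v : 'rV[R]_k) : (sqnorm v <= 1) = (nn v <= 1).
Proof. by rewrite -[in RHS]sqrtr1 /nn ler_sqrt. Qed.

Lemma cat_sqnorm (X : topologicalType) k (f : X -> 'rV[R]_k) x :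
  cat_at f x -> cat_at (fun y => sqnorm (f y)) x.
Proof. by move=> cf; apply: cat_sum => i; cat_auto. Qed.

Lemma cat_nn (X : topologicalType) k (f : X -> 'rV[R]_k) x :
  cat_at f x -> cat_at (fun y => nn (f y)) x.
Proof. by move=> cf; apply/cat_sqrt/cat_sqnorm. Qed.

Lemma cat_scale (X : topologicalType) k (a : X -> R) (f : X -> 'rV[R]_k) x :
  cat_at a x -> cat_at f x -> cat_at (fun y => a y *: f y) x.
Proof.
move=> ca cf; apply: cat_mx => i j.
by rewrite (_ : (fun y => _) = fun y => a y * f y i j); [cat_auto|apply/funext => y; rewrite mxE].
Qed.

Lemma cat_near (X Y : topologicalType) (f g : X -> Y) x :
  nbhs x [set y | f y = g y] -> cat_at f x -> cat_at g x.
Proof.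
move=> fg cf U; rewrite -(nbhs_singleton fg) => /cf Uf.
by apply: filterS2 fg Uf => y /= ->.
Qed.

(* The value [e0] at [v = 0] is junk. *)
Definition dir k (v : 'rV[R]_k.+1) : 'rV[R]_k.+1 :=
  if v == 0 then e0 k else (nn v)^-1 *: v.

Lemma dir_norm k (v : 'rV[R]_k.+1) : sqnorm (dir v) = 1.
Proof.
rewrite /dir; case: eqP => [_|/eqP v0]; first by have := @e0_in R k; rewrite inE.
by apply/eqP; rewrite nn1 nnZ ?invr_ge0 ?nn_ge0 // mulVf // nn_eq0.
Qed.

Lemma dirE k (v : 'rV[R]_k.+1) : v != 0 -> dir v = (nn v)^-1 *: v.
Proof. by rewrite /dir => /negbTE ->. Qed.

Lemma unit_neq0 k (v : 'rV[R]_k) : sqnorm v = 1 -> v != 0.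
Proof. by move=> v1; rewrite -sqnorm_eq0 v1 oner_eq0. Qed.

Lemma dir_id k (v : 'rV[R]_k.+1) : sqnorm v = 1 -> dir v = v.
Proof.
move=> v1; rewrite dirE ?unit_neq0 //; move/eqP: v1; rewrite nn1 => /eqP ->.
by rewrite invr1 scale1r.
Qed.

Lemma dirZ k a (v : 'rV[R]_k.+1) : 0 < a -> dir (a *: v) = dir v.
Proof.
move=> a0; rewrite /dir scaler_eq0 gt_eqF //=; case: eqP => // _.
by rewrite nnZ ?ltW // scalerA invfM mulrAC mulVf ?mul1r // gt_eqF.
Qed.

Lemma cat_dir (X : topologicalType) k (f : X -> 'rV[R]_k.+1) x :
  f x != 0 -> cat_at f x -> cat_at (fun y => dir (f y)) x.
Proof.
move=> f0 cf; apply: (@cat_near _ _ (fun y => (nn (f y))^-1 *: f y)).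
  have : nbhs x ((fun y => nn (f y)) @^-1` [set r | 0 < r]).
    by apply: (cat_nn cf); apply: lt_nbhsr; rewrite nn_gt0.
  by apply: filterS => y /=; rewrite nn_gt0 => /dirE.
by apply: cat_scale => //; apply: cat_inv; [rewrite nn_eq0|exact: cat_nn].
Qed.

Definition ret k (v : 'rV[R]_k) : 'rV[R]_k := (Num.max 1 (nn v))^-1 *: v.

Lemma ret_norm k (v : 'rV[R]_k) : sqnorm (ret v) <= 1.
Proof.
have H : 0 < Num.max 1 (nn v) by rewrite lt_max ltr01.
by rewrite nn_le1 nnZ ?invr_ge0 ?(ltW H) // mulrC ler_pdivrMr // mul1r le_max lexx orbT.
Qed.

Lemma ret_id k (v : 'rV[R]_k) : sqnorm v <= 1 -> ret v = v.
Proof. by rewrite nn_le1 /ret => v1; rewrite max_l // invr1 scale1r. Qed.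

Lemma cat_ret k (v : 'rV[R]_k) : cat_at (@ret k) v.
Proof.
apply: cat_scale; last by cat_auto.
apply: cat_inv; first by rewrite gt_eqF // lt_max ltr01.
by apply: cat_max; [cat_auto|apply: cat_nn; cat_auto].
Qed.

End Norms.

(** * Cones and their dependence on the attaching map *)

Section Cones.
Context {R : realType} {m : nat}.
Notation V := 'rV[R]_m.+1.
Implicit Types f g : V -> V.

(* [S^m] with an (m+1)-cell attached along [f]; for [deg2] this is [moore_space]. *)
Definition cone_attach f (p q : @moore_base R m) : Prop :=
  (set_val p).1 = false /\ sqnorm (set_val p).2 = 1 /\
  (set_val q).1 = true /\ (set_val q).2 = f (set_val p).2.

Definition cone f : pspace :=
  PSpace (\pi_(gquot (cone_attach f)) (SigSub (@moore_pt_in R m))).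

Lemma cell_in (v : V) : (false, ret v) \in @moore_base_set R m.
Proof. by rewrite inE; exact: ret_norm. Qed.

Lemma base_in (v : V) : (true, dir v) \in @moore_base_set R m.
Proof. by rewrite inE; exact: dir_norm. Qed.

(** With [ret] and [dir] both inclusions are defined on all vectors, so that points of a cone can be
    given by formulas without proofs of membership. *)
Definition cell f (v : V) : cone f := \pi_(gquot (cone_attach f)) (SigSub (cell_in v)).
Definition base f (v : V) : cone f := \pi_(gquot (cone_attach f)) (SigSub (base_in v)).

Lemma cone_pt f : pspt (cone f) = base f (e0 m).
Proof.
congr (\pi_(_) _); apply: val_inj => /=; congr (_, _); rewrite dir_id //.
by have := @e0_in R m; rewrite inE.
Qed.

Lemma cat_cell f v : cat_at (cell f) v.
Proof.
apply: (cat_comp (f := \pi_(gquot (cone_attach f)))); first exact: gquot_pi_cat.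
apply: cat_set_type; change (cat_at (fun v : V => (false, ret v)) v).
by apply: cat_pair; [cat_auto|exact: cat_ret].
Qed.

Lemma cat_base f v : v != 0 -> cat_at (base f) v.
Proof.
move=> v0; apply: (cat_comp (f := \pi_(gquot (cone_attach f)))); first exact: gquot_pi_cat.
apply: cat_set_type; change (cat_at (fun v : V => (true, dir v)) v).
by apply: cat_pair; [cat_auto|apply: cat_dir => //; cat_auto].
Qed.

Lemma cone_glue f v : sqnorm v = 1 -> sqnorm (f v) = 1 -> cell f v = base f (f v).
Proof.
move=> v1 f1; apply: gquot_rel; rewrite /cone_attach.
change ((false, ret v).1 = false /\ sqnorm (false, ret v).2 = 1 /\ (true, dir (f v)).1 = true /\
  (true, dir (f v)).2 = f (false, ret v).2) => /=.
by rewrite dir_id // ret_id // v1.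
Qed.

Lemma base_dir f v a : 0 < a -> base f (a *: v) = base f v.
Proof. by move=> a0; congr (\pi_(_) _); apply: val_inj => /=; rewrite dirZ. Qed.

Lemma cone_ind f (P : cone f -> Prop) :
  (forall v, sqnorm v <= 1 -> P (cell f v)) -> (forall v, sqnorm v = 1 -> P (base f v)) ->
  forall x, P x.
Proof.
move=> HD HS; apply: gquot_ind => -[[[] v] bv].
  have v1 : sqnorm v = 1 by move: (bv); rewrite inE.
  rewrite (_ : \pi__ _ = base f v); first exact: HS.
  by congr (\pi_(_) _); apply: val_inj => /=; rewrite dir_id.
have v1 : sqnorm v <= 1 by move: (bv); rewrite inE.
rewrite (_ : \pi__ _ = cell f v); first exact: HD.
by congr (\pi_(_) _); apply: val_inj => /=; rewrite ret_id.
Qed.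

Lemma cone_lift2 f (Y : topologicalType) (a b : V -> R -> Y) :
  (forall v r, sqnorm v <= 1 -> cat_at (fun p : V * R => a p.1 p.2) (v, r)) ->
  (forall v r, sqnorm v = 1 -> cat_at (fun p : V * R => b p.1 p.2) (v, r)) ->
  (forall v r, sqnorm v = 1 -> a v r = b (f v) r) ->
  exists H : cone f * R -> Y, [/\ continuous H,
    forall v r, sqnorm v <= 1 -> H (cell f v, r) = a v r &
    forall v r, sqnorm v = 1 -> H (base f v, r) = b v r].
Proof.
move=> ca cb ab.
(* The Boolean tag, read as -1 or 1, lets the pasting lemma handle the disjoint union. *)
pose t (p : @moore_base R m * R) : R := if (set_val p.1).1 then -1 else 1.
pose h (p : @moore_base R m * R) :=
  if t p <= 0 then b (set_val p.1).2 p.2 else a (set_val p.1).2 p.2.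
have N1 : (1 <= 0 :> R) = false by lra.
have N2 : (-1 <= 0 :> R) = true by lra.
have ch : continuous h.
  apply: (cat_paste (a := t)).
  - move=> p; apply: (cat_comp (f := fun c : bool => if c then (-1 : R) else 1)
      (g := fun p : @moore_base R m * R => (set_val p.1).1)); last by cat_auto.
    move=> U HU; apply: (filterS _ (discrete_set1 _)) => _ /= ->.
    exact: nbhs_singleton HU.
  - move=> [p r]; rewrite /t /=; case E: (set_val p).1; rewrite ?N1 // => _.
    apply: (cat_comp (f := fun q : V * R => b q.1 q.2)
      (g := fun x : @moore_base R m * R => ((set_val x.1).2, x.2))); last by cat_auto.
    by apply: cb; have := set_valP p; rewrite /moore_base_set /= E.
  - move=> [p r]; rewrite /t /=; case E: (set_val p).1; first by move=> ?; exfalso; lra.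
    move=> _; apply: (cat_comp (f := fun q : V * R => a q.1 q.2)
      (g := fun x : @moore_base R m * R => ((set_val x.1).2, x.2))); last by cat_auto.
    by apply: ca; have := set_valP p; rewrite /moore_base_set /= E.
  - by move=> [p r]; rewrite /t; case: ifP => _ ?; exfalso; lra.
have [|H [cH HE]] := gquot_lift2 (r := cone_attach f) ch.
  move=> p q r [p1 [p2 [q1 q2]]]; rewrite /h /t /= p1 q1 N1 N2 q2.
  exact: ab.
exists H; split=> // v r v1.
  by rewrite HE /h /t /= N1 ret_id.
by rewrite HE /h /t /= N2 dir_id.
Qed.

Lemma cone_lift f (Y : topologicalType) (a b : V -> Y) :
  (forall v, sqnorm v <= 1 -> cat_at a v) -> (forall v, sqnorm v = 1 -> cat_at b v) ->
  (forall v, sqnorm v = 1 -> a v = b (f v)) ->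
  exists H : cone f -> Y, [/\ continuous H, forall v, sqnorm v <= 1 -> H (cell f v) = a v &
    forall v, sqnorm v = 1 -> H (base f v) = b v].
Proof.
move=> ca cb ab; have [|||H [cH Ha Hb]] := @cone_lift2 f Y (fun v _ => a v) (fun v _ => b v).
- by move=> v r v1; apply: (cat_comp (f := a)); [exact: ca|cat_auto].
- by move=> v r v1; apply: (cat_comp (f := b)); [exact: cb|cat_auto].
- by move=> v _; exact: ab.
exists (fun x => H (x, 0)); split; [|by move=> v; exact: Ha|by move=> v; exact: Hb].
by move=> x; apply: (cat_compc cH); cat_auto.
Qed.

End Cones.

Section ConeInvariance.
Context {R : realType} {m : nat}.
Notation V := 'rV[R]_m.+1.
Implicit Types (f g : V -> V) (h : V -> R -> V).

Definition spherical f : Prop := forall v, sqnorm v = 1 -> sqnorm (f v) = 1.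

(** The values need not be unit vectors, only nonzero: [base] normalises them. *)
Definition sphere_htp f g h : Prop := [/\
  forall v t, sqnorm v = 1 -> 0 <= t <= 1 -> h v t != 0,
  forall v t, sqnorm v = 1 -> 0 <= t <= 1 -> cat_at (fun p : V * R => h p.1 p.2) (v, t),
  forall v, sqnorm v = 1 -> h v 0 = f v & forall v, sqnorm v = 1 -> h v 1 = g v].

Lemma sphere_htp_sym f g h : sphere_htp f g h -> sphere_htp g f (fun v t => h v (1 - t)).
Proof.
have I (t : R) : 0 <= t <= 1 -> 0 <= 1 - t <= 1 by lra.
move=> [h0 ch hf hg]; split.
- by move=> v t v1 t1; apply: h0 => //; exact: I.
- move=> v t v1 t1; apply: (cat_comp (f := fun p : V * R => h p.1 p.2)
    (g := fun p : V * R => (p.1, 1 - p.2))); last by cat_auto.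
  by apply: ch => //; exact: I.
- by move=> v v1; rewrite subr0 hg.
- by move=> v v1; rewrite subrr hf.
Qed.

(** The inner disk of radius 1/2 is stretched onto the cell, and the outer ring follows [h] from [g]
    at radius 1/2 back to [f] at radius 1. *)
Definition cone_map_for f g (h : V -> R -> V) (F : cone f -> cone g) : Prop := [/\ pmap F,
  forall v, nn v <= 2^-1 -> F (cell f v) = cell g (2 *: v),
  forall v, 2^-1 <= nn v <= 1 -> F (cell f v) = base g (h (dir v) (2 - 2 * nn v)) &
  forall v, sqnorm v = 1 -> F (base f v) = base g v].

Lemma nn_neq0 (v : V) : 0 < nn v -> v != 0.
Proof. by rewrite nn_gt0. Qed.

Lemma base_dirE f v : v != 0 -> base f (dir v) = base f v.
Proof. by move=> v0; rewrite dirE // base_dir // invr_gt0 nn_gt0. Qed.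

Lemma cone_map_ex f g h : spherical f -> spherical g -> sphere_htp f g h ->
  exists F : cone f -> cone g, cone_map_for h F.
Proof.
move=> sf sg [h0 ch hf hg].
pose a (v : V) := if nn v - 2^-1 <= 0 then cell g (2 *: v)
                  else base g (h (dir v) (2 - 2 * nn v)).
have edge v : nn v = 2^-1 -> cell g (2 *: v) = base g (h (dir v) (2 - 2 * nn v)).
  move=> v2; have v0 : v != 0 by apply: nn_neq0; lra.
  have -> : 2 - 2 * nn v = 1 by lra.
  have -> : 2 *: v = dir v by rewrite dirE // v2 invrK.
  by rewrite hg ?dir_norm // cone_glue ?dir_norm // sg ?dir_norm.
have ca v : sqnorm v <= 1 -> cat_at a v.
  rewrite nn_le1 => v1.
  have c1 : cat_at (fun v : V => cell g (2 *: v)) v.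
    by apply: (cat_comp (f := cell g)); [exact: cat_cell|apply: cat_scale; cat_auto].
  have cn : cat_at (fun v : V => nn v - 2^-1) v.
    by apply: cat_add; [apply: cat_nn|]; cat_auto.
  have c2 : 0 <= nn v - 2^-1 -> cat_at (fun v : V => base g (h (dir v) (2 - 2 * nn v))) v.
    move=> v2; have t01 : 0 <= 2 - 2 * nn v <= 1 by lra.
    apply: (cat_comp (f := base g)); first by apply/cat_base/h0 => //; exact: dir_norm.
    apply: (cat_comp (f := fun p : V * R => h p.1 p.2) (g := fun v : V => (dir v, 2 - 2 * nn v))).
      by apply: ch => //; exact: dir_norm.
    apply: cat_pair; first by apply: cat_dir; [apply: nn_neq0; lra|cat_auto].
    by apply: cat_add; [cat_auto|apply/cat_opp/cat_mul; [cat_auto|apply: cat_nn; cat_auto]].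
  by apply: (cat_paste_at cn) => // v2; apply: edge; lra.
have [|||F [cF Fa Fb]] := @cone_lift R m f (cone g) a (base g).
- exact: ca.
- by move=> v v1; apply: cat_base; exact: unit_neq0.
- move=> v v1; have n1 : nn v = 1 by apply/eqP; rewrite -nn1 v1.
  rewrite /a n1 ifF; last by lra.
  by rewrite mulr1 subrr dir_id // hf.
exists F; split.
- split=> //; rewrite !cone_pt Fb //; by have := @e0_in R m; rewrite inE.
- by move=> v v2; rewrite Fa /a ?ifT ?nn_le1 //; lra.
- move=> v v2; rewrite Fa /a ?nn_le1; last by lra.
  by case: ifP => // v3; apply: edge; lra.
- exact: Fb.
Qed.

(* The composite runs along [h] and back; [rho] undoes this by shrinking the collar. *)
Lemma cone_map_comp f g h h' (F : cone f -> cone g) (G : cone g -> cone f) : spherical f -> sphere_htp f g h ->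
  (forall v t, sqnorm v = 1 -> h' v t = h v (1 - t)) ->
  cone_map_for h F -> cone_map_for h' G -> @phtp R (cone f) (cone f) (G \o F) id.
Proof.
move=> sf [h0 ch hf hg] hh [pF F1 F2 F3] [pG G1 G2 G3].
(* The radius of the disk stretched onto the cell: 1/4 for the composite, where two halvings have
   taken place, and 1 for the identity. *)
pose rho (r : R) : R := (1 + 3 * clamp r) / 4.
have rhoP (r : R) : 4^-1 <= rho r <= 1 by have := clamp_itv r; rewrite /rho; lra.
(* The time in [h]. At r = 0 it increases along the ring of [G], from radius 1/4 to 1/2, and
   decreases along the ring of [F]; as rho grows, the minimum cuts off the peak. *)
pose q (v : V) (r : R) : R := Num.min (4 * (nn v - rho r)) (2 - 2 * nn v).
have qP (v : V) (r : R) : rho r <= nn v -> nn v <= 1 -> 0 <= q v r <= 1.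
  by move=> v1 v2; have := rhoP r; rewrite /q; minmax; lra.
pose a1 (v : V) (r : R) := cell f ((rho r)^-1 *: v).
pose a2 (v : V) (r : R) := base f (h (dir v) (q v r)).
pose a (v : V) (r : R) := if nn v - rho r <= 0 then a1 v r else a2 v r.
have edge v r : nn v = rho r -> a1 v r = a2 v r.
  move=> vr; have v0 : v != 0 by apply: nn_neq0; have := rhoP r; lra.
  rewrite /a1 /a2 -vr -dirE // cone_glue ?sf ?dir_norm // -hf ?dir_norm //.
  congr (base f (h _ _)); rewrite /q vr subrr mulr0 min_l //.
  by have := rhoP r; lra.
have crho (p : V * R) : cat_at (fun p => rho p.2) p.
  rewrite /rho; apply: cat_mul; last by cat_auto.
  by apply: cat_add; [cat_auto|apply: cat_mul; cat_all].
have cnn (p : V * R) : cat_at (fun p => nn p.1) p by apply: cat_nn; cat_auto.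
have ca v r : sqnorm v <= 1 -> cat_at (fun p : V * R => a p.1 p.2) (v, r).
  rewrite nn_le1 => v1.
  have c1 : cat_at (fun p : V * R => a1 p.1 p.2) (v, r).
    apply: (cat_comp (f := cell f)); first exact: cat_cell.
    apply: cat_scale; last by cat_auto.
    by apply: cat_inv => //; rewrite /= gt_eqF //; have := rhoP r; lra.
  have cn : cat_at (fun p : V * R => nn p.1 - rho p.2) (v, r).
    by apply: cat_add; [exact: cnn|apply: cat_opp; exact: crho].
  have c2 : 0 <= nn v - rho r -> cat_at (fun p : V * R => a2 p.1 p.2) (v, r).
    move=> v2; have vr : rho r <= nn v by lra.
    have t01 := qP v r vr v1.
    apply: (cat_comp (f := base f)); first by apply/cat_base/h0 => //=; exact: dir_norm.
    apply: (cat_comp (f := fun p : V * R => h p.1 p.2) (g := fun p : V * R => (dir p.1, q p.1 p.2))).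
      by apply: ch => //=; exact: dir_norm.
    apply: cat_pair; first by apply: cat_dir; [apply: nn_neq0 => /=; have := rhoP r; lra|cat_auto].
    apply: cat_min; first by apply: cat_mul; [cat_auto|exact: cn].
    by apply: cat_add; [cat_auto|apply/cat_opp/cat_mul; [cat_auto|exact: cnn]].
  by apply: (cat_paste_at cn) => //= v2; apply: edge; lra.
have [|||K [cK Ka Kb]] := @cone_lift2 R m f (cone f) a (fun v _ => base f v).
- exact: ca.
- move=> v r v1; apply: (cat_comp (f := base f)); last by cat_auto.
  by apply: cat_base; exact: unit_neq0.
- move=> v r v1; have n1 : nn v = 1 by apply/eqP; rewrite -nn1 v1.
  have := rhoP r; rewrite /a n1; case: ifP => r1 rp.
    have -> : a1 v r = cell f v by rewrite /a1 (_ : rho r = 1) ?invr1 ?scale1r //; lra.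
    by rewrite cone_glue // sf.
  rewrite /a2 /q n1 (_ : Num.min _ _ = 0) ?dir_id ?hf //.
  by rewrite min_r; lra.
have half4 (v : V) : nn (2 *: v) = 2 * nn v by rewrite nnZ.
exists K; split=> //; split; last split.
- apply: cone_ind => v v1; last by rewrite Kb //= F3 // G3.
  have n1 : nn v <= 1 by rewrite -nn_le1.
  have r0 : rho 0 = 4^-1 by rewrite /rho clamp0; lra.
  rewrite Ka //= /a /a1 /a2 /q r0 invrK.
  have [v2|v2] := leP (nn v) 2^-1; last first.
    have [v0 hv0] : v != 0 /\ h (dir v) (2 - 2 * nn v) != 0.
      by split; [apply: nn_neq0; lra|apply: h0; [exact: dir_norm|lra]].
    rewrite ifF; last by lra.
    rewrite min_r; last by lra.
    rewrite F2; last by lra.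
    by rewrite -[base g _]base_dirE // G3 ?dir_norm // base_dirE.
  rewrite F1 //; have [v4|v4] := leP (nn v) 4^-1.
    rewrite ifT; last by lra.
    by rewrite G1 ?half4; [rewrite scalerA (_ : 2 * 2 = 4 :> R) //; lra|lra].
  rewrite ifF; last by lra.
  rewrite G2 ?half4; last by lra.
  rewrite dirZ // hh ?dir_norm //; congr (base f (h _ _)).
  by rewrite min_l; lra.
- have r1 : rho 1 = 1 by rewrite /rho clamp1; lra.
  apply: cone_ind => v v1; last by rewrite Kb.
  rewrite Ka //= /a /a1 r1 invr1 scale1r ifT //.
  by move: v1; rewrite nn_le1; lra.
- by move=> r; rewrite !cone_pt Kb //; have := @e0_in R m; rewrite inE.
Qed.

Theorem cone_phe f g h : spherical f -> spherical g -> sphere_htp f g h ->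
  @phe R (cone f) (cone g).
Proof.
move=> sf sg fg; have gf := sphere_htp_sym fg.
have [F HF] := cone_map_ex sf sg fg; have [G HG] := cone_map_ex sg sf gf.
exists F, G; split; first by case: HF.
split; first by case: HG.
split; first by apply: cone_map_comp HF HG => // v t _.
by apply: cone_map_comp HG HF => // v t _; rewrite subKr.
Qed.

Definition dot (v w : V) : R := \sum_i v ord0 i * w ord0 i.

Lemma sqnormD (v w : V) : sqnorm (v + w) = sqnorm v + 2 * dot v w + sqnorm w.
Proof.
rewrite /sqnorm /dot mulr_sumr -!big_split /=; apply: eq_bigr => i _; rewrite mxE; ring.
Qed.

Lemma dotZ a b (v w : V) : dot (a *: v) (b *: w) = a * b * dot v w.
Proof. by rewrite /dot mulr_sumr; apply: eq_bigr => i _; rewrite !mxE; ring. Qed.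

(* Two unit vectors with nonnegative scalar product are joined by a segment that avoids 0. *)
Lemma cone_phe_dot f g : spherical f -> spherical g ->
  (forall v, cat_at f v) -> (forall v, cat_at g v) ->
  (forall v, sqnorm v = 1 -> 0 <= dot (f v) (g v)) -> @phe R (cone f) (cone g).
Proof.
move=> sf sg cf cg fg.
apply: (@cone_phe f g (fun v t => (1 - t) *: f v + t *: g v)) => //; split.
- move=> v t v1 t1; rewrite -sqnorm_eq0 sqnormD dotZ !sqnormZ sf ?sg // gt_eqF //.
  have H : 0 <= (1 - t) * t * dot (f v) (g v) by rewrite !mulr_ge0 ?fg //; lra.
  (* Since 2((1 - t)^2 + t^2) = 1 + (1 - 2t)^2, the squared norm is at least 1/2. *)
  have : 0 <= (1 - t - t) ^+ 2 by exact: sqr_ge0.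
  by nra.
- move=> v t _ _; apply: cat_mx => i j.
  rewrite (_ : (fun y => _) = fun p : V * R => (1 - p.2) * f p.1 i j + p.2 * g p.1 i j); last first.
    by apply/funext => p; rewrite !mxE.
  have cfi : cat_at (fun p : V * R => f p.1) (v, t) by apply: (cat_comp (f := f)); [exact: cf|cat_auto].
  have cgi : cat_at (fun p : V * R => g p.1) (v, t) by apply: (cat_comp (f := g)); [exact: cg|cat_auto].
  by apply: cat_add; apply: cat_mul; try (by cat_auto); exact: cat_coord.
- by move=> v _; rewrite subr0 scale1r scale0r addr0.
- by move=> v _; rewrite subrr scale1r scale0r add0r.
Qed.

End ConeInvariance.

(** * Fold maps, and spheres as disks with collapsed boundary *)

Section FoldMaps.
Context {R : realType} {m : nat}.
Notation V := 'rV[R]_m.+1.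

(* Self-maps of [S^m] that collapse the equator [v_0 = 0] to [e0] and wrap either hemisphere
   around the sphere, the upper one through [v_k |-> eps k * v_(s k)]. *)
Definition fold_map (eps : 'I_m.+1 -> R) (s : 'I_m.+1 -> 'I_m.+1) (v : V) : V :=
  \matrix_(i, k) if k == ord0 then 1 - 2 * v ord0 ord0 ^+ 2
    else (`|v ord0 ord0| - v ord0 ord0) * v ord0 k +
         (`|v ord0 ord0| + v ord0 ord0) * (eps k * v ord0 (s k)).

Lemma cat_fold_map eps s v : cat_at (fold_map eps s) v.
Proof. by apply: cat_matrix => i k; case: (k == ord0); cat_auto. Qed.

Lemma sqnormE (v : V) : sqnorm v = v ord0 ord0 ^+ 2 + \sum_(k | k != ord0) v ord0 k ^+ 2.
Proof. by rewrite /sqnorm (bigD1 ord0). Qed.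

Lemma perm_sqnorm (s : 'I_m.+1 -> 'I_m.+1) (v : V) : involutive s -> s ord0 = ord0 ->
  \sum_(k | k != ord0) v ord0 (s k) ^+ 2 = \sum_(k | k != ord0) v ord0 k ^+ 2.
Proof.
move=> sK s0; rewrite [RHS](reindex_inj (inv_inj sK)) /=; apply: eq_bigl => k.
by rewrite -[in RHS]s0 (inj_eq (inv_inj sK)).
Qed.

(** On either hemisphere one of |a| - a and |a| + a vanishes, so the cross terms drop out, and (1 -
    2a^2)^2 + 4a^2(1 - a^2) = 1. *)
Lemma fold_map_spherical eps s : involutive s -> s ord0 = ord0 ->
  (forall k, eps k ^+ 2 = 1) -> spherical (fold_map eps s).
Proof.
move=> sK s0 e1 v v1.
rewrite sqnormE mxE eqxx.
rewrite (eq_bigr (fun k => (`|v ord0 ord0| - v ord0 ord0) ^+ 2 * v ord0 k ^+ 2 +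
    (`|v ord0 ord0| + v ord0 ord0) ^+ 2 * v ord0 (s k) ^+ 2)); last first.
  move=> k /negbTE k0; rewrite mxE k0.
  have n2 : `|v ord0 ord0| ^+ 2 = v ord0 ord0 ^+ 2 by rewrite real_normK ?num_real.
  rewrite sqrrD !exprMn e1 mul1r.
  rewrite (_ : _ *+ 2 = 2 * (`|v ord0 ord0| ^+ 2 - v ord0 ord0 ^+ 2) * (v ord0 k * (eps k * v ord0 (s k)))).
    by rewrite n2 subrr mulr0 mul0r addr0.
  by rewrite -mulr_natl; ring.
rewrite big_split /= -!mulr_sumr (perm_sqnorm _ sK s0).
move: v1; rewrite sqnormE; set q := \sum_(k | _) _ => v1.
have n2 : `|v ord0 ord0| ^+ 2 = v ord0 ord0 ^+ 2 by rewrite real_normK ?num_real.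
have -> : q = 1 - v ord0 ord0 ^+ 2 by rewrite -v1; ring.
move: n2; move: (`|v ord0 ord0|) => a; move: (v ord0 ord0) => b n2.
have -> : (a - b) ^+ 2 = a ^+ 2 + b ^+ 2 - 2 * a * b by ring.
have -> : (a + b) ^+ 2 = a ^+ 2 + b ^+ 2 + 2 * a * b by ring.
by rewrite n2; ring.
Qed.

Lemma fold_map_equator eps s (v : V) : v ord0 ord0 = 0 -> fold_map eps s v = e0 m.
Proof.
move=> v0; apply/rowP => k; rewrite !mxE v0 normr0 subrr addr0 !mul0r addr0.
by case: eqP => //= _; rewrite expr0n mulr0 subr0.
Qed.

End FoldMaps.

Section Balls.
Context {R : realType}.

Definition sph k : pspace := PSpace (point : @sphere R k).

(* The quotient map from the disk to the sphere that collapses the boundary to [e0]. *)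
Definition pinch_disk k (v : 'rV[R]_k.+1) : 'rV[R]_k.+2 :=
  \matrix_(a, l) if unlift ord0 l is Some i then 2 * Num.sqrt (1 - sqnorm v) * v ord0 i
                 else 2 * sqnorm v - 1.

Lemma cat_pinch_disk k (v : 'rV[R]_k.+1) : cat_at (@pinch_disk k) v.
Proof.
have cn : cat_at (fun v : 'rV[R]_k.+1 => sqnorm v) v by apply: cat_sqnorm; cat_auto.
apply: cat_matrix => a l; case: unlift => [i|]; last first.
  by apply: cat_add; [apply: cat_mul|]; cat_auto.
apply: cat_mul; last by cat_auto.
by apply: cat_mul; [cat_auto|apply/cat_sqrt/cat_add; [cat_auto|apply/cat_opp]].
Qed.

Lemma pinch_disk0 k (v : 'rV[R]_k.+1) : pinch_disk v ord0 ord0 = 2 * sqnorm v - 1.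
Proof. by rewrite mxE unlift_none. Qed.

Lemma pinch_disk_lift k (v : 'rV[R]_k.+1) i :
  pinch_disk v ord0 (lift ord0 i) = 2 * Num.sqrt (1 - sqnorm v) * v ord0 i.
Proof. by rewrite mxE liftK. Qed.

Lemma sqnorm_recl k (u : 'rV[R]_k.+1) :
  sqnorm u = u ord0 ord0 ^+ 2 + \sum_i u ord0 (lift ord0 i) ^+ 2.
Proof. by rewrite /sqnorm big_ord_recl. Qed.

Lemma pinch_disk_norm k (v : 'rV[R]_k.+1) : sqnorm v <= 1 -> sqnorm (pinch_disk v) = 1.
Proof.
move=> v1; rewrite sqnorm_recl pinch_disk0.
rewrite (eq_bigr (fun i => 4 * (1 - sqnorm v) * v ord0 i ^+ 2)) => [|i _].
  by rewrite -mulr_sumr -/(sqnorm v); ring.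
by rewrite pinch_disk_lift !exprMn sqr_sqrtr ?subr_ge0 //; ring.
Qed.

Lemma pinch_disk_boundary k (v : 'rV[R]_k.+1) : sqnorm v = 1 -> pinch_disk v = e0 k.+1.
Proof.
move=> v1; apply/rowP => l; rewrite !mxE v1 subrr sqrtr0 mulr0.
by case: (unliftP ord0 l) => [i ->|->]; rewrite ?mul0r ?eqxx //=; lra.
Qed.

Lemma pinch_disk_inj k (v w : 'rV[R]_k.+1) : sqnorm v <= 1 -> sqnorm w <= 1 ->
  pinch_disk v = pinch_disk w -> v = w \/ (sqnorm v = 1 /\ sqnorm w = 1).
Proof.
move=> v1 w1 E; have := congr1 (fun u : 'rV_(_) => u ord0 ord0) E.
rewrite /= !pinch_disk0 => E0; have {}E0 : sqnorm v = sqnorm w by lra.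
have [w1'|w1'] := eqVneq (sqnorm w) 1; [by right; rewrite E0|left].
apply/rowP => i; have := congr1 (fun u : 'rV_(_) => u ord0 (lift ord0 i)) E.
rewrite /= !pinch_disk_lift E0; apply: mulfI.
by rewrite mulf_neq0 ?pnatr_eq0 // sqrtr_eq0 -ltNge subr_gt0 lt_neqAle w1'.
Qed.

Lemma pinch_disk_surj k (u : 'rV[R]_k.+2) : sqnorm u = 1 ->
  exists2 v : 'rV[R]_k.+1, sqnorm v <= 1 & pinch_disk v = u.
Proof.
move=> u1; have := u1; rewrite sqnorm_recl; set a := u ord0 ord0; set q := \sum_i _ => aq.
have q0 : 0 <= q by apply: sumr_ge0 => i _; exact: sqr_ge0.
have /andP[a1 a2] : -1 <= a <= 1 by apply: sqr_le1; lra.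
have [E|a3] := eqVneq a 1.
  have e1 : sqnorm (e0 k : 'rV[R]_k.+1) = 1 by have := @e0_in R k; rewrite inE.
  exists (e0 k); first by rewrite e1.
  rewrite pinch_disk_boundary //; apply/rowP => l; rewrite mxE.
  case: (unliftP ord0 l) => [i ->|->]; last by rewrite eqxx -/a E.
  have qE : q = 0 by move: aq; rewrite E; lra.
  apply/esym/eqP; rewrite -sqrf_eq0; apply/eqP.
  by apply: (psumr_eq0P _ qE) => // j _; exact: sqr_ge0.
(* Solving 2|v|^2 - 1 = a gives b = sqrt(1 - |v|^2), and the other coordinates give v = u / (2b). *)
pose b := Num.sqrt ((1 - a) / 2).
have a4 : 0 < (1 - a) / 2 by rewrite divr_gt0 // subr_gt0 lt_neqAle a3.
have b2 : b ^+ 2 = (1 - a) / 2 by rewrite sqr_sqrtr // ltW.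
have b0 : 0 < b by rewrite sqrtr_gt0.
pose v : 'rV[R]_k.+1 := \matrix_(_, i) ((2 * b)^-1 * u ord0 (lift ord0 i)).
have vn : sqnorm v = (1 + a) / 2.
  rewrite /sqnorm (eq_bigr (fun i => ((2 * b)^-1) ^+ 2 * u ord0 (lift ord0 i) ^+ 2)) => [|i _]; last first.
    by rewrite mxE exprMn.
  rewrite -mulr_sumr -/q (_ : q = (1 - a) * (1 + a)); last by move: aq; lra.
  rewrite exprVn exprMn b2; field.
  by rewrite subr_eq0 eq_sym a3.
exists v; first by rewrite vn; lra.
apply/rowP => l; case: (unliftP ord0 l) => [i ->|->].
  rewrite pinch_disk_lift vn (_ : 1 - _ = (1 - a) / 2); last by lra.
  by rewrite -/b mxE mulrA mulfV ?mul1r // mulf_neq0 ?pnatr_eq0 // gt_eqF.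
by rewrite pinch_disk0 vn -/a; lra.
Qed.

Lemma dir_in k (v : 'rV[R]_k.+1) : dir v \in @sphere_set R k.
Proof. by rewrite inE; exact: dir_norm. Qed.

Definition to_sph k (v : 'rV[R]_k.+1) : sph k := SigSub (dir_in v) : @sphere R k.

Lemma to_sphE k (v : 'rV[R]_k.+1) : sqnorm v = 1 -> set_val (to_sph v : sphere k) = v.
Proof. by move=> v1; rewrite -[RHS]dir_id. Qed.

Lemma sph_norm k (x : sph k) : sqnorm (set_val (x : @sphere R k)) = 1.
Proof. exact: (set_valP (x : sphere k)). Qed.

Lemma to_sphK k (x : sph k) : to_sph (set_val (x : @sphere R k)) = x.
Proof. by apply: val_inj; rewrite /= dir_id //; exact: sph_norm. Qed.

Lemma cat_to_sph k (v : 'rV[R]_k.+1) : v != 0 -> cat_at (@to_sph k) v.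
Proof.
move=> v0; apply: cat_set_type; change (cat_at (fun v : 'rV[R]_k.+1 => dir v) v).
by apply: cat_dir => //; cat_auto.
Qed.

Lemma to_sph_pt k : to_sph (e0 k : 'rV[R]_k.+1) = pspt (sph k).
Proof.
apply: val_inj; rewrite /= dir_id //; by have := @e0_in R k; rewrite inE.
Qed.

End Balls.
Arguments sph : clear implicits.

(** * The models as spheres and as cones *)

Section ModelCells.
Context {R : realType} {m : nat} (B : {set 'I_m}).
Notation raw := (raw R m).
Notation j := #|B|.
Notation V := 'rV[R]_j.+2.
Notation mp := (@mpi R m finset.set0 B).

Definition disk_pt (p : raw) : V := \matrix_(a, l) kap (coords (B := B) p) l.

Lemma disk_ptE p l : disk_pt p ord0 l = kap (coords p) l.
Proof. by rewrite mxE. Qed.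

Lemma cat_disk_pt p : cat_at disk_pt p.
Proof. by apply: cat_matrix => a l; exact: cat_kap_coords. Qed.

Lemma disk_pt_norm p : sqnorm (disk_pt p) = 1 - vol (coords (B := B) p).
Proof.
rewrite -kap_norm; last exact: coords_cube.
by rewrite /sqnorm opprB addrC subrK; apply: eq_bigr => l _; rewrite disk_ptE.
Qed.

Lemma disk_pt_le1 p : sqnorm (disk_pt p) <= 1.
Proof. by rewrite disk_pt_norm; have := vol_ge0 (coords_cube (B := B) p); lra. Qed.

Lemma disk_pt_surj (v : V) : sqnorm v <= 1 -> exists p, [/\ box p, disk_pt p = v &
  vol (tailf (coords (B := B) p)) = 0 -> p.1.2 = 1].
Proof.
move=> v1; have [c [Hc Ec c0]] := kap_surj (v := fun l => v ord0 l) v1.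
have [p bp pE] := coords_surj Hc; have {}pE : coords p = c by apply/funext.
exists p; split=> //; first by apply/rowP => l; rewrite disk_ptE pE Ec.
rewrite pE => /c0; rewrite -pE coords0; case: p bp {pE} => [[t s] v'] /boxP[_ s1 _] /=.
by rewrite trunc_id.
Qed.

Lemma disk_pt_tail p q : disk_pt p = disk_pt q ->
  vol (tailf (coords (B := B) p)) = vol (tailf (coords (B := B) q)).
Proof.
move=> E; rewrite -!kap_norm; try exact/in_cube_tail/coords_cube.
by congr (1 - _); apply: eq_bigr => l _; rewrite -!kap_tail -!disk_ptE E.
Qed.

Lemma mp_tail0 p : vol (tailf (coords (B := B) p)) = 0 -> mp p = pspt (mod_space finset.set0 B).
Proof.
have [mc _ _] := @mpi_compat R m finset.set0 B.
by move/coords_tail => H; apply: mc; case: H => H; [apply: Or41|apply: Or42|apply: Or43].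
Qed.

Lemma disk_pt_fibre p q : box p -> box q -> disk_pt p = disk_pt q -> mp p = mp q.
Proof.
move=> bp bq E; have T := disk_pt_tail E.
have [V0|V0] := eqVneq (vol (tailf (coords (B := B) p))) 0.
  by rewrite !mp_tail0 // -T.
apply: coords_fibre => //; apply: kap_inj => //; try exact: coords_cube.
by move=> l; rewrite -!disk_ptE E.
Qed.

Lemma coords_triv t s (v v' : 'rV[R]_m) : mtriv finset.set0 B v v' ->
  coords (B := B) (t, s, v) = coords (t, s, v').
Proof.
move=> vv; apply/funext => l; rewrite /coords; case: unlift => [k|//]; case: unlift => [i|//] /=.
by case: (vv (enum_val i)) => [->//|[]]; rewrite enum_valP.
Qed.

Lemma disk_pt_triv t s (v v' : 'rV[R]_m) : mtriv finset.set0 B v v' ->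
  disk_pt (t, s, v) = disk_pt (t, s, v').
Proof. by move=> vv; rewrite /disk_pt (coords_triv _ _ vv). Qed.

(** For empty [B] the base point clause of [mcol] collapses the faces s = -1 and s = 1 too, so the
    collapsed set is the whole boundary of the square, which is where [vol] vanishes. *)
Lemma mod_sphere : B = finset.set0 -> @phe R (@mod_space R m finset.set0 B) (sph R j.+2).
Proof.
move=> B0; have [mc mg mt] := @mpi_compat R m finset.set0 B.
have nB i : i \notin B by rewrite B0 finset.in_set0.
have colP (p : raw) : mcol finset.set0 B p <-> vol (coords (B := B) p) = 0.
  rewrite vol_recl coords0; split.
    case=> [t0|t1|[i iB]|[_ s1 _]]; last 2 first.
    - by have := nB i; rewrite iB.
    - have -> : trunc p.1.2 ^+ 2 = 1 by case: (trunc_pm s1) => ->; rewrite ?sqrrN expr1n.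
      by rewrite subrr mul0r.
    - by rewrite (proj2 (coords_tail B p)) ?mulr0 //; apply: Or31.
    - by rewrite (proj2 (coords_tail B p)) ?mulr0 //; apply: Or32.
  move/eqP; rewrite mulf_eq0 => /orP[/eqP s1|/eqP/coords_tail H].
    apply: Or44; split=> // [|i]; last by rewrite finset.in_set0.
    apply/trunc_ge1; rewrite -[_ <= _]ler_sqr ?nnegrE // expr1n real_normK ?num_real //; lra.
  by case: H => H; [apply: Or41|apply: Or42|apply: Or43].
pose k (p : raw) := pinch_disk (disk_pt p).
have k1 p : sqnorm (k p) = 1 by apply/pinch_disk_norm/disk_pt_le1.
have ck p : cat_at k p.
  by apply: (cat_comp (f := @pinch_disk R j.+1)); [exact: cat_pinch_disk|exact: cat_disk_pt].
have surj (x : sph R j.+2) : exists2 p, box p & k p = set_val (x : @sphere R j.+2).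
  have [v v1 vE] := pinch_disk_surj (sph_norm x).
  by have [p [bp pE _]] := disk_pt_surj v1; exists p => //; rewrite /k pE.
have fib p q : box p -> box q -> k p = k q -> mp p = mp q.
  move=> bp bq E; have [E'|[]] := pinch_disk_inj (disk_pt_le1 p) (disk_pt_le1 q) E.
    exact: disk_pt_fibre.
  rewrite !disk_pt_norm => Ep Eq; rewrite !mc //; apply/colP; lra.
have cm : continuous mp by move=> p; exact: mpi_cat.
have hV : hausdorff_space 'rV[R]_j.+3 by exact: norm_hausdorff.
have [F [cF FE]] := compact_lift (@box_compact R m) hV ck cm surj fib.
apply: (@mod_iso _ _ _ _ (sph R j.+2) (fun p => to_sph (k p)) F).
- move=> p; apply: (cat_comp (f := @to_sph R _)) => //.
  by apply/cat_to_sph/unit_neq0.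
- split.
  + move=> p /colP p0; rewrite /k pinch_disk_boundary ?to_sph_pt //.
    by rewrite disk_pt_norm p0 subr0.
  + move=> t s s' v s1 s1'; congr to_sph; rewrite /k.
    have C x w : 1 <= `|x| -> sqnorm (disk_pt (t, x, w)) = 1.
      move=> x1; rewrite disk_pt_norm (proj1 (colP _)) ?subr0 //.
      by apply: Or44; split=> // i; rewrite finset.in_set0.
    by rewrite !pinch_disk_boundary // C // ler_normr; apply/orP; [left|right]; lra.
  + by move=> t s v v' vv; rewrite /k (disk_pt_triv _ _ vv).
- by move=> x; apply: cF; apply: cat_set_val; cat_auto.
- by move=> p bp; apply: FE => //; rewrite to_sphE.
- move=> x; have [p bp pE] := surj x; exists p => //.
  by rewrite pE to_sphK.
Qed.

(** The signs undo the gluing v -> -v between the hemispheres s = -1 and s = 1: -1 on the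
    coordinates of [B], and 1 on the last one, the suspension coordinate. *)
Definition first_fold : V -> V := fold_map (fun k => if k == ord_max then 1 else -1) id.

Lemma first_fold_spherical : spherical first_fold.
Proof.
by apply: fold_map_spherical => // k; case: ifP => _; rewrite ?sqrrN expr1n.
Qed.

Lemma first_fold_neg t s s' (v : 'rV[R]_m) : s <= -1 -> 1 <= s' ->
  first_fold (disk_pt (t, s, v)) = first_fold (disk_pt (t, s', - v)).
Proof.
move=> s1 s2.
(* Under the square roots of [kap] only squares occur, so sign changes pass through it. *)
have sq l : coords (B := B) (t, s', - v) l ^+ 2 = coords (B := B) (t, s, v) l ^+ 2.
  case: (unliftP ord0 l) => [k ->|->]; last first.
    by rewrite !coords0 /= trunc_ge // trunc_le // sqrrN.
  case: (unliftP ord_max k) => [i ->|->]; last by rewrite !coords_last.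
  by rewrite !coords_mid /= mxE truncN sqrrN.
have kE l a : coords (B := B) (t, s', - v) l = a * coords (B := B) (t, s, v) l ->
    disk_pt (t, s', - v) ord0 l = a * disk_pt (t, s, v) ord0 l.
  move=> E; rewrite !disk_ptE /kap E -mulrA; congr (_ * (_ * Num.sqrt _)).
  by apply: eq_bigr => l' _; rewrite sq.
have k0 : disk_pt (t, s', - v) ord0 ord0 = - disk_pt (t, s, v) ord0 ord0.
  rewrite (kE _ (-1)) ?mulN1r // !coords0 /= trunc_ge // trunc_le //.
  by rewrite ?mulN1r opprK.
apply/rowP => l; rewrite [LHS]mxE [RHS]mxE k0 normrN sqrrN.
case: (unliftP ord0 l) => [k ->|-> //]; rewrite [_ == ord0]eq_sym (negbTE (neq_lift _ _)).
case: (unliftP ord_max k) => [i ->|->].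
  have -> : (lift ord0 (lift ord_max i) == ord_max) = false.
    by apply/negbTE; rewrite -val_eqE /= /bump /= add1n eqSS leqNgt ltn_ord /= add0n ltn_eqF.
  rewrite (kE _ (-1)); last by rewrite !coords_mid /= mxE truncN mulN1r.
  by ring.
have -> : lift ord0 ord_max == ord_max :> 'I_j.+2 by rewrite -val_eqE.
rewrite (kE _ 1); last by rewrite !coords_last mul1r.
by ring.
Qed.

Lemma first_fold_surj (u : V) : sqnorm u = 1 ->
  exists w : V, [/\ sqnorm w = 1, 0 <= w ord0 ord0 & first_fold w = u].
Proof.
move=> u1; set a := u ord0 ord0.
have [a1 a2] : -1 <= a /\ a <= 1.
  by apply/andP/sqr_le1; rewrite -u1 sqnormE lerDl; apply: sumr_ge0 => i _; exact: sqr_ge0.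
have [E|a3] := eqVneq a 1.
  pose w : V := delta_mx ord0 ord_max.
  have w0 : w ord0 ord0 = 0 by rewrite mxE.
  exists w; split; rewrite ?w0 //.
    by rewrite /sqnorm (bigD1 ord_max) //= mxE !eqxx expr1n big1 ?addr0 // => i /negbTE i0; rewrite mxE i0 andbF expr0n.
  rewrite /first_fold fold_map_equator //; apply/rowP => l; rewrite mxE.
  case: eqP => [->|/eqP l0]; first by rewrite -/a E.
  move: u1; rewrite sqnormE -/a E expr1n => u1.
  have qE : \sum_(k | k != ord0) u ord0 k ^+ 2 = 0 by lra.
  apply/esym/eqP; rewrite -sqrf_eq0; apply/eqP.
  by apply: (psumr_eq0P _ qE l0) => i _; exact: sqr_ge0.
have a4 : 0 < (1 - a) / 2 by rewrite divr_gt0 // subr_gt0 lt_neqAle a3.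
(* The first coordinate requires 1 - 2b^2 = a; the nonnegative root puts the preimage on the
   hemisphere s = 1. *)
have [b [b0 b2]] : exists b : R, 0 < b /\ b ^+ 2 = (1 - a) / 2.
  by exists (Num.sqrt ((1 - a) / 2)); rewrite sqrtr_gt0 sqr_sqrtr // ltW.
pose eps (k : 'I_j.+2) : R := if k == ord_max then 1 else -1.
have eps2 k : eps k * eps k = 1 by rewrite /eps; case: ifP => _; ring.
pose w : V := \matrix_(_, k) if k == ord0 then b else eps k * u ord0 k / (2 * b).
have w0 : w ord0 ord0 = b by rewrite mxE eqxx.
exists w; split; rewrite ?w0 ?ltW //.
  rewrite sqnormE w0 b2 (eq_bigr (fun k => ((2 * b)^-1) ^+ 2 * u ord0 k ^+ 2)); last first.
    move=> k /negbTE k0; rewrite mxE k0 !exprMn [eps k ^+ 2]expr2 eps2; ring.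
  move: u1; rewrite sqnormE -/a -mulr_sumr; set q := \sum_(_ | _) _ => u1.
  rewrite (_ : q = (1 - a) * (1 + a)); last by lra.
  rewrite exprVn exprMn b2; field.
  by rewrite subr_eq0 eq_sym a3.
apply/rowP => k; rewrite mxE w0 gtr0_norm // subrr mul0r add0r.
case: eqP => [->|/eqP/negbTE k0]; first by rewrite b2 -/a; lra.
have F (e x : R) : e * e = 1 -> (b + b) * (e * (e * x / (2 * b))) = x.
  move=> ee; have -> : (b + b) * (e * (e * x / (2 * b))) = e * e * x.
    by field; rewrite gt_eqF.
  by rewrite ee mul1r.
by rewrite mxE k0; exact: (F (eps k) _ (eps2 k)).
Qed.

(** Compactness gives the inverse in two pieces: [al] on the cell, from the whole box, and [be] on
    the sphere, from the face s = 1, which covers the sphere injectively up to collapsed points. The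
    face s = -1 enters when the pieces are compared along the attaching map. *)
Theorem mod_cone : (0 < j)%N -> @phe R (@mod_space R m finset.set0 B) (cone first_fold).
Proof.
move=> j0; have [mc mg mt] := @mpi_compat R m finset.set0 B.
have sf := first_fold_spherical.
have cff (v : V) : cat_at first_fold v := @cat_fold_map R j.+1 _ id v.
have hV : hausdorff_space V by exact: norm_hausdorff.
have cm : continuous mp by move=> p; exact: mpi_cat.
have cd : continuous disk_pt by move=> p; exact: cat_disk_pt.
have surj1 (v : V) : exists2 p, box p & disk_pt p = ret v.
  by have [p [bp pE _]] := disk_pt_surj (ret_norm v); exists p.
have [al [cal alE]] := compact_lift (@box_compact R m) hV cd cm surj1 disk_pt_fibre.
have {}alE p : box p -> al (disk_pt p) = mp p.
  by move=> bp; apply: alE => //; rewrite ret_id // disk_pt_le1.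
pose up (p : raw) : raw := (p.1.1, 1, p.2).
have bup p : box p -> box (up p).
  case: p => [[t s] v] /boxP[t1 s1 v1]; apply/boxP; split=> //.
  by rewrite lexx andbT; lra.
pose k (p : raw) := first_fold (disk_pt (up p)).
have up1 p : coords (B := B) (up p) ord0 = 1 by rewrite coords0 trunc_ge.
have dup p : disk_pt (up p) ord0 ord0 = Num.sqrt (vol (tailf (coords (B := B) (up p)))).
  by rewrite disk_ptE kap0 up1 mul1r.
have dup1 p : sqnorm (disk_pt (up p)) = 1.
  by rewrite disk_pt_norm vol_recl up1 expr1n subrr mul0r subr0.
have cup p : cat_at up p by rewrite /up; cat_auto.
have ck : continuous k.
  move=> p; rewrite /k; apply: (cat_comp (f := first_fold) (g := fun p => disk_pt (up p))); first exact: cff.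
  by apply: (cat_comp (f := disk_pt)); [exact: cat_disk_pt|exact: cup].
have cmup : continuous (fun p => mp (up p)).
  by move=> p; apply: (cat_comp (f := mp)); [exact: mpi_cat|exact: cup].
have surj2 (v : V) : exists2 p, box p & k p = dir v.
  have [w [w1 w0 wE]] := first_fold_surj (dir_norm v).
  have [|[[t s] x] [bp pE tail0]] := @disk_pt_surj w; first by rewrite w1.
  exists (t, s, x) => //; rewrite /k (_ : up _ = (t, s, x)) ?pE //.
  congr (t, _, x); apply/esym.
  have [V0|V0] := eqVneq (vol (tailf (coords (B := B) (t, s, x)))) 0; first exact: tail0.
  move: w1 w0; rewrite -pE disk_pt_norm vol_recl disk_ptE kap0 coords0 /=.
  move: bp => /boxP[_ s1 _]; rewrite trunc_id // => H.
  have Vp : 0 < vol (tailf (coords (B := B) (t, s, x))).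
    by rewrite lt_def V0; apply/vol_ge0/in_cube_tail/coords_cube.
  rewrite pmulr_lge0 ?sqrtr_gt0 // => s0.
  have /eqP : (1 - s ^+ 2) * vol (tailf (coords (B := B) (t, s, x))) = 0 by lra.
  rewrite mulf_eq0 (negbTE V0) orbF subr_eq0 eq_sym sqrf_eq1 => /orP[/eqP //|/eqP sE].
  by move: s0; rewrite sE (_ : (0 <= -1 :> R) = false) //; lra.
have fib2 p q : box p -> box q -> k p = k q -> mp (up p) = mp (up q).
  move=> bp bq E.
  have nn_abs r : `|disk_pt (up r) ord0 ord0| = disk_pt (up r) ord0 ord0.
    by rewrite ger0_norm // dup sqrtr_ge0.
  have E0 : disk_pt (up p) ord0 ord0 = disk_pt (up q) ord0 ord0.
    have := congr1 (fun u : V => u ord0 ord0) E; rewrite /k [LHS]mxE [RHS]mxE eqxx => E0.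
    apply/eqP; rewrite -(@eqrXn2 _ 2) ?dup ?sqrtr_ge0 // -!dup; apply/eqP.
    by lra.
  have [z|z] := eqVneq (disk_pt (up p) ord0 ord0) 0.
    have tail0 r : disk_pt (up r) ord0 ord0 = 0 -> vol (tailf (coords (B := B) (up r))) = 0.
      rewrite dup => /eqP; rewrite sqrtr_eq0 => H; apply/eqP; rewrite eq_le H.
      exact/vol_ge0/in_cube_tail/coords_cube.
    by rewrite !mp_tail0 //; apply: tail0; rewrite -?E0.
  apply: disk_pt_fibre; [exact: bup|exact: bup|].
  apply/rowP => l; have [->|l0] := eqVneq l ord0; first exact: E0.
  have := congr1 (fun u : V => u ord0 l) E; rewrite /k [LHS]mxE [RHS]mxE (negbTE l0) !nn_abs E0.
  rewrite !subrr !mul0r !add0r.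
  set x := disk_pt (up q) ord0 ord0 in z E0 *; rewrite E0 in z.
  move=> H; have x2 : x + x != 0 by rewrite -mulr2n mulrn_eq0.
  move: (mulfI x2 H); apply: mulfI.
  by case: ifP => _; rewrite ?oppr_eq0 oner_eq0.
have [be [cbe beE]] := compact_lift (@box_compact R m) hV ck cmup surj2 fib2.
have {}beE p : box p -> be (k p) = mp (up p).
  by move=> bp; apply: beE => //; rewrite dir_id // sf.
(* Over a degenerate slice the representative was chosen with s = 1. Any other boundary point has s
   = 1 or s = -1, and in the latter case the gluing carries it to the face s = 1. *)
have glue (v : V) : sqnorm v = 1 -> al v = be (first_fold v).
  move=> v1; have [|[[t s] x] [bp pE tail0]] := @disk_pt_surj v; first by rewrite v1.
  rewrite -pE alE //.
  have s01 : -1 <= s <= 1 by case/boxP: bp.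
  have [V0|V0] := eqVneq (vol (tailf (coords (B := B) (t, s, x)))) 0.
    by move: (tail0 V0) bp => /= -> bp; exact/esym/(beE (t, 1, x)).
  have /eqP : (1 - s ^+ 2) * vol (tailf (coords (B := B) (t, s, x))) = 0.
    have := v1; rewrite -pE disk_pt_norm vol_recl coords0 /= trunc_id // => H; lra.
  rewrite mulf_eq0 (negbTE V0) orbF subr_eq0 eq_sym sqrf_eq1 => /orP[/eqP sE|/eqP sE].
    by move: bp; rewrite sE => bp; exact/esym/(beE (t, 1, x)).
  have E1 : first_fold (disk_pt (t, s, x)) = k (t, s, - x).
    by rewrite /k /up /= sE; apply: first_fold_neg.
  rewrite E1 beE; first by rewrite /up /= sE; exact: mg.
  case/boxP: bp => t1 _ x1; apply/boxP; split=> // i; rewrite mxE; have := x1 i; lra.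
have [|||F [cF Fa Fb]] := @cone_lift R j.+1 first_fold (mod_space finset.set0 B) al be.
- by move=> v _; apply: cal; exact: cat_ret.
- by move=> v v1; apply: cbe; apply: cat_dir; [exact: unit_neq0|cat_auto].
- exact: glue.
have k_surj (v : V) : sqnorm v <= 1 -> exists2 p, box p & disk_pt p = v.
  by move=> /disk_pt_surj[p [bp pE _]]; exists p.
apply: (@mod_iso _ _ _ _ (cone first_fold) (fun p => cell first_fold (disk_pt p)) F) => //.
- by move=> p; apply: (cat_comp (f := cell first_fold)); [exact: cat_cell|exact: cat_disk_pt].
- split.
  + move=> p pc; have /coords_tail V0 : [\/ p.1.1 <= 0, 1 <= p.1.1 |
        exists2 i, i \in B & 1 <= `|p.2 ord0 i|].
      case: pc => [H|H|H|[H]]; [exact: Or31|exact: Or32|exact: Or33|].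
      by move: j0; rewrite card_gt0 => /finset.set0Pn[i iB]; move: (H i); rewrite iB.
    have d1 : sqnorm (disk_pt p) = 1 by rewrite disk_pt_norm vol_recl V0 mulr0 subr0.
    rewrite cone_glue ?sf // /first_fold fold_map_equator ?cone_pt //.
    by rewrite disk_ptE kap0 V0 sqrtr0 mulr0.
  + move=> t s s' v s1 s1'.
    have d1 x w : trunc x ^+ 2 = 1 -> sqnorm (disk_pt (t, x, w)) = 1.
      by move=> x1; rewrite disk_pt_norm vol_recl coords0 /= x1 subrr mul0r subr0.
    have d2 : sqnorm (disk_pt (t, s, v)) = 1 by apply: d1; rewrite trunc_le // sqrrN expr1n.
    have d3 : sqnorm (disk_pt (t, s', - v)) = 1 by apply: d1; rewrite trunc_ge // expr1n.
    rewrite (cone_glue d2) ?sf // (cone_glue d3) ?sf //.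
    by rewrite (first_fold_neg _ _ s1 s1').
  + by move=> t s v v' vv; rewrite (disk_pt_triv _ _ vv).
- by move=> p bp; rewrite Fa ?alE // disk_pt_le1.
- apply: cone_ind => v v1.
    by have [p bp pE] := k_surj _ v1; exists p => //; rewrite pE.
  have [w [w1 _ wE]] := first_fold_surj v1.
  have [|p bp pE] := k_surj w; first by rewrite w1.
  by exists p => //; rewrite pE cone_glue ?sf // wE.
Qed.

End ModelCells.

Section TrivialCone.
Context {R : realType} {m : nat}.
Notation V := 'rV[R]_m.+1.

Lemma e0_norm k : sqnorm (e0 k : 'rV[R]_k.+1) = 1.
Proof. by have := @e0_in R k; rewrite inE. Qed.

Lemma cell_ret f (v : V) : cell f (ret v) = cell f v.
Proof. by congr (\pi_(_) _); apply: val_inj; rewrite /= ret_id // ret_norm. Qed.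

(** The cell closes up to a sphere that meets [S^m] in the base point. Its inclusion [q] is a
    section of [pinch_disk] followed by [cell], continuous by compactness. *)
Lemma cone_const_coprod : @hcoprod R bool (fun b => if b then sph R m.+1 else sph R m)
  (cone (fun _ : V => e0 m)).
Proof.
set f := fun _ : V => e0 m.
have sf : spherical f by move=> v _; exact: e0_norm.
(* A compact cube around the disk; [ret] maps it onto the disk. *)
pose K : set V := [set v | forall i, `[-1, 1]%classic (v ord0 i)].
have cK : compact K.
  by apply: (@rV_compact R _ (fun _ => `[-1, 1]%classic)) => _; exact: segment_compact.
pose k (v : V) := pinch_disk (ret v).
have ck : continuous k.
  move=> v; apply: (cat_comp (f := @pinch_disk R m) (g := @ret R m.+1)); [exact: cat_pinch_disk|exact: cat_ret].
have cc : continuous (cell f) by move=> v; exact: cat_cell.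
have hV : hausdorff_space 'rV[R]_m.+2 by exact: norm_hausdorff.
have surj (x : sph R m.+1) : exists2 v, K v & k v = set_val (x : @sphere R m.+1).
  have [v v1 vE] := pinch_disk_surj (sph_norm x); exists v; last by rewrite /k ret_id.
  move=> i; rewrite /= in_itv /=; apply: sqr_le1; apply: le_trans v1.
  by rewrite /sqnorm (bigD1 i) //= lerDl; apply: sumr_ge0 => l _; exact: sqr_ge0.
have fib v w : K v -> K w -> k v = k w -> cell f v = cell f w.
  move=> _ _ E; rewrite -(cell_ret f v) -(cell_ret f w).
  have [->//|[v1 w1]] := pinch_disk_inj (ret_norm v) (ret_norm w) E.
  by rewrite !cone_glue // e0_norm.
have [q [cq qE]] := compact_lift cK hV ck cc surj fib.
have {}cq : continuous (q : sph R m.+1 -> cone f).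
  by move=> x; apply: cq; apply: cat_set_val; cat_auto.
have pinch_sph (x : sph R m.+1) : exists2 v : V, sqnorm v <= 1 & x = to_sph (pinch_disk v).
  by have [v v1 vE] := pinch_disk_surj (sph_norm x); exists v => //; rewrite vE to_sphK.
have {}qE (v : V) : sqnorm v <= 1 -> q (to_sph (pinch_disk v)) = cell f v.
  move=> v1; apply: qE; last by rewrite to_sphE ?pinch_disk_norm // /k ret_id.
  move=> i; rewrite /= in_itv /=; apply: sqr_le1; apply: le_trans v1.
  by rewrite /sqnorm (bigD1 i) //= lerDl; apply: sumr_ge0 => l _; exact: sqr_ge0.
pose s (x : sph R m) : cone f := base f (set_val (x : @sphere R m)).
have ps : pmap s.
  split; last by rewrite /s -to_sph_pt to_sphE ?e0_norm // cone_pt.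
  move=> x; apply: (cat_comp (f := base f) (g := fun x : sph R m => set_val (x : @sphere R m))).
    by apply: cat_base; apply: unit_neq0; exact: sph_norm.
  by apply: cat_set_val; cat_auto.
have pq : pmap (q : sph R m.+1 -> cone f).
  by split=> //; rewrite -to_sph_pt -(pinch_disk_boundary (e0_norm m)) qE ?e0_norm // cone_glue ?e0_norm // cone_pt.
have cpt (v : V) : sqnorm v <= 1 -> cat_at (fun v : V => to_sph (pinch_disk v)) v.
  move=> v1; apply: (cat_comp (f := @to_sph R _)); last exact: cat_pinch_disk.
  by apply/cat_to_sph/unit_neq0/pinch_disk_norm.
have cts (v : V) : sqnorm v = 1 -> cat_at (@to_sph R m) v.
  by move=> v1; apply/cat_to_sph/unit_neq0.
exists (fun b => if b as b0 return ((if b0 then sph R m.+1 else sph R m) : pspace) -> cone f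
  then q else s); split.
- by case.
- move=> Y F pF; have [cF1 F1] := pF true; have [cF2 F2] := pF false.
  have [|||h [ch ha hb]] := @cone_lift R m f Y (fun v => F true (to_sph (pinch_disk v)))
      (fun v => F false (to_sph v)).
  + by move=> v v1; apply: (cat_comp (f := F true)); [exact: cF1|exact: cpt].
  + by move=> v v1; apply: (cat_comp (f := F false)); [exact: cF2|exact: cts].
  + by move=> v v1; rewrite pinch_disk_boundary // !to_sph_pt F1 F2.
  have ph : pmap h by split=> //; rewrite cone_pt hb ?e0_norm // to_sph_pt F2.
  exists h; split=> // -[].
  + apply: phtp_eq; first exact: pmap_comp.
    by move=> x; have [v v1 ->] := pinch_sph x; rewrite /= qE // ha.
  + apply: phtp_eq; first exact: pmap_comp.
    by move=> x; rewrite /= /s hb ?sph_norm // to_sphK.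
- move=> Y h h' ph ph' hh.
  have [H2 [cH2 [H20 [H21 H2p]]]] := hh true; have [H1 [cH1 [H10 [H11 H1p]]]] := hh false.
  have [|||H [cH Ha Hb]] := @cone_lift2 R m f Y (fun v r => H2 (to_sph (pinch_disk v), r))
      (fun v r => H1 (to_sph v, r)).
  + move=> v r v1; apply: (cat_compc cH2); apply: cat_pair; last by cat_auto.
    by apply: (cat_comp (f := fun v : V => to_sph (pinch_disk v))); [exact: cpt|cat_auto].
  + move=> v r v1; apply: (cat_compc cH1); apply: cat_pair; last by cat_auto.
    by apply: (cat_comp (f := @to_sph R m)); [exact: cts|cat_auto].
  + by move=> v r v1; rewrite pinch_disk_boundary // !to_sph_pt H1p H2p.
  exists H; split=> //; split; last split.
  + apply: cone_ind => v v1; first by rewrite Ha // H20 /= qE.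
    by rewrite Hb // H10 /= /s to_sphE.
  + apply: cone_ind => v v1; first by rewrite Ha // H21 /= qE.
    by rewrite Hb // H11 /= /s to_sphE.
  + by move=> r; rewrite cone_pt Hb ?e0_norm // to_sph_pt H1p.
Qed.

End TrivialCone.

(** * Homotopies of the attaching maps *)

Section Degrees.
Context {R : realType} (n : nat).
Notation V := 'rV[R]_n.+2.
Implicit Types v w : V.

Lemma dot_recl v w : dot v w = v ord0 ord0 * w ord0 ord0 + \sum_(k | k != ord0) v ord0 k * w ord0 k.
Proof. by rewrite /dot (bigD1 ord0). Qed.

Lemma dot_fold_map (e1 e2 : 'I_n.+2 -> R) (s1 s2 : 'I_n.+2 -> 'I_n.+2) v :
  0 <= \sum_(k | k != ord0) e1 k * e2 k * (v ord0 (s1 k) * v ord0 (s2 k)) ->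
  0 <= dot (fold_map e1 s1 v) (fold_map e2 s2 v).
Proof.
move=> H; rewrite dot_recl ![fold_map _ _ _ ord0 ord0]mxE eqxx.
set a := v ord0 ord0.
rewrite (eq_bigr (fun k => (`|a| - a) ^+ 2 * v ord0 k ^+ 2 +
    (`|a| + a) ^+ 2 * (e1 k * e2 k * (v ord0 (s1 k) * v ord0 (s2 k))))); last first.
  move=> k /negbTE k0; rewrite ![fold_map _ _ _ ord0 k]mxE k0 -/a.
  have n2 : (`|a| - a) * (`|a| + a) = 0 by rewrite -subr_sqr real_normK ?num_real // subrr.
  move: n2; set A := _ - a; set C := _ + a => n2.
  transitivity (A ^+ 2 * v ord0 k ^+ 2 + C ^+ 2 * (e1 k * e2 k * (v ord0 (s1 k) * v ord0 (s2 k))) +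
      A * C * (v ord0 k * (e1 k * v ord0 (s1 k)) + v ord0 k * (e2 k * v ord0 (s2 k)))); first by ring.
  by rewrite n2 mul0r addr0.
rewrite big_split /= -!mulr_sumr -expr2 addr_ge0 ?sqr_ge0 //.
rewrite addr_ge0 //; first by rewrite mulr_ge0 ?sqr_ge0 //; apply: sumr_ge0 => k _; exact: sqr_ge0.
by rewrite mulr_ge0 ?sqr_ge0.
Qed.

Lemma sum_involution (s : 'I_n.+2 -> 'I_n.+2) (T : 'I_n.+2 -> R) :
  involutive s -> s ord0 = ord0 -> (forall k, 0 <= T k + T (s k)) ->
  0 <= \sum_(k | k != ord0) T k.
Proof.
move=> sK s0 H.
have E : \sum_(k | k != ord0) T k = \sum_(k | k != ord0) T (s k).
  rewrite (reindex_inj (inv_inj sK)) /=; apply: eq_bigl => k.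
  by rewrite -[in LHS]s0 (inj_eq (inv_inj sK)).
have : 0 <= \sum_(k | k != ord0) T k + \sum_(k | k != ord0) T k.
  by rewrite {2}E -big_split /=; apply: sumr_ge0 => k _; exact: H.
lra.
Qed.

(* Coordinates 1, .., n are paired off from the top, leaving out 1 when n is odd. *)
Definition unpaired (k : 'I_n.+2) : bool :=
  [|| k == 0 :> nat, k == n.+1 :> nat | odd n && (k == 1 :> nat)].

Definition partner_nat (k : 'I_n.+2) : nat :=
  if unpaired k then nat_of_ord k else if odd k == odd n then k.-1 else k.+1.

Lemma partner_lt k : (partner_nat k < n.+2)%N.
Proof.
rewrite /partner_nat /unpaired; have := ltn_ord k.
case: ifP => //; case: ifP => //; lia.
Qed.

Definition partner (k : 'I_n.+2) : 'I_n.+2 := Ordinal (partner_lt k).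

Lemma odd_facts (k : 'I_n.+2) : [/\ k = 1%N :> nat -> odd k, k = 2%N :> nat -> ~~ odd k,
  k = n :> nat -> odd k = odd n, (k < n.+2)%N & (0 < k)%N -> odd k.-1 = ~~ odd k].
Proof.
split; [by move=> ->|by move=> ->|by move=> ->|exact: ltn_ord|].
by case: (nat_of_ord k) => //= i; rewrite negbK.
Qed.

Lemma unpaired_partner k : unpaired (partner k) = unpaired k.
Proof.
have [o1 o2 on lk _] := odd_facts k.
rewrite {1}/unpaired /= /partner_nat; case u: (unpaired k) => //.
move: u; rewrite /unpaired; case: eqP => [E|E]; move: o1 o2 on E lk;
  case: (odd k); case: (odd n) => //= *; lia.
Qed.

Lemma partner_odd k : unpaired k = false ->
  (odd (partner_nat k) == odd n) = ~~ (odd k == odd n) /\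
  partner_nat k = (if odd k == odd n then k.-1 else k.+1).
Proof.
have [_ _ _ _ ok] := odd_facts k.
move=> u; rewrite /partner_nat u; split=> //; move: u; rewrite /unpaired.
case: (posnP k) => [-> //|k0] _; case E: (odd k == odd n); rewrite /= ?ok //;
  by move: E; case: (odd k); case: (odd n).
Qed.

Lemma partnerK : involutive partner.
Proof.
move=> k; apply: val_inj => /=; rewrite {1}/partner_nat unpaired_partner.
case u: (unpaired k); first by rewrite /= /partner_nat u.
have [-> E] := partner_odd u; rewrite /= E.
case: (odd k == odd n) => //=; move: u; rewrite /unpaired.
by case: (nat_of_ord k).
Qed.

Lemma partner0 : partner ord0 = ord0.
Proof. by apply: val_inj. Qed.

Definition sgn0 (k : 'I_n.+2) : R := if k == ord_max then 1 else -1.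

(** Together with [partner] this is the quarter turn of each pair: the two coordinates are exchanged
    and receive opposite signs. *)
Definition sgnJ (k : 'I_n.+2) : R :=
  if unpaired k then sgn0 k else if odd k == odd n then 1 else -1.

Definition sgn1 (k : 'I_n.+2) : R := if unpaired k then sgn0 k else 1.

Lemma sgn_sqr0 k : sgn0 k ^+ 2 = 1.
Proof. by rewrite /sgn0; case: ifP => _; rewrite ?sqrrN expr1n. Qed.

Lemma sgn_sqrJ k : sgnJ k ^+ 2 = 1.
Proof.
by rewrite /sgnJ; case: ifP => _; [exact: sgn_sqr0|case: ifP => _; rewrite ?sqrrN expr1n].
Qed.

Lemma sgn_sqr1 k : sgn1 k ^+ 2 = 1.
Proof. by rewrite /sgn1; case: ifP => _; rewrite ?sgn_sqr0 ?expr1n. Qed.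

Lemma sgnJ_partner k : unpaired k = false -> sgnJ (partner k) = - sgnJ k.
Proof.
move=> u; rewrite /sgnJ unpaired_partner u /=.
have [-> _] := partner_odd u.
by case: (odd k == odd n); rewrite /= ?opprK.
Qed.

Lemma partner_unpaired k : unpaired k -> partner k = k.
Proof. by move=> u; apply: val_inj; rewrite /= /partner_nat u. Qed.

(* On the upper hemisphere the path goes from -1 to 1 through a quarter turn of each pair. *)
Lemma phe_fold_J : @phe R (cone (fold_map sgn0 id : V -> V)) (cone (fold_map sgn1 id : V -> V)).
Proof.
have s0 : spherical (fold_map sgn0 id : V -> V) by apply: fold_map_spherical => //; exact: sgn_sqr0.
have s1 : spherical (fold_map sgn1 id : V -> V) by apply: fold_map_spherical => //; exact: sgn_sqr1.
have sJ : spherical (fold_map sgnJ partner : V -> V).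
  by apply: fold_map_spherical; [exact: partnerK|exact: partner0|exact: sgn_sqrJ].
apply: (@phe_trans _ _ (cone (fold_map sgnJ partner : V -> V))).
  apply: cone_phe_dot; [exact: s0|exact: sJ|exact: cat_fold_map|exact: cat_fold_map|].
  move=> v _; apply: dot_fold_map; apply: (sum_involution partnerK partner0) => k.
  rewrite partnerK; case u: (unpaired k).
    rewrite partner_unpaired // /sgnJ u -expr2 sgn_sqr0 mul1r -expr2 addr_ge0 //; exact: sqr_ge0.
  have -> : sgn0 (partner k) = sgn0 k.
    have H l : unpaired l = false -> sgn0 l = -1.
      by rewrite /unpaired /sgn0 -val_eqE /=; case: (l == n.+1 :> nat) => //; rewrite orbT.
    by rewrite !H ?unpaired_partner.
  (* A plane vector is orthogonal to its quarter turn: the two terms of a pair cancel. *)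
  by rewrite sgnJ_partner // (_ : _ + _ = 0) //; ring.
apply: cone_phe_dot; [exact: sJ|exact: s1|exact: cat_fold_map|exact: cat_fold_map|].
move=> v _; apply: dot_fold_map; apply: (sum_involution partnerK partner0) => k.
rewrite partnerK; case u: (unpaired k).
  rewrite partner_unpaired // /sgnJ /sgn1 u -expr2 sgn_sqr0 mul1r -expr2 addr_ge0 //; exact: sqr_ge0.
have -> : sgn1 (partner k) = sgn1 k by rewrite /sgn1 unpaired_partner u.
by rewrite sgnJ_partner // (_ : _ + _ = 0) //; ring.
Qed.

Lemma const_spherical (w : V) : sqnorm w = 1 -> spherical (fun _ : V => w).
Proof. by move=> w1 v _. Qed.

(** For even n the signs away from index 0 have all become 1, so the two hemispheres are wrapped as
    mirror images. The map [g] folds the sphere onto the half with nonpositive first coordinate,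
    which contracts to -e0; the constant is then moved to e0, for which the cone is known to
    split. *)
Lemma phe_fold_even : ~~ odd n ->
  @phe R (cone (fold_map sgn1 id : V -> V)) (cone (fun _ : V => e0 n.+1)).
Proof.
move=> en.
have s1 : spherical (fold_map sgn1 id : V -> V) by apply: fold_map_spherical => //; exact: sgn_sqr1.
have sgn1E k : k != ord0 -> sgn1 k = 1.
  rewrite /sgn1 /unpaired /sgn0 -val_eqE (negbTE en) /= orbF => /negbTE ->.
  by rewrite -val_eqE /=; case: (k == n.+1 :> nat).
pose g (v : V) : V := \matrix_(i, k) if k == ord0 then - `|v ord0 ord0| else v ord0 k.
have cg v : cat_at g v by apply: cat_matrix => i k; case: (k == ord0); cat_auto.
have sg : spherical g.
  move=> v; rewrite !sqnormE [g v ord0 ord0]mxE eqxx sqrrN real_normK ?num_real // => <-.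
  by congr (_ + _); apply: eq_bigr => k /negbTE k0; rewrite mxE k0.
have e1 : sqnorm (e0 n.+1 : V) = 1 by exact: e0_norm.
have e1' : sqnorm (- e0 n.+1 : V) = 1 by rewrite -scaleN1r sqnormZ sqrrN expr1n mul1r.
(* A unit vector orthogonal to e0, as a halfway point: the segment between the antipodes -e0 and e0
   passes through 0. *)
pose d : V := delta_mx ord0 (lift ord0 ord0).
have d1 : sqnorm d = 1.
  rewrite /sqnorm (bigD1 (lift ord0 ord0)) //= mxE !eqxx expr1n big1 ?addr0 // => i /negbTE i0.
  by rewrite mxE i0 andbF expr0n.
have e0E k : (e0 n.+1 : V) ord0 k = (k == ord0)%:R by rewrite mxE.
have dot_e0 (w : V) : dot w (e0 n.+1) = w ord0 ord0.
  rewrite dot_recl e0E eqxx mulr1 big1 ?addr0 // => k /negbTE k0.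
  by rewrite e0E k0 mulr0.
have dotN (x y : V) : dot x (- y) = - dot x y.
  by rewrite /dot -sumrN; apply: eq_bigr => i _; rewrite mxE mulrN.
have ccst (w : V) : forall v : V, cat_at (fun _ : V => w) v by move=> v; exact: cat_cst.
apply: (@phe_trans _ _ (cone g)).
  apply: cone_phe_dot; [exact: s1|exact: sg|exact: cat_fold_map|exact: cg|].
  move=> v v1; rewrite dot_recl [fold_map _ _ _ ord0 ord0]mxE [g _ _ _]mxE !eqxx.
  set a := v ord0 ord0.
  rewrite (eq_bigr (fun k => 2 * `|a| * v ord0 k ^+ 2)); last first.
    move=> k k0; rewrite [fold_map _ _ _ ord0 k]mxE [g _ _ _]mxE (negbTE k0) sgn1E // -/a; ring.
  move: v1; rewrite sqnormE -/a -mulr_sumr; set q := \sum_(_ | _) _ => v1.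
  have -> : q = 1 - `|a| ^+ 2 by rewrite real_normK ?num_real // -v1; ring.
  have -> : a ^+ 2 = `|a| ^+ 2 by rewrite real_normK ?num_real.
  (* The scalar product is -|a|(1 - 2a^2) + 2|a|(1 - a^2) = |a|. *)
  rewrite (_ : _ + _ = `|a|) ?normr_ge0 //; ring.
apply: (@phe_trans _ _ (cone (fun _ : V => - e0 n.+1))).
  apply: cone_phe_dot; [exact: sg|exact: const_spherical|exact: cg|exact: ccst|move=> v _].
  by rewrite dotN dot_e0 mxE eqxx opprK normr_ge0.
apply: (@phe_trans _ _ (cone (fun _ : V => d))).
  apply: cone_phe_dot; [exact: const_spherical|exact: const_spherical|exact: ccst|exact: ccst|move=> v _].
  rewrite /dot big1 // => i _; rewrite !mxE eqxx /=.
  by case: (i =P ord0) => [->|_]; rewrite ?(negbTE (neq_lift _ _)) ?mulr0 // oppr0 mul0r.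
apply: cone_phe_dot; [exact: const_spherical|exact: const_spherical|exact: ccst|exact: ccst|move=> v _].
by rewrite dot_e0 mxE.
Qed.

End Degrees.

Section OddDegree.
Context {R : realType} (n : nat).
Notation V := 'rV[R]_n.+2.
Implicit Types v w : V.
Let i1 : 'I_n.+2 := lift ord0 ord0.

Lemma inord1E : inord 1 = i1 :> 'I_n.+2.
Proof. by apply: val_inj; rewrite /= inordK. Qed.

Definition radius (v : V) : R := Num.sqrt (v ord0 ord0 ^+ 2 + v ord0 i1 ^+ 2).
Definition sqre (v : V) : R := (v ord0 ord0 ^+ 2 - v ord0 i1 ^+ 2) / radius v.
Definition sqim (v : V) : R := 2 * v ord0 ord0 * v ord0 i1 / radius v.

Lemma radius_sqr v : radius v ^+ 2 = v ord0 ord0 ^+ 2 + v ord0 i1 ^+ 2.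
Proof. by rewrite sqr_sqrtr // addr_ge0 ?sqr_ge0. Qed.

Lemma radius_ge0 v : 0 <= radius v.
Proof. exact: sqrtr_ge0. Qed.

Lemma sqre_sqim v : sqre v ^+ 2 + sqim v ^+ 2 = radius v ^+ 2.
Proof.
have [r0|r0] := eqVneq (radius v) 0.
  by rewrite /sqre /sqim r0 invr0 !mulr0 expr0n addr0.
rewrite /sqre /sqim !exprMn exprVn; apply: (mulIf (x := radius v ^+ 2)).
  by rewrite expf_neq0.
rewrite mulrDl !divfK ?expf_neq0 // radius_sqr; ring.
Qed.

Lemma cat_squeeze (X : topologicalType) (f g : X -> R) x :
  (forall y, `|f y| <= g y) -> g x = 0 -> cat_at g x -> cat_at f x.
Proof.
move=> fg gx cg U; have -> : f x = 0.
  by apply/eqP; rewrite -normr_eq0 eq_le normr_ge0 andbT -gx.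
rewrite -nbhs_ballE => -[e e0 eU].
have : nbhs x (g @^-1` [set r | r < e]) by apply: cg; apply: lt_nbhsl; rewrite gx.
apply: filterS => y /= gy; apply: eU; rewrite /ball /= sub0r normrN.
exact: le_lt_trans (fg y) gy.
Qed.

Lemma cat_radius v : cat_at radius v.
Proof. by rewrite /radius; cat_auto. Qed.

(** Where the radius vanishes, the quotient is 0 by the convention for division by 0, and the bound
    by the radius makes it continuous there. *)
Lemma cat_over_radius (f : V -> R) v : (forall w, cat_at f w) ->
  (forall w, `|f w / radius w| <= radius w) -> cat_at (fun w => f w / radius w) v.
Proof.
move=> cf fr; have [r0|r0] := eqVneq (radius v) 0.
  by apply: cat_squeeze r0 _; [exact: fr|exact: cat_radius].
by apply: cat_mul; [exact: cf|apply: cat_inv; [exact: r0|exact: cat_radius]].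
Qed.

Lemma cat_sqre v : cat_at sqre v.
Proof.
apply: (cat_over_radius (f := fun v : V => v ord0 ord0 ^+ 2 - v ord0 i1 ^+ 2)) => w.
  by cat_auto.
rewrite -[_ <= _]ler_sqr ?nnegrE ?radius_ge0 // real_normK ?num_real //.
by rewrite -sqre_sqim lerDl sqr_ge0.
Qed.

Lemma cat_sqim v : cat_at sqim v.
Proof.
apply: (cat_over_radius (f := fun v : V => 2 * v ord0 ord0 * v ord0 i1)) => w.
  by cat_auto.
rewrite -[_ <= _]ler_sqr ?nnegrE ?radius_ge0 // real_normK ?num_real //.
by rewrite -sqre_sqim lerDr sqr_ge0.
Qed.

(* [deg2] followed by the rotation of matrix [(c, -s; s, c)] of the first two coordinates. *)
Definition rot_deg2 (c s : R) (v : V) : V :=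
  \matrix_(a, k) if k == ord0 then c * sqre v - s * sqim v
                 else if k == i1 then s * sqre v + c * sqim v else v ord0 k.

Lemma rot_deg2E : rot_deg2 1 0 = @deg2 R n.+1.
Proof.
apply/funext => v; apply/rowP => k; rewrite !mxE inord1E -/i1.
have -> : (k == 0 :> nat) = (k == ord0) by rewrite -val_eqE.
have -> : (k == 1 :> nat) = (k == i1) by rewrite -val_eqE.
by rewrite !mul1r !mul0r subr0 add0r.
Qed.

Lemma cat_rot_deg2 c s v : cat_at (rot_deg2 c s) v.
Proof.
have c1 := @cat_sqre v; have c2 := @cat_sqim v.
apply: cat_matrix => a k; case: (k == ord0); last case: (k == i1); last by cat_auto.
  by apply: cat_add; [|apply: cat_opp]; apply: cat_mul; [exact: cat_cst|exact: c1|exact: cat_cst|exact: c2].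
by apply: cat_add; apply: cat_mul; [exact: cat_cst|exact: c1|exact: cat_cst|exact: c2].
Qed.

Lemma dot_split v w : dot v w = v ord0 ord0 * w ord0 ord0 + v ord0 i1 * w ord0 i1 +
  \sum_(k | (k != ord0) && (k != i1)) v ord0 k * w ord0 k.
Proof. by rewrite /dot (bigD1 ord0) //= (bigD1 i1) //= addrA. Qed.

Lemma dot_vv v : dot v v = sqnorm v.
Proof. by apply: eq_bigr => i _; rewrite expr2. Qed.

Lemma rot0 c s v : rot_deg2 c s v ord0 ord0 = c * sqre v - s * sqim v.
Proof. by rewrite mxE. Qed.

Lemma rot1 c s v : rot_deg2 c s v ord0 i1 = s * sqre v + c * sqim v.
Proof. by rewrite mxE eqxx. Qed.

Lemma rot_rest c s v k : (k != ord0) && (k != i1) -> rot_deg2 c s v ord0 k = v ord0 k.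
Proof. by move=> /andP[/negbTE k0 /negbTE k1]; rewrite mxE k0 k1. Qed.

Lemma dot_rot c s c' s' v : dot (rot_deg2 c s v) (rot_deg2 c' s' v) =
  (c * c' + s * s') * radius v ^+ 2 + \sum_(k | (k != ord0) && (k != i1)) v ord0 k ^+ 2.
Proof.
rewrite dot_split !rot0 !rot1 -sqre_sqim; congr (_ + _); first by ring.
by apply: eq_bigr => k kk; rewrite !rot_rest // expr2.
Qed.

Lemma rest_ge0 v : 0 <= \sum_(k | (k != ord0) && (k != i1)) v ord0 k ^+ 2.
Proof. by apply: sumr_ge0 => k _; exact: sqr_ge0. Qed.

Lemma sqnorm_split v : sqnorm v = radius v ^+ 2 + \sum_(k | (k != ord0) && (k != i1)) v ord0 k ^+ 2.
Proof.
by rewrite -dot_vv dot_split radius_sqr !expr2.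
Qed.

Lemma rot_spherical c s : c ^+ 2 + s ^+ 2 = 1 -> spherical (rot_deg2 c s).
Proof. by move=> cs v <-; rewrite -[LHS]dot_vv dot_rot -!expr2 cs mul1r -sqnorm_split. Qed.

Lemma phe_rot c s c' s' : c ^+ 2 + s ^+ 2 = 1 -> c' ^+ 2 + s' ^+ 2 = 1 ->
  0 <= c * c' + s * s' -> @phe R (cone (rot_deg2 c s)) (cone (rot_deg2 c' s')).
Proof.
move=> h h' hh; apply: cone_phe_dot; [exact: rot_spherical|exact: rot_spherical|
  exact: cat_rot_deg2|exact: cat_rot_deg2|].
by move=> v _; rewrite dot_rot addr_ge0 ?rest_ge0 // mulr_ge0 ?sqr_ge0.
Qed.

(** For odd n the coordinate 1 alone, apart from index 0, keeps the sign -1. On unit vectors z = (a,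
    b) of the plane of coordinates 0 and 1 the fold map is then (1 - 2a^2, -2ab), that is -z^2, the
    degree 2 map followed by a half turn. *)
Lemma phe_fold_rot : odd n ->
  @phe R (cone (fold_map (@sgn1 R n) id : V -> V)) (cone (rot_deg2 (-1) 0)).
Proof.
move=> on; apply: cone_phe_dot; [|by apply: rot_spherical; ring|exact: cat_fold_map|exact: cat_rot_deg2|].
  by apply: fold_map_spherical => //; exact: sgn_sqr1.
move=> v v1.
have n0 : (0 < n)%N by case: (n) on.
have s1 : @sgn1 R n i1 = -1.
  rewrite /sgn1 /unpaired /sgn0 on /= -val_eqE /=.
  by rewrite eqSS eq_sym gtn_eqF.
have sk k : (k != ord0) && (k != i1) -> @sgn1 R n k = 1.
  rewrite /sgn1 /unpaired /sgn0 on /= -!val_eqE /= => /andP[/negbTE -> /negbTE ->].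
  by rewrite orbF; case: (k == n.+1 :> nat).
rewrite dot_split rot0 rot1 mul0r subr0 mul0r add0r.
rewrite [fold_map _ _ _ ord0 ord0]mxE eqxx [fold_map _ _ _ ord0 i1]mxE /= s1.
set a := v ord0 ord0; set b := v ord0 i1.
rewrite (eq_bigr (fun k => 2 * `|a| * v ord0 k ^+ 2)); last first.
  move=> k kk; rewrite rot_rest // [fold_map _ _ _ ord0 k]mxE sk //.
  by case/andP: kk => /negbTE -> _; rewrite -/a; ring.
move: v1; rewrite sqnorm_split -mulr_sumr; have := rest_ge0 v; set q := \sum_(_ | _) _ => q0 v1.
rewrite /sqre /sqim -/a -/b.
have r2 := radius_sqr v; rewrite -/a -/b in r2.
have := radius_ge0 v; move: v1 r2; set r := radius v => v1 r2 r0.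
have [rz|rz] := eqVneq r 0.
  by rewrite rz invr0 !mulr0 !add0r mulr_ge0 // mulr_ge0.
have rp : 0 < r by rewrite lt_def rz.
have ar : `|a| <= r.
  by rewrite -[_ <= _]ler_sqr ?nnegrE // r2 real_normK ?num_real // lerDl sqr_ge0.
have a2 : `|a| ^+ 2 = a ^+ 2 by rewrite real_normK ?num_real.
(* Multiplying by r clears the denominators. With q = 1 - r^2 and b^2 = r^2 - a^2 the result is r^2
   + 2|a|q(r - |a|), where |a| <= r. *)
rewrite -(pmulr_rge0 _ rp).
have -> : r * ((1 - 2 * a ^+ 2) * (-1 * ((a ^+ 2 - b ^+ 2) / r)) +
    ((`|a| - a) * b + (`|a| + a) * (-1 * b)) * (-1 * (2 * a * b / r)) + 2 * `|a| * q) =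
    (1 - 2 * a ^+ 2) * (b ^+ 2 - a ^+ 2) + 4 * a ^+ 2 * b ^+ 2 + 2 * `|a| * q * r.
  by field.
have qE : q = 1 - r ^+ 2 by rewrite -v1; ring.
have bE : b ^+ 2 = r ^+ 2 - a ^+ 2 by rewrite r2; ring.
have -> : (1 - 2 * a ^+ 2) * (b ^+ 2 - a ^+ 2) + 4 * a ^+ 2 * b ^+ 2 + 2 * `|a| * q * r =
    r ^+ 2 + 2 * `|a| * q * (r - `|a|).
  rewrite (_ : 2 * `|a| * q * (r - `|a|) = 2 * `|a| * q * r - 2 * `|a| ^+ 2 * q); last by ring.
  by rewrite a2 bE qE; ring.
by rewrite addr_ge0 ?sqr_ge0 // mulr_ge0 ?subr_ge0 // mulr_ge0 // mulr_ge0.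
Qed.

Lemma phe_fold_odd : odd n ->
  @phe R (cone (fold_map (@sgn1 R n) id : V -> V)) (cone (@deg2 R n.+1)).
Proof.
move=> on; apply: (phe_trans (phe_fold_rot on)).
(* The half turn is undone in two quarter turns, each with nonnegative cosine. *)
apply: (@phe_trans _ _ (cone (rot_deg2 0 (-1)))); first by apply: phe_rot; lra.
by rewrite -rot_deg2E; apply: phe_rot; lra.
Qed.

End OddDegree.

(** * Assembling the wedge *)

Section Wedges.
Context {R : realType} {I : choiceType} (X : I -> ptopologicalType) (i0 : I).
Notation W := (wedge (fun i => @point (X i))).

Definition wedge_space : pspace := PSpace (wedge_lift (fun i => @point (X i)) (point : X i0) : W).

(** Homotopies on the summands are glued as maps into the function space of the line, to which
    [wedge_fun] applies; [cat_uncurry] turns the result into a homotopy on the wedge. The index [i0]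
    names the base point. *)
Lemma wedge_coprod : @hcoprod R I (fun i => PSpace (point : X i)) wedge_space.
Proof.
have lift_pt i : wedge_lift (fun i => @point (X i)) (point : X i) = pspt wedge_space.
  exact: (@wedge_liftE _ X (fun i => @point (X i)) i0 point i point).
exists (fun i => @wedge_lift I X (fun i => @point (X i)) i); split.
- by move=> i; split; [exact: wedge_lift_continuous|exact: lift_pt].
- move=> Y f pf.
  have fE i j : f i point = f j point by rewrite (pf i).2 (pf j).2.
  have ch : continuous (wedge_fun f : W -> Y).
    by apply: wedge_fun_continuous => // i; exact: (pf i).1.
  have hE i (x : X i) : wedge_fun f (wedge_lift (fun i => @point (X i)) x) = f i x.
    exact: wedge_lift_funE.
  exists (wedge_fun f); split; first by split=> //; rewrite hE (pf i0).2.
  move=> i; apply: phtp_eq; last by move=> x; rewrite /= hE.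
  apply: (pmap_comp (Y := wedge_space)).
    by split; [exact: wedge_lift_continuous|exact: lift_pt].
  by split=> //; rewrite hE (pf i0).2.
- move=> Y h h' ph ph' /choice_dep[H HP].
  pose g i (x : X i) : {compact-open, R -> Y} := fun r => H i (x, r).
  have cH i : continuous (H i) by case: (HP i).
  have cg i : continuous (g i) by exact: (cat_curry (cH i)).
  have gE i j : g i point = g j point.
    apply/funext => r; rewrite /g; case: (HP i) => _ [_ [_ Hi]]; case: (HP j) => _ [_ [_ Hj]].
    by rewrite (Hi r) (Hj r).
  have cW : continuous (wedge_fun g : W -> {compact-open, R -> Y}).
    exact: wedge_fun_continuous.
  have WE i (x : X i) : wedge_fun g (wedge_lift (fun i => @point (X i)) x) = g i x.
    exact: wedge_lift_funE.
  have surj (x : W) : exists i y, x = wedge_lift (fun i => @point (X i)) (y : X i).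
    have : [set: W] x by [].
    by rewrite -wedgeTE => -[i _ [y _ <-]]; exists i, y.
  exists (fun p => wedge_fun g p.1 p.2); split; last split; last split.
  + apply: (cat_uncurry (h := wedge_fun g : W -> R -> Y)); first exact: cW.
    move=> x; have [i [y ->]] := surj x; rewrite WE => r.
    by apply: (cat_compc (cH i)); cat_auto.
  + move=> x; have [i [y ->]] := surj x; rewrite /= WE /g.
    by case: (HP i) => _ [H0 _]; exact: H0.
  + move=> x; have [i [y ->]] := surj x; rewrite /= WE /g.
    by case: (HP i) => _ [_ [H1 _]]; exact: H1.
  + by move=> r; rewrite /= WE /g; case: (HP i0) => _ [_ [_ Hp]]; rewrite (Hp r).
Qed.

End Wedges.

Section Pieces.
Context {R : realType}.

Definition piece (i : nat) (t : bool) : pspace :=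
  if i == 0%N then sph R 2
  else if odd i then PSpace (point : @moore_space R i.+1)
  else if t then sph R i.+2 else sph R i.+1.

Definition tag_ok (i : nat) (t : bool) : bool := t ==> (~~ odd i && (0 < i)%N).

Lemma rhs_pieceE n (c : rhs_index n) :
  PSpace (point : @rhs_piece R n c) = piece (val c).1.1 (val c).2.
Proof.
case: c => -[[i k] t] H; rewrite /piece /rhs_piece /=.
by case: (i == 0%N) => //; case: (odd i) => //; case: t H.
Qed.

Lemma mod_piece m (B : {set 'I_m}) :
  @hcoprod R {t : bool | tag_ok #|B| t} (fun t => piece #|B| (val t)) (@mod_space R m finset.set0 B).
Proof.
have single : tag_ok #|B| true = false -> @phe R (@mod_space R m finset.set0 B) (piece #|B| false) ->
    @hcoprod R {t : bool | tag_ok #|B| t} (fun t => piece #|B| (val t)) (@mod_space R m finset.set0 B).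
  move=> tF HB; have ok0 : tag_ok #|B| false by [].
  have all0 (t : {t : bool | tag_ok #|B| t}) : t = exist (fun t => tag_ok #|B| t) false ok0.
    by apply: val_inj; case: t => -[] H //; exfalso; move: H; rewrite tF.
  apply: (hcoprod_reindex (g := fun=> tt) (g' := fun=> exist (fun t => tag_ok #|B| t) false ok0)
    _ _ _ (@hcoprod1 R (@mod_space R m finset.set0 B))) => [t|[]//|t].
    exact/esym/all0.
  by rewrite (all0 t); exact: phe_sym.
have [B0|B0] := eqVneq #|B| 0%N.
  apply: single; first by rewrite /tag_ok B0.
  have BE : B = finset.set0 by apply/eqP; rewrite -finset.cards_eq0 B0.
  by have := @mod_sphere R m B BE; rewrite /piece B0.
have Bp : (0 < #|B|)%N by rewrite lt0n.
have HC := phe_trans (@mod_cone R m B Bp) (@phe_fold_J R #|B|).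
have [oB|eB] := boolP (odd #|B|).
  apply: single; first by rewrite /tag_ok oB.
  rewrite /piece (negbTE B0) oB.
  exact: (phe_trans HC (@phe_fold_odd R _ oB)).
have HE := phe_trans HC (@phe_fold_even R _ eB).
have ok t : tag_ok #|B| t by rewrite /tag_ok eB Bp implybT.
apply: (hcoprod_pher _ (phe_sym HE)).
apply: (hcoprod_reindex (g := fun t : {t : bool | tag_ok #|B| t} => val t)
  (g' := fun b => exist (fun t => tag_ok #|B| t) b (ok b)) _ _ _ (@cone_const_coprod R #|B|.+1)) => //.
- by move=> [t H]; exact: val_inj.
- by move=> [t H]; rewrite /piece (negbTE B0) (negbTE eB) /=; exact: phe_refl.
Qed.

End Pieces.

Section Indexing.
Context (m : nat).
Notation subsets i := (enum [set A : {set 'I_m} | #|A| == i]%SET).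

Lemma size_subsets i : size (subsets i) = 'C(m, i).
Proof. by rewrite -cardE card_draws card_ord. Qed.

Lemma mem_subsets i (A : {set 'I_m}) : (A \in subsets i) = (#|A| == i).
Proof. by rewrite mem_enum inE. Qed.

(* The summand [(i, k, _)] of the wedge belongs to the k-th subset with i elements. *)
Definition idx_set (c : rhs_index m.+1) : {set 'I_m} :=
  nth finset.set0 (subsets (val c).1.1) (val c).1.2.

Lemma rhs_indexP (c : rhs_index m.+1) :
  [/\ ((val c).1.2 < 'C(m, (val c).1.1))%N & tag_ok (val c).1.1 (val c).2].
Proof. by case: c => -[[i j] t] /= /and3P[_ ? ?]. Qed.

Lemma card_idx_set c : #|idx_set c| = (val c).1.1.
Proof.
by apply/eqP; rewrite -mem_subsets mem_nth // size_subsets; case: (rhs_indexP c).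
Qed.

Lemma tag_idx c : tag_ok #|idx_set c| (val c).2.
Proof. by rewrite card_idx_set; case: (rhs_indexP c). Qed.

Lemma set_idx_valid (B : {set 'I_m}) t : tag_ok #|B| t ->
  rhs_valid m.+1 (#|B|, index B (subsets #|B|), t).
Proof.
move=> tB; apply/and3P; split=> //.
  by rewrite ltnS -[X in (_ <= X)%N]card_ord max_card.
by rewrite -size_subsets index_mem mem_subsets.
Qed.

Definition to_sets (c : rhs_index m.+1) : {B : {set 'I_m} & {t : bool | tag_ok #|B| t}} :=
  existT _ (idx_set c) (exist (fun t => tag_ok #|idx_set c| t) (val c).2 (tag_idx c)).

Definition of_sets (k : {B : {set 'I_m} & {t : bool | tag_ok #|B| t}}) : rhs_index m.+1 :=
  exist (fun c => rhs_valid m.+1 c) _ (set_idx_valid (valP (projT2 k))).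

Lemma to_setsK : cancel to_sets of_sets.
Proof.
move=> c; apply: val_inj => /=; have E := card_idx_set c.
have lt_c : ((val c).1.2 < size (subsets (val c).1.1))%N.
  by rewrite size_subsets; case: (rhs_indexP c).
by rewrite E index_uniq ?enum_uniq // -!surjective_pairing.
Qed.

Lemma of_setsK : cancel of_sets to_sets.
Proof.
move=> [B [t H]]; rewrite /to_sets.
have E : idx_set (of_sets (existT _ B (exist (fun t => tag_ok #|B| t) t H))) = B.
  by rewrite /idx_set /= nth_index // mem_subsets.
move: (tag_idx _); rewrite E /= => H'; congr (existT _ B _); exact: val_inj.
Qed.

End Indexing.

Lemma phe_homotopy_equivalent (R : realType) (X Y : pspace) :
  @phe R X Y -> @homotopy_equivalent R X Y.
Proof.
have H (Z : pspace) (f g : Z -> Z) : @phtp R Z Z f g -> @homotopic R Z Z f g.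
  move=> [K [cK [K0 [K1 _]]]].
  exists (fun p => K (p.1, set_val p.2)); split; last first.
    by split=> x t tE; rewrite /= tE.
  by move=> p; apply: (cat_compc cK); cat_auto.
move=> [f [g [[cf _] [[cg _] [gf fg]]]]]; exists f, g.
by split=> //; split=> //; split; exact: H.
Qed.

Theorem mainTheorem16 (R : realType) (n : nat) :
  (1 <= n)%N ->
  @homotopy_equivalent R (@reduced_suspension R (@Kn R n)) (@rhs_wedge R n).
Proof.
case: n => // m _.
(* The summand S^2, present for every n, supplies the base point of the wedge. *)
have valid0 : rhs_valid m.+1 (0%N, 0%N, false) by rewrite /= bin0.
pose c0 : rhs_index m.+1 := exist (fun c => rhs_valid m.+1 c) _ valid0.
have wedge := @wedge_coprod R (rhs_index m.+1) (@rhs_piece R m.+1) c0.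
have sets := hcoprod_sig (@mod_piece R m) (@mod_coprod R m).
have susp := hcoprod_pher sets (phe_sym (@start_phe R m)).
apply: (@phe_homotopy_equivalent R (@susp_K R m) (wedge_space (@rhs_piece R m.+1) c0)).
apply: hcoprod_uniq wedge.
apply: (hcoprod_reindex (@to_setsK m) (@of_setsK m) _ susp) => c.
by rewrite rhs_pieceE /= card_idx_set; exact: phe_refl.
Qed.
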